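(* Fix $0<p<1<q<\infty$ and $d\ge1$. For a family $\{X_\alpha\}$ of $\mathbb{R}^d$-valued random variables with distributions $\mu_\alpha$, consider the properties: (1) $\{|X_\alpha|\}$ is st-bounded by a $q$-integrable r.v.; (2) $\{|X_\alpha|^q\}$ is icx-bounded by an integrable r.v.; (3) $\{X_\alpha\}$ is bounded in $L^q$; (4) $\{|X_\alpha|\}$ is st-bounded by an integrable r.v.; (5) $\{|X_\alpha|\}$ is icx-bounded by an integrable r.v.; (6) $\{X_\alpha\}$ is bounded in $L^1$; (7) $\{|X_\alpha|\}$ is st-bounded by a $p$-integrable r.v.; (8) $\{|X_\alpha|^p\}$ is icx-bounded by an integrable r.v.; (9) $\{X_\alpha\}$ is bounded in $L^p$; (10) $\{|X_\alpha|\}$ is st-bounded by a finite r.v. Then: (1) is equivalent to ''$\{|X_\alpha|^q\}$ is st-bounded by an integrable r.v.'' and to ''$\{|X_\alpha|\}$ is icx-bounded by a $q$-integrable r.v.''; (2) is equivalent to ''$\{X_\alpha\}$ is uniformly $q$-integrable'' and to ''$\{\mu_\alpha\}$ is relatively compact in $(M_q,d_{W,q})$''; (3) is equivalent to ''$\{\mu_\alpha\}$ is bounded in $(M_q,d_{W,q})$''; (5) is equivalent to ''$\{X_\alpha\}$ is uniformly integrable'' and to ''$\{\mu_\alpha\}$ is relatively compact in $(M_1,d_{W,1})$''; (6) is equivalent to ''$\{\mu_\alpha\}$ is bounded in $(M_1,d_{W,1})$''; (7) is equivalent to ''$\{|X_\alpha|^p\}$ is st-bounded by an integrable r.v.'';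 (8) is equivalent to ''$\{X_\alpha\}$ is uniformly $p$-integrable''; (10) is equivalent to ''$\{X_\alpha\}$ is tight'' and to ''$\{\mu_\alpha\}$ is relatively compact in $(M,d_P)$''. Moreover (1)$\Rightarrow$(2)$\Rightarrow$(3)$\Rightarrow$(4)$\Rightarrow$(5)$\Rightarrow$(6)$\Rightarrow$(7)$\Rightarrow$(8)$\Rightarrow$(9)$\Rightarrow$(10), and none of these nine implications can be reversed in general: for each $k\in\{1,\dots,9\}$ there is a family satisfying property $(k+1)$ but not property $(k)$.
   Context: ''Positive'' means nonnegative; the random variables need not be on a common probability space; $|\cdot|$ is the Euclidean norm. $X_1\le_{\mathrm{st}}X_2$ means $\mathbb{P}(X_1>t)\le\mathbb{P}(X_2>t)$ for all $t$; for positive $X_1,X_2$, $X_1\le_{\mathrm{icx}}X_2$ means $\mathbb{E}(X_1-t)_+\le\mathbb{E}(X_2-t)_+$ for all $t\ge0$ (equivalently $\mathbb{E}\phi(X_1)\le\mathbb{E}\phi(X_2)$ for all increasing convex $\phi:\mathbb{R}_+\to\mathbb{R}_+$). A family of positive r.v.'s $\{Z_\alpha\}$ is st-bounded (icx-bounded) by $Y$ if $Z_\alpha\le_{\mathrm{st}}Y$ ($Z_\alpha\le_{\mathrm{icx}}Y$) for all $\alpha$. A r.v. is $r$-integrable if $\mathbb{E}|Y|^r<\infty$; a positive r.v. (possibly taking value $\infty$) is finite if $\mathbb{P}(Y<\infty)=1$. $\{X_\alpha\}$ is uniformly $r$-integrable if $\sup_\alpha\mathbb{E}|X_\alpha|^r1(|X_\alpha|>t)\to0$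 as $t\to\infty$ (uniformly integrable when $r=1$), tight if $\sup_\alpha\mathbb{P}(|X_\alpha|>t)\to0$, bounded in $L^r$ if $\sup_\alpha\mathbb{E}|X_\alpha|^r<\infty$. $M$ is the space of Borel probability measures on $\mathbb{R}^d$ with the Prohorov metric $d_P(\mu,\nu)=\inf\{\epsilon>0:\mu(B)\le\nu(B^\epsilon)+\epsilon,\ \nu(B)\le\mu(B^\epsilon)+\epsilon\ \forall B\}$, $B^\epsilon$ the open $\epsilon$-neighbourhood of $B$. For $r\ge1$, $M_r$ is the set of $\mu\in M$ with finite $r$-th moment and $d_{W,r}(\mu,\nu)=\bigl(\inf_{\gamma}\int|x-y|^r\,\gamma(dx,dy)\bigr)^{1/r}$, the infimum over couplings $\gamma$ of $\mu$ and $\nu$ ($r$-Wasserstein metric). *)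

(* Defs.v *)
From HB Require Import structures.
From mathcomp Require Import all_boot all_order all_algebra.
From mathcomp Require Import all_classical all_reals all_analysis.
From mathcomp Require Import measurable_realfun.
Set Implicit Arguments.
Unset Strict Implicit.
Unset Printing Implicit Defensive.
Import Order.TTheory GRing.Theory Num.Theory.
Local Open Scope classical_set_scope.
Local Open Scope ring_scope.

Section Defs.
Variable R : realType.

Definition eucl {d : nat} (x : 'rV[R]_d) : R :=
  Num.sqrt (\sum_(i < d) x ord0 i ^+ 2).

Definition eopen (d : nat) : set (set 'rV[R]_d) :=
  [set U | forall x, U x ->
     exists2 r : R, 0 < r & [set y | eucl (y - x) < r] `<=` U].

Definition Rd (d : nat) : Type := 'rV[R]_d.
HB.instance Definition _ (d : nat) := Choice.on (Rd d).
HB.instance Definition _ (d : nat) := isPointed.Build (Rd d) 0.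
HB.instance Definition _ (d : nat) :=
  Measurable.copy (Rd d) (@g_sigma_algebraType (Rd d) (@eopen d)).

Variable d : nat.

Record RVec := MkRVec {
  rv_disp : measure_display;
  rv_T : measurableType rv_disp;
  rv_P : probability rv_T R;
  rv_X : {RV rv_P >-> Rd d} }.

Record PosRV := MkPosRV {
  py_disp : measure_display;
  py_T : measurableType py_disp;
  py_P : probability py_T R;
  py_Y : {RV py_P >-> \bar R};
  py_ge0 : forall w, (0 <= py_Y w)%E }.

Local Open Scope ereal_scope.

Definition law (X : RVec) : probability (Rd d) R := distribution (rv_P X) (rv_X X).

Definition nrm (X : RVec) : rv_T X -> \bar R := fun w => (eucl (rv_X X w))%:E.
Definition nrmp (X : RVec) (s : R) : rv_T X -> \bar R :=
  fun w => (powR (eucl (rv_X X w)) s)%:E.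
Arguments nrm : clear implicits.
Arguments nrmp : clear implicits.

Definition st_le d1 d2 (T1 : measurableType d1) (T2 : measurableType d2)
  (P1 : probability T1 R) (Z1 : T1 -> \bar R)
  (P2 : probability T2 R) (Z2 : T2 -> \bar R) : Prop :=
  forall t : R, P1 [set w | t%:E < Z1 w] <= P2 [set w | t%:E < Z2 w].

Definition icx_le d1 d2 (T1 : measurableType d1) (T2 : measurableType d2)
  (P1 : probability T1 R) (Z1 : T1 -> \bar R)
  (P2 : probability T2 R) (Z2 : T2 -> \bar R) : Prop :=
  forall t : R, (0 <= t)%R ->
    \int[P1]_w maxe (Z1 w - t%:E) 0 <= \int[P2]_w maxe (Z2 w - t%:E) 0.

Definition integrableY (Y : PosRV) : Prop :=
  \int[py_P Y]_w py_Y Y w < +oo.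
Definition r_integrableY (r : R) (Y : PosRV) : Prop :=
  \int[py_P Y]_w poweR (py_Y Y w) r < +oo.
Definition finiteY (Y : PosRV) : Prop :=
  py_P Y [set w | py_Y Y w < +oo] = 1.

Section family.
Variable I : Type.
Variable X : I -> RVec.

Definition st_bounded (Z : forall i, rv_T (X i) -> \bar R) (Y : PosRV) :=
  forall i, st_le (rv_P (X i)) (Z i) (py_P Y) (py_Y Y).
Definition icx_bounded (Z : forall i, rv_T (X i) -> \bar R) (Y : PosRV) :=
  forall i, icx_le (rv_P (X i)) (Z i) (py_P Y) (py_Y Y).

Definition bounded_Lr (r : R) : Prop :=
  exists C : R, forall i, \int[rv_P (X i)]_w nrmp (X i) r w <= C%:E.

Definition unif_r_integrable (r : R) : Prop :=
  forall eps : R, (0 < eps)%R -> exists t0 : R, forall t : R, (t0 <= t)%R ->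
    forall i, \int[rv_P (X i)]_(w in [set w | (t < eucl (rv_X (X i) w))%R])
                 nrmp (X i) r w <= eps%:E.

Definition tight : Prop :=
  forall eps : R, (0 < eps)%R -> exists t0 : R, forall t : R, (t0 <= t)%R ->
    forall i, rv_P (X i) [set w | (t < eucl (rv_X (X i) w))%R] <= eps%:E.

Definition laws : set (probability (Rd d) R) := range (fun i => law (X i)).

End family.

Definition PM := probability (Rd d) R.

Definition Mr (r : R) : set PM :=
  [set mu : PM | \int[mu]_x (powR (@eucl d x) r)%:E < +oo].

Definition eps_nbhd (B : set 'rV[R]_d) (e : R) : set 'rV[R]_d :=
  [set x | exists2 y, B y & (eucl (x - y) < e)%R].

Definition dP (mu nu : PM) : \bar R :=
  ereal_inf [set e%:E | e in [set e : R | (0 < e)%R /\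
     forall B : set (Rd d), measurable B ->
       mu B <= nu (eps_nbhd B e) + e%:E /\ nu B <= mu (eps_nbhd B e) + e%:E]].

Definition couplings (mu nu : PM) : set (probability (Rd d * Rd d)%type R) :=
  [set g | forall A : set (Rd d), measurable A ->
     g (A `*` setT) = mu A /\ g (setT `*` A) = nu A].

Definition dW (r : R) (mu nu : PM) : \bar R :=
  poweR (ereal_inf [set \int[g]_z (powR (eucl (z.1 - z.2 : 'rV[R]_d)) r)%:E
                   | g in couplings mu nu]) r^-1.

End Defs.
Arguments nrm {R d}.
Arguments nrmp {R d}.

Section metric.
Variables (R : realType) (X : Type) (S : set X) (dist : X -> X -> \bar R).
Local Open Scope ereal_scope.

Definition mball (x : X) (r : R) : set X := [set y | S y /\ dist x y < r%:E].

Definition mopen (U : set X) : Prop :=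
  U `<=` S /\ forall x, U x -> exists2 r : R, (0 < r)%R & mball x r `<=` U.

Definition mclosure (A : set X) : set X :=
  [set x | S x /\ forall r : R, (0 < r)%R -> (A `&` mball x r) !=set0].

Definition mcompact (K : set X) : Prop :=
  K `<=` S /\
  forall F : set (set X), (forall U, F U -> mopen U) ->
    K `<=` \bigcup_(U in F) U ->
    exists G : set (set X), [/\ finite_set G, G `<=` F & K `<=` \bigcup_(U in G) U].

Definition rel_compact (A : set X) : Prop := A `<=` S /\ mcompact (mclosure A).

Definition mbounded (A : set X) : Prop :=
  A `<=` S /\ exists C : R, forall x y, A x -> A y -> dist x y <= C%:E.

End metric.

Arguments st_bounded {R d I} X Z Y.
Arguments icx_bounded {R d I} X Z Y.
Section props.
Variables (R : realType) (d : nat) (p q : R) (I : Type) (X : I -> RVec R d).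
Local Open Scope ereal_scope.

Let nX i := nrm (X i).
Let nXp s i := nrmp (X i) s.

Definition prop1 := exists Y, r_integrableY q Y /\ st_bounded X nX Y.
Definition prop2 := exists Y, integrableY Y /\ icx_bounded X (nXp q) Y.
Definition prop3 := bounded_Lr X q.
Definition prop4 := exists Y, integrableY Y /\ st_bounded X nX Y.
Definition prop5 := exists Y, integrableY Y /\ icx_bounded X nX Y.
Definition prop6 := bounded_Lr X 1.
Definition prop7 := exists Y, r_integrableY p Y /\ st_bounded X nX Y.
Definition prop8 := exists Y, integrableY Y /\ icx_bounded X (nXp p) Y.
Definition prop9 := bounded_Lr X p.
Definition prop10 := exists Y, finiteY Y /\ st_bounded X nX Y.

Definition prop (k : nat) : Prop :=
  match k with
  | 1 => prop1 | 2 => prop2 | 3 => prop3 | 4 => prop4 | 5 => prop5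
  | 6 => prop6 | 7 => prop7 | 8 => prop8 | 9 => prop9 | 10 => prop10
  | _ => True
  end%N.

End props.

(* Main.v *)
(** A family of positive random variables whose tails (or expected excesses
    E(Z - b_n)_+) are bounded along a sequence b_n by g_n is dominated by
    Y = sum_n c_n 1{U < g_n} with U uniform on [0, 1]; since E Y = sum_n c_n g_n,
    each moment or tail condition produces an explicit st- or icx-bound, with
    b_n = 2^n in most cases.  Conversely P(Y > t) and E(Y - t)_+ tend to 0.  The
    counterexamples are the spikes 2^n e_0 carried with probability 2^(-ns) or
    2^(-ns)/(n+1).

    Relative compactness implies the tail conditions because the sets
    {mu : tail beyond n < e} form an increasing open cover.  For the converse,
    follow an ultrafilter of laws: the limiting masses of the cells cut out by
    finitely many conditions a <= x_i (a rational) define a binary tree, the tree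
    a quantile-like map X from [0, 1) to R^d, and the law of X is the limit.
    Gluing along finitely many cells couples X with the laws of the
    ultrafilter so that the two points are close with high probability; this
    bounds the Prohorov distance, and the r-Wasserstein distance when r-th moments
    have uniformly small tails. *)
Require Import Defs.
From HB Require Import structures.
From mathcomp Require Import all_boot all_order all_algebra.
From mathcomp Require Import all_classical all_reals all_analysis.
From mathcomp Require Import measurable_realfun.
From mathcomp Require Import ring lra.
Import Order.TTheory GRing.Theory Num.Theory.
Local Open Scope classical_set_scope.
Local Open Scope ring_scope.
Set Implicit Arguments.
Unset Strict Implicit.
Unset Printing Implicit Defensive.

(** * Tails and dominating random variables *)

(** Compactness is understood through open covers, for distances that are mere functions with values
    in the extended reals. Ultrafilters fit this definition directly, without passing to
    subsequences. Both distances are compared with one relation, [near]: some coupling puts the two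
    points within e of each other off a set of mass e. Going from [near] to a Wasserstein distance
    requires control of the r-th moment beyond a level n. This is measured by (|x| - n)_+^r and not
    by |x|^r 1{|x| > n}: the former is stable under small displacements of x, so a bound on it
    extends to the closure of a family and passes to the limit law. The two kinds of spikes are
    tuned so that the s-th moment of the n-th spike is exactly 1, respectively 1/(n+1). The first
    sequence is bounded without vanishing; the second vanishes without being summable, and an
    st-bound would force summability. *)

Section tails.
Variable R : realType.
Local Open Scope ereal_scope.

Lemma measurable_gt_ereal d (T : measurableType d) (W : T -> \bar R) (t : \bar R) :
  measurable_fun setT W -> measurable [set w | t < W w].
Proof. by move=> mW; rewrite -[X in measurable X]setTI; exact: emeasurable_fun_o_infty. Qed.

(** Tonelli on the region between 0 and the graph of W: integrating over s first gives the length of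
    [0, W w), which may be infinite, and integrating over w first gives the tail. *)
Lemma layer_cake d (T : measurableType d) (P : probability T R) (W : T -> \bar R) :
  measurable_fun setT W -> (forall w, 0 <= W w) ->
  \int[P]_w W w =
  \int[@lebesgue_measure R]_(s in `[0%R, +oo[) P [set w | s%:E < W w].
Proof.
move=> mW W0.
pose A : set (T * measurableTypeR R) := [set p | (0 <= p.2)%R /\ p.2%:E < W p.1].
have mA : measurable A.
  have m1 : measurable [set p : T * measurableTypeR R | (0 <= p.2)%R].
    rewrite (_ : [set _ | _] = snd @^-1` `[0%R, +oo[); last first.
      by apply/seteqP; split=> p /=; rewrite in_itv/= andbT.
    by rewrite -[X in measurable X]setTI; apply: measurable_snd.
  have m2 : measurable [set p : T * measurableTypeR R | p.2%:E < W p.1].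
    rewrite -[X in measurable X]setTI.
    apply: emeasurable_fun_lt => //.
      by have /measurable_EFinP : measurable_fun setT (snd : T * measurableTypeR R -> measurableTypeR R) by exact: measurable_snd.
    exact: measurableT_comp.
  exact: measurableI.
transitivity (\int[P]_w \int[@lebesgue_measure R]_s (\1_A (w, s))%:E).
  apply: eq_integral => w _.
  pose B : set R := [set s : R | (0 <= s)%R /\ s%:E < W w].
  transitivity (\int[@lebesgue_measure R]_s (\1_B s)%:E); last first.
    by apply: eq_integral => s _; congr (_%:E); rewrite !indicE; congr (nat_of_bool _)%:R;
      apply/asbool_equiv_eq.
  have E : B =
      match W w with r%:E => `[0%R, r[%classic | +oo => `[0%R, +oo[%classic | _ => set0 end.
    apply/seteqP; split => s /=; rewrite /B/=; case: (W w) (W0 w) => [r| |] //= r0; rewrite ?in_itv/= ?andbT.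
    - by rewrite lte_fin => -[-> ->].
    - by case.
    - by case/andP => ? ?; rewrite lte_fin.
    - by move=> ?; rewrite ltry.
  rewrite E integral_indic ?setIT//; last by case: (W w).
  case: (W w) (W0 w) => [r| |] //= r0.
    rewrite lebesgue_measure_itv/= lte_fin; case: ifPn => [_|].
      by rewrite oppr0 addr0.
    by rewrite -leNgt => r0'; congr (_%:E); apply/eqP; rewrite eq_le r0' -lee_fin r0.
  by rewrite lebesgue_measure_itv/= ltry.
rewrite (@fubini_tonelli _ _ _ _ _ P (@lebesgue_measure R) (fun p => (\1_A p)%:E))//.
- rewrite [RHS]integral_mkcond; apply: eq_integral => s _ /=; rewrite patchE.
  pose B : set T := [set x | (0 <= (s : R))%R /\ (s : R)%:E < W x].
  rewrite [LHS](_ : _ = \int[P]_x (\1_B x)%:E); last first.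
    by apply: eq_integral => x _; congr (_%:E); rewrite !indicE; congr (nat_of_bool _)%:R;
      apply/asbool_equiv_eq.
  case: ifPn => [|/negP]; rewrite inE/= in_itv/= andbT => s0.
    rewrite integral_indic ?setIT//.
      by congr (P _); apply/seteqP; split=> x //= [].
    rewrite (_ : B = [set x | (s : R)%:E < W x]); last first.
      by apply/seteqP; split=> x //= [].
    exact: measurable_gt_ereal.
  rewrite (_ : B = set0); last by apply/seteqP; split=> x //= [].
  by under eq_integral do rewrite indic0; rewrite integral0.
- by apply/measurable_EFinP/measurable_indic.
Qed.

(** The integrands of the layer-cake formula are compared pointwise; since the formula only sees
    levels s >= 0, the tail hypothesis is asked for there alone. *)
Lemma st_le_integral d1 d2 (T1 : measurableType d1) (T2 : measurableType d2)
  (P1 : probability T1 R) (Z1 : T1 -> \bar R) (P2 : probability T2 R) (Z2 : T2 -> \bar R) :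
  measurable_fun setT Z1 -> measurable_fun setT Z2 ->
  (forall w, 0 <= Z1 w) -> (forall w, 0 <= Z2 w) ->
  (forall t : R, (0 <= t)%R -> P1 [set w | t%:E < Z1 w] <= P2 [set w | t%:E < Z2 w]) ->
  \int[P1]_w Z1 w <= \int[P2]_w Z2 w.
Proof.
have nincr d (T : measurableType d) (P : probability T R) (Z : T -> \bar R) :
    measurable_fun setT Z ->
    measurable_fun (`[0%R, +oo[ : set R) (fun s : R => P [set w | s%:E < Z w]).
  move=> mZ; have fn (s : R) : P [set w | s%:E < Z w] \is a fin_num.
    by rewrite fin_num_measure//; exact: measurable_gt_ereal.
  rewrite (_ : (fun s : R => _) = EFin \o (fun s : R => fine (P [set w | s%:E < Z w]))).
    apply/measurable_EFinP/measurable_funTS.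
    apply: nonincreasing_measurable => // s t st.
    rewrite fine_le//; apply: le_measure.
    - by rewrite inE; exact: measurable_gt_ereal.
    - by rewrite inE; exact: measurable_gt_ereal.
    - by move=> w /=; apply: le_lt_trans; rewrite lee_fin.
  by apply/funext => s /=; rewrite fineK.
move=> mZ1 mZ2 Z10 Z20 H; rewrite !layer_cake//.
apply: ge0_le_integral => //.
- exact: nincr.
- exact: nincr.
- by move=> s /=; rewrite in_itv/= andbT => /H.
Qed.

End tails.

Section stairs.
Variable R : realType.
Local Open Scope ereal_scope.

Let U : probability (measurableTypeR R) R := uniform_prob (@ltr01 R).

Lemma uniform01E (A : set (measurableTypeR R)) : measurable A ->
  U A = @lebesgue_measure R (A `&` `[0%R, 1%R]).
Proof.
move=> mA; rewrite /U/= /uniform_prob integral_uniform_pdf.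
rewrite (eq_integral (fun=> 1)).
  by rewrite integral_cst//= ?mul1e//; exact: measurableI.
move=> x; rewrite inE/= in_itv/= => -[_ x01].
by rewrite /uniform_pdf x01 subr0 invr1.
Qed.

Lemma uniform01_itv (a b : R) : (0 <= a)%R -> (a <= b)%R -> (b <= 1)%R ->
  U `[a, b[%classic = (b - a)%:E.
Proof.
move=> a0 ab b1; rewrite uniform01E//.
rewrite (_ : _ `&` _ = `[a, b[%classic); last first.
  apply/seteqP; split=> x /=; rewrite !in_itv/=; first by case.
  by move=> /andP[ax xb]; rewrite ax xb (le_trans a0 ax) (ltW (lt_le_trans xb b1)).
rewrite lebesgue_measure_itv/= lte_fin; case: ltP => // ba.
by rewrite (_ : b = a) ?subrr//; apply/eqP; rewrite eq_le ba ab.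
Qed.

Lemma uniform01_lt (g : R) : (0 <= g <= 1)%R -> U [set u | (u < g)%R] = g%:E.
Proof.
move=> /andP[g0 g1]; rewrite uniform01E; last first.
  by rewrite (_ : [set _ | _] = `]-oo, g[%classic)//; apply/seteqP; split=> x /=; rewrite in_itv.
rewrite -[in RHS](subr0 g) -(uniform01_itv (lexx 0) g0 g1) uniform01E//.
congr (lebesgue_measure _); apply/seteqP; split => x /=; rewrite !in_itv/=.
  by move=> [-> /andP[-> ->]].
by move=> [/andP[_ ->] ->].
Qed.

Variables c g : nat -> R.
Hypothesis c0 : forall n, (0 <= c n)%R.
Hypothesis g01 : forall n, (0 <= g n <= 1)%R.

Let step n : set (measurableTypeR R) := [set u | (u < g n)%R].

Let mstep n : measurable (step n).
Proof.
by rewrite (_ : step n = `]-oo, g n[%classic)//; apply/seteqP; split=> x /=; rewrite in_itv.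
Qed.

Let Ustep n : U (step n) = (g n)%:E.
Proof. exact: uniform01_lt. Qed.

Definition stair (u : measurableTypeR R) : \bar R :=
  \sum_(n <oo) (c n * \1_(step n) u)%:E.

Let term_ge0 n u : 0 <= (c n * \1_(step n) u)%:E.
Proof. by rewrite lee_fin mulr_ge0// indicE. Qed.

Let mterm n : measurable_fun setT (fun u => (c n * \1_(step n) u)%:E).
Proof. by apply/measurable_EFinP; apply: measurable_funM => //; exact: measurable_indic. Qed.

Lemma measurable_stair : measurable_fun setT stair.
Proof. by apply: ge0_emeasurable_sum => // *; exact: mterm. Qed.

Lemma stair_ge0 u : 0 <= stair u.
Proof. by apply: nneseries_ge0 => n _ _; exact: term_ge0. Qed.

Definition stairRV : PosRV R :=
  @MkPosRV R _ _ U (mfun_Sub (mem_set measurable_stair)) stair_ge0.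

Lemma stair_ge n u : (u < g n)%R -> (c n)%:E <= stair u.
Proof.
move=> un; rewrite /stair (@nneseriesD1 _ _ n)//= ?indicE ?mem_set//.
by rewrite mulr1 leeDl// nneseries_ge0// => k _ _; exact: term_ge0.
Qed.

(** On {U < g n} the n-th term of the series alone exceeds t. *)
Lemma stair_tail n (t : R) : (t < c n)%R -> (g n)%:E <= py_P stairRV [set u | t%:E < py_Y stairRV u].
Proof.
move=> tc; rewrite -Ustep; apply: le_measure.
- by rewrite inE; exact: mstep.
- by rewrite inE; apply: measurable_gt_ereal; exact: measurable_stair.
- move=> u /= un; apply: lt_le_trans (stair_ge un); by rewrite lte_fin.
Qed.

Lemma integral_stair : \int[U]_u stair u = \sum_(n <oo) (c n * g n)%:E.
Proof.
rewrite integral_nneseries//.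
apply: eq_eseriesr => n _; under eq_integral do rewrite EFinM.
rewrite ge0_integralZl_EFin//.
- rewrite (integral_indic _ _ (mstep n))// setIT.
  by rewrite EFinM; congr (_ * _); exact: Ustep.
- by apply/measurable_EFinP/measurable_indic.
Qed.

Lemma stairRV_integrable : \sum_(n <oo) (c n * g n)%:E < +oo -> integrableY stairRV.
Proof. by rewrite /integrableY/= integral_stair. Qed.

(* [stair u] is a finite sum for u > 0. *)
Lemma stairRV_finite : (forall n m, (n <= m)%N -> (g m <= g n)%R) ->
  (forall e : R, (0 < e)%R -> exists n, (g n < e)%R) -> finiteY stairRV.
Proof.
move=> gd g0; rewrite /finiteY/=.
have mfin : measurable [set w | stair w < +oo].
  by rewrite -[X in measurable X]setTI; apply: emeasurable_fun_infty_o => //; exact: measurable_stair.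
suff H : U (~` [set w | stair w < +oo]) = 0.
  by have := probability_setC U (measurableC mfin); rewrite setCK H sube0.
apply/eqP; rewrite eq_le measure_ge0 andbT.
apply/lee_addgt0Pr => e e0; rewrite add0e.
have [n gn] := g0 _ e0; apply: (@le_trans _ _ (U (step n))); last first.
  by rewrite Ustep lee_fin ltW.
apply: le_measure; rewrite ?inE//; first exact: measurableC.
move=> u /= /negP; rewrite -leNgt leye_eq => /eqP uoo.
rewrite /step/= ltNge; apply/negP => gu.
suff : stair u < +oo by rewrite uoo.
rewrite /stair (@nneseries_split _ _ 0 n); last by move=> k _; exact: term_ge0.
rewrite [X in _ + X]eseries0 ?adde0; last first.
  move=> k; rewrite add0n => nk _; rewrite indicE memNset ?mulr0//= => uk.
  by have := gd _ _ nk; rewrite leNgt (le_lt_trans gu uk).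
by rewrite sumEFin ltry.
Qed.

End stairs.

Section dominate.
Variables (R : realType) (d : nat) (I : Type) (X : I -> RVec R d).
Variable Z : forall i, rv_T (X i) -> R.
Hypothesis mZ : forall i, measurable_fun setT (@Z i).
Variable b : nat -> R.
Hypothesis b0 : b 0%N = 0.
Hypothesis bge0 : forall n, 0 <= b n.
Hypothesis b_unbounded : forall t : R, exists n, t < b n.
Local Open Scope ereal_scope.

(** Some of the level sequences used below are not known to be monotone, so the least index with t <
    b n is taken; b 0 = 0 makes it a successor. *)
Lemma bracket (t : R) : (0 <= t)%R -> exists n, (b n <= t < b n.+1)%R.
Proof.
move=> t0; have [n] := ex_minnP (b_unbounded t).
case: n => [|n]; first by rewrite b0 => /(le_lt_trans t0); rewrite ltxx.
move=> tn min; exists n; rewrite tn andbT leNgt; apply/negP => /min.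
by rewrite ltnn.
Qed.

Lemma measurable_gt_fun i (t : R) : measurable [set w | (t < @Z i w)%R].
Proof.
have /measurable_EFinP/(measurable_gt_ereal t%:E) := @mZ i.
by under eq_set do rewrite lte_fin.
Qed.

(** For b n <= t < b n.+1 the tail at t is at most the tail at b n, hence at most g n. On {U < g n}
    the stair must therefore exceed every such t, which is why its n-th height is b n.+1. *)
Lemma st_bounded_stair (g : nat -> R) (g01 : forall n, (0 <= g n <= 1)%R) :
  (forall i n, rv_P (X i) [set w | (b n < @Z i w)%R] <= (g n)%:E) ->
  st_bounded X (fun i w => (Z w)%:E) (stairRV g (fun n => bge0 n.+1)).
Proof.
move=> H i t; have [t0|t0] := ltP t 0%R.
  rewrite [X in _ <= py_P _ X](_ : _ = setT) ?probability_setT.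
    by apply: probability_le1; apply: measurable_gt_ereal; exact/measurable_EFinP.
  apply/seteqP; split => // u _ /=; apply: lt_le_trans (stair_ge0 _ _ _); first by rewrite lte_fin.
  by move=> n; exact: bge0.
have [n /andP[bn tb]] := bracket t0.
apply: le_trans (stair_tail _ g01 tb); apply: le_trans (H i n).
apply: le_measure; rewrite ?inE.
- by apply: measurable_gt_ereal; exact/measurable_EFinP.
- exact: measurable_gt_fun.
- by move=> w /=; rewrite lte_fin; exact: le_lt_trans.
Qed.

(** For b n <= t < b n.+1, the stair exceeds t by at least K n on {U < g n}, so its expected excess
    is at least K n * g n. The probability g n can thus be chosen small, with K n compensating. *)
Lemma icx_bounded_stair (g K : nat -> R) (g01 : forall n, (0 <= g n <= 1)%R)
  (cge0 : forall n, (0 <= b n.+1 + K n)%R) : (forall n, (0 <= K n)%R) ->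
  (forall i n, \int[rv_P (X i)]_w maxe ((@Z i w)%:E - (b n)%:E) 0 <= (K n * g n)%:E) ->
  icx_bounded X (fun i w => (Z w)%:E) (stairRV g cge0).
Proof.
move=> K0 H i t t0.
have mmax (s : R) : measurable_fun setT (fun w => maxe ((@Z i w)%:E - s%:E) 0).
  apply: measurable_maxe => //; apply: emeasurable_funB => //.
  exact/measurable_EFinP.
have [n /andP[bn tb]] := bracket t0.
apply: (@le_trans _ _ (\int[rv_P (X i)]_w maxe ((@Z i w)%:E - (b n)%:E) 0)).
  apply: ge0_le_integral => //.
  - by move=> w _; rewrite le_max lexx orbT.
  - by move=> w _; rewrite ge_max !le_max lexx orbT andbT leeB// lee_fin.
apply: le_trans (H i n) _.
have mY : measurable_fun setT (fun u => maxe (stair (fun n => b n.+1 + K n)%R g u - t%:E) 0).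
  apply: measurable_maxe => //; apply: emeasurable_funB => //.
  exact: measurable_stair.
pose A : set (measurableTypeR R) := [set u | (u < g n)%R].
have mA : measurable A.
  by rewrite (_ : A = `]-oo, g n[%classic)//; apply/seteqP; split=> x /=; rewrite in_itv.
have <- : \int[uniform_prob (@ltr01 R)]_u ((K n)%:E * (\1_A u)%:E) = (K n * g n)%:E.
  rewrite ge0_integralZl_EFin//; last exact/measurable_EFinP/measurable_indic.
  by rewrite integral_indic// setIT EFinM; congr (_ * _); exact: uniform01_lt.
apply: ge0_le_integral => //=.
- by move=> u _; rewrite mule_ge0// lee_fin.
- by apply: measurable_funeM; apply/measurable_EFinP/measurable_indic.
- move=> u _; rewrite indicE; case: (asboolP (u < g n)%R) => un.
    rewrite mem_set// mule1 le_max; apply/orP; left.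
    rewrite EFinN leeBrDr//.
    apply: le_trans (stair_ge cge0 un); rewrite lee_fin addrC lerD2r; exact: ltW.
  by rewrite memNset// mule0 le_max lexx orbT.
Qed.

End dominate.

(** * Euclidean space *)

Section euclidean.
Variables (R : realType) (d : nat).
Implicit Types x y : 'rV[R]_d.

Lemma eucl_ge0 x : 0 <= eucl x.
Proof. exact: sqrtr_ge0. Qed.

Lemma eucl_sqr x : eucl x ^+ 2 = \sum_(i < d) x ord0 i ^+ 2.
Proof. by rewrite sqr_sqrtr// sumr_ge0// => i _; exact: sqr_ge0. Qed.

Lemma eucl0 : eucl (0 : 'rV[R]_d) = 0.
Proof. by rewrite /eucl big1 ?sqrtr0// => i _; rewrite mxE expr0n. Qed.

Lemma euclN x : eucl (- x) = eucl x.
Proof. by rewrite /eucl; congr Num.sqrt; apply: eq_bigr => i _; rewrite mxE sqrrN. Qed.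

Lemma eucl_subC x y : eucl (x - y) = eucl (y - x).
Proof. by rewrite -euclN opprB. Qed.

Lemma coord_le_eucl x i : `|x ord0 i| <= eucl x.
Proof.
rewrite -sqrtr_sqr ler_sqrt; last by apply: sumr_ge0 => k _; exact: sqr_ge0.
by rewrite (bigD1 i)//= lerDl sumr_ge0// => k _; exact: sqr_ge0.
Qed.

(** Cauchy-Schwarz: with B = |y|^2 and C the dot product, the sum of squares |B x - C y|^2 expands
    to B ((|x| |y|)^2 - C^2). *)
Lemma dot_le_eucl x y : \sum_(i < d) x ord0 i * y ord0 i <= eucl x * eucl y.
Proof.
(* The dot product is made opaque so that [ring] treats it as an atom inside the sums. *)
have [C CE] : exists C, C = \sum_(i < d) x ord0 i * y ord0 i by eexists.
rewrite -CE.
have [y0|y0] := eqVneq (eucl y) 0.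
  rewrite y0 mulr0 CE big1// => i _.
  by have := coord_le_eucl y i; rewrite y0 normr_le0 => /eqP ->; rewrite mulr0.
have yp : 0 < eucl y ^+ 2 by rewrite exprn_even_gt0//= y0.
suff : C ^+ 2 <= (eucl x * eucl y) ^+ 2.
  move=> /ler_wsqrtr; rewrite !sqrtr_sqr (ger0_norm (mulr_ge0 (eucl_ge0 _) (eucl_ge0 _))).
  by apply: le_trans; exact: ler_norm.
have : 0 <= \sum_(i < d) (eucl y ^+ 2 * x ord0 i - C * y ord0 i) ^+ 2.
  by apply: sumr_ge0 => i _; exact: sqr_ge0.
have -> : \sum_(i < d) (eucl y ^+ 2 * x ord0 i - C * y ord0 i) ^+ 2 =
    eucl y ^+ 2 * ((eucl x * eucl y) ^+ 2 - C ^+ 2).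
  transitivity ((eucl y ^+ 2) ^+ 2 * eucl x ^+ 2 - 2 * eucl y ^+ 2 * C * (\sum_(i < d) x ord0 i * y ord0 i) + C ^+ 2 * eucl y ^+ 2);
    last by rewrite -CE; move: (C) (eucl x) (eucl y) => c a b; ring.
  rewrite [eucl x ^+ 2]eucl_sqr; move: (eucl y ^+ 2) (eucl_sqr y) => B BE.
  rewrite [X in _ = _ + _ * X]BE !mulr_sumr -sumrB -big_split/=.
  apply: eq_bigr => i _; move: (C) (x ord0 i) (y ord0 i) => c a b; ring.
by rewrite pmulr_rge0// subr_ge0.
Qed.

Lemma ler_euclD x y : eucl (x + y) <= eucl x + eucl y.
Proof.
have H : 0 <= eucl x + eucl y by rewrite addr_ge0// eucl_ge0.
rewrite -(ler_pXn2r (n := 2)) ?nnegrE ?eucl_ge0// eucl_sqr.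
have -> : \sum_(i < d) (x + y) ord0 i ^+ 2 =
   eucl x ^+ 2 + (\sum_(i < d) x ord0 i * y ord0 i) *+ 2 + eucl y ^+ 2.
  rewrite !eucl_sqr -sumrMnl -!big_split/=; apply: eq_bigr => i _.
  by rewrite mxE sqrrD.
by rewrite sqrrD lerD2r lerD2l lerMn2r/= dot_le_eucl.
Qed.

Lemma eucl_dist x y : eucl x <= eucl y + eucl (x - y).
Proof. by have := ler_euclD y (x - y); rewrite [y + _]addrC subrK. Qed.

Lemma eucl_le_sum x : eucl x <= \sum_(i < d) `|x ord0 i|.
Proof.
have H : 0 <= \sum_(i < d) `|x ord0 i| by exact: sumr_ge0.
rewrite -(ler_pXn2r (n := 2)) ?nnegrE ?eucl_ge0// eucl_sqr [leRHS]expr2 mulr_sumr.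
apply: ler_sum => i _; rewrite -real_normK ?num_real// expr2.
by rewrite ler_wpM2r// (bigD1 i)//= lerDl sumr_ge0.
Qed.

End euclidean.

Section Rd_measurable.
Variables (R : realType) (d : nat).

Lemma eopen_measurable (U : set (Rd R d)) : eopen U -> measurable U.
Proof. by move=> oU; exact: sub_sigma_algebra. Qed.

Lemma eopen_lt_eucl (c : 'rV[R]_d) (r : R) : eopen [set x | eucl (x - c) < r].
Proof.
move=> x /= xr; exists (r - eucl (x - c)); first by rewrite subr_gt0.
move=> y /= yx; apply: le_lt_trans (eucl_dist _ (x - c)) _.
by rewrite -ltrBrDl opprB addrA subrK.
Qed.

Lemma measurable_coord (i : 'I_d) : measurable_fun setT (fun x : Rd R d => (x : 'rV[R]_d) ord0 i).
Proof.
apply: (measurability _ (RGenOInfty.measurableE R)).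
move=> _ [_ [a ->] <-]; rewrite setTI; apply: eopen_measurable => x /=; rewrite in_itv/= andbT => ax.
exists (x ord0 i - a); first by rewrite subr_gt0.
move=> y /= yx; rewrite /= in_itv/= andbT.
have := le_lt_trans (coord_le_eucl (y - x) i) yx; rewrite !mxE ltr_norml => /andP[+ _].
by rewrite opprB ltrD2r.
Qed.

Lemma measurable_eucl d' (T : measurableType d') (f : T -> 'rV[R]_d) :
  (forall i, measurable_fun setT (fun t => f t ord0 i)) ->
  measurable_fun setT (fun t => eucl (f t)).
Proof.
move=> mf; rewrite /eucl.
have ms : measurable_fun setT (@Num.sqrt R).
  by apply: continuous_measurable_fun; exact: sqrt_continuous.
apply: (measurableT_comp ms).
by apply: measurable_sum => i; apply: measurable_funX.
Qed.

(** The sigma-algebra is generated by the Euclidean open sets, and each of these is the countable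
    union of the boxes with rational centre and side 2/(n+1) that it contains. *)
Lemma measurable_Rd d' (T : measurableType d') (f : T -> Rd R d) :
  (forall i, measurable_fun setT (fun t => (f t : 'rV[R]_d) ord0 i)) ->
  measurable_fun setT f.
Proof.
move=> mf.
pose box (k : 'rV[rat]_d * nat) : set 'rV[R]_d :=
  [set y | forall i, `|y ord0 i - ratr (k.1 ord0 i)| < k.2.+1%:R^-1].
have mbox k : measurable (f @^-1` box k).
  rewrite (_ : _ @^-1` _ = \bigcap_(i in [set: 'I_d])
      [set t | `|(f t : 'rV[R]_d) ord0 i - ratr (k.1 ord0 i)| < k.2.+1%:R^-1]); last first.
    by apply/seteqP; split => t /= H i; [move=> _|]; apply: H.
  apply: fin_bigcap_measurable => // i _.
  have m : measurable_fun setT (fun t => `|(f t : 'rV[R]_d) ord0 i - ratr (k.1 ord0 i)|).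
    by apply: measurableT_comp => //; apply: measurable_funB.
  by have := m measurableT `]-oo, k.2.+1%:R^-1[%classic (measurable_itv _);
    rewrite setTI; congr measurable; apply/seteqP; split => t /=; rewrite in_itv.
apply: (@measurability _ _ _ _ setT f (@eopen R d)) => //.
move=> _ [U oU <-]; rewrite setTI.
have -> : f @^-1` U = \bigcup_(k in [set k | box k `<=` U]) (f @^-1` box k).
  apply/seteqP; split => t /=; last by move=> [k kU]; exact: kU.
  move=> /oU[r r0 rU].
  (* Two points of one box differ by less than 2/(n+1) in each of the d coordinates, and [eucl] is
     at most the sum of the absolute coordinates. *)
  have [n nr] : exists n, d%:R * (2 / n.+1%:R) < r.
    exists (Num.truncn (d%:R * 2 / r)).
    have := truncnS_gt (d%:R * 2 / r); rewrite ltr_pdivrMr// mulrA ltr_pdivrMr//.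
    by rewrite [r * _]mulrC.
  have /choice[c Hc] (i : 'I_d) : exists q : rat, `|(f t : 'rV[R]_d) ord0 i - ratr q| < n.+1%:R^-1.
    have [q] := @rat_in_itvoo R ((f t : 'rV[R]_d) ord0 i - n.+1%:R^-1)
      ((f t : 'rV[R]_d) ord0 i + n.+1%:R^-1) ltac:(by rewrite ltrBlDr -addrA ltrDl addr_gt0).
    rewrite in_itv/= => /andP[q1 q2]; exists q.
    rewrite ltr_norml; move: q1 q2; move: (n.+1%:R^-1) (ratr q : R) ((f t : 'rV[R]_d) ord0 i).
    by move=> e a b *; apply/andP; split; lra.
  exists (\row_i c i, n); last by move=> i; rewrite mxE.
  move=> y yb; apply: rU => /=; apply: le_lt_trans (eucl_le_sum _) _.
  apply: le_lt_trans nr; rewrite -[d in d%:R]card_ord mulr_natl -sumr_const.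
  apply: ler_sum => i _; rewrite !mxE.
  have := yb i; have := Hc i; rewrite /= mxE.
  move: (n.+1%:R^-1) => e; rewrite !ltr_norml ler_norml => /andP[? ?] /andP[? ?].
  by apply/andP; split; lra.
rewrite bigcup_mkcond; apply: countable_bigcupT_measurable => [|k].
  exact: countableP.
by case: ifPn.
Qed.

End Rd_measurable.

(** * Moment and tail criteria *)

Section excess.
Variables (R : realType) (d : measure_display) (T : measurableType d) (P : probability T R).
Local Open Scope ereal_scope.

Lemma measurable_excess (Z : T -> \bar R) (t : R) :
  measurable_fun setT Z -> measurable_fun setT (fun w => maxe (Z w - t%:E) 0).
Proof. by move=> mZ; apply: measurable_maxe => //; exact: emeasurable_funB. Qed.

Lemma le_cst_measure (Z : T -> \bar R) (A : set T) (a : R) :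
  measurable_fun setT Z -> (forall w, 0 <= Z w) -> measurable A -> (0 <= a)%R ->
  (forall w, A w -> a%:E <= Z w) -> a%:E * P A <= \int[P]_w Z w.
Proof.
move=> mZ Z0 mA a0 H.
rewrite -integral_cst//; apply: (@le_trans _ _ (\int[P]_(w in A) Z w)).
  by apply: ge0_le_integral => //; exact: measurable_funTS.
exact: ge0_subset_integral.
Qed.

(** Monotone convergence of min(Y, n) to Y, together with Y = min(Y, n) + (Y - n)_+. *)
Lemma excess_small (Y : T -> \bar R) : measurable_fun setT Y -> (forall w, 0 <= Y w) ->
  \int[P]_w Y w < +oo -> forall e : R, (0 < e)%R -> exists2 a0 : R, (0 <= a0)%R &
    forall a : R, (a0 <= a)%R -> \int[P]_w maxe (Y w - a%:E) 0 <= e%:E.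
Proof.
move=> mY Y0 Yoo e e0.
pose m (n : nat) w : \bar R := mine (Y w) n%:R%:E.
have mm n : measurable_fun setT (m n) by apply: measurable_mine.
have m0 n w : 0 <= m n w by rewrite /m le_min Y0/= lee_fin.
have Yfin : \int[P]_w Y w \is a fin_num by rewrite ge0_fin_numE// integral_ge0.
have mY' n : \int[P]_w m n w <= \int[P]_w Y w.
  by apply: ge0_le_integral => // w _; rewrite ge_min lexx.
have mfin n : \int[P]_w m n w \is a fin_num.
  by rewrite ge0_fin_numE ?integral_ge0//; exact: le_lt_trans (mY' n) Yoo.
have cvg : \int[P]_w m n w @[n --> \oo] --> \int[P]_w Y w.
  rewrite [X in _ --> X](_ : _ = \int[P]_w limn (m ^~ w)); last first.
    apply: eq_integral => w _; apply/esym/cvg_lim => //; rewrite /m.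
    case: (Y w) (Y0 w) => [r r0| _|//].
      apply: cvg_near_cst.
      near=> n; apply/min_idPl; rewrite lee_fin.
      by near: n; exact: nbhs_infty_ger.
    rewrite (_ : (fun n => _) = (fun n => n%:R%:E)); last by apply/funext => n; rewrite minye.
    by apply/cvgeryP; exact: cvgr_idn.
  apply: cvg_monotone_convergence => //.
  by move=> w _ k n kn; rewrite /m le_min ge_min lexx/= ge_min lee_fin ler_nat kn orbT.
have [n Hn] : exists n, \int[P]_w Y w - e%:E < \int[P]_w m n w.
  apply: contrapT => /forallNP H.
  have : \int[P]_w Y w <= \int[P]_w Y w - e%:E.
    by apply: (cvge_le _ cvg); apply: nearW => n; rewrite leNgt; apply/negP.
  by rewrite leNgt lteBlDr// lteDl// lte_fin e0.
exists n%:R => // a na.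
apply: (@le_trans _ _ (\int[P]_w maxe (Y w - n%:R%:E) 0)).
  apply: ge0_le_integral => //.
  - by move=> w _; rewrite le_max lexx orbT.
  - exact: measurable_excess.
  - exact: measurable_excess.
  - by move=> w _; rewrite ge_max !le_max lexx orbT andbT leeB// lee_fin.
(* The finite integral of min(Y, n) is added to both sides; this form of the decomposition stays
   valid at points where Y is infinite. *)
rewrite -(leeD2lE _ _ (mfin n)) -ge0_integralD//; last 2 first.
  - by move=> w _; rewrite le_max lexx orbT.
  - exact: measurable_excess.
rewrite (_ : \int[P]_w (m n w + maxe (Y w - n%:R%:E) 0) = \int[P]_w Y w); last first.
  apply: eq_integral => w _; rewrite /m.
  case: (Y w) (Y0 w) => [r _| _|//]; last by rewrite minye addye// maxye addey.
  rewrite -EFinB -EFin_min -EFin_max -EFinD; congr (_%:E).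
  by rewrite minEle maxEle subr_le0; case: leP => _; rewrite ?addr0// addrC subrK.
by rewrite -leeBlDr// ltW.
Unshelve. all: by end_near. Qed.

End excess.

Section powers.
Variable R : realType.
Local Open Scope ereal_scope.

Lemma ltr_powR_ge0 (s : R) (x y : R) : (0 < s)%R -> (0 <= x)%R -> (0 <= y)%R ->
  (x `^ s < y `^ s)%R = (x < y)%R.
Proof.
move=> s0 x0 y0; apply/idP/idP; last by move=> /(gt0_ltr_powR s0); apply.
by rewrite !ltNge; apply: contra => /(ge0_ler_powR (ltW s0)); apply.
Qed.

Lemma ler_powR_ge0 (s : R) (x y : R) : (0 < s)%R -> (0 <= x)%R -> (0 <= y)%R ->
  (x `^ s <= y `^ s)%R = (x <= y)%R.
Proof. by move=> s0 x0 y0; rewrite leNgt ltr_powR_ge0// -leNgt. Qed.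

Lemma powRK (s : R) (x : R) : (s != 0)%R -> (0 <= x)%R -> ((x `^ s) `^ s^-1)%R = x.
Proof. by move=> s0 x0; rewrite -powRrM mulfV// powRr1. Qed.

Lemma powRVK (s : R) (x : R) : (s != 0)%R -> (0 <= x)%R -> ((x `^ s^-1) `^ s)%R = x.
Proof. by move=> s0 x0; rewrite -powRrM mulVf// powRr1. Qed.

Lemma lte_poweR (s t : R) (y : \bar R) : (0 < s)%R -> (0 <= t)%R -> 0 <= y ->
  ((t `^ s)%:E < poweR y s) = (t%:E < y).
Proof.
move=> s0 t0; case: y => [r| |]//.
  by rewrite lee_fin => r0; rewrite poweR_EFin !lte_fin ltr_powR_ge0.
by move=> _; rewrite poweRyr ?gt_eqF// !ltry.
Qed.

Lemma poweRVK (s : R) (y : \bar R) : (s != 0)%R -> 0 <= y -> poweR (poweR y s^-1) s = y.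
Proof. by move=> s0 y0; rewrite -poweRrM mulVf// poweRe1. Qed.

Variable Y : PosRV R.

Lemma st_le_ge0 d (T : measurableType d) (P : probability T R) (Z : T -> \bar R) :
  measurable_fun setT Z ->
  (forall t : R, (0 <= t)%R -> P [set w | t%:E < Z w] <= py_P Y [set w | t%:E < py_Y Y w]) ->
  st_le P Z (py_P Y) (py_Y Y).
Proof.
move=> mZ H t; have [t0|/H//] := ltP t 0%R.
rewrite [X in _ <= py_P _ X](_ : _ = setT) ?probability_setT.
  by apply: probability_le1; exact: measurable_gt_ereal.
by apply/seteqP; split=> // w _ /=; apply: lt_le_trans (py_ge0 _); rewrite lte_fin.
Qed.

Lemma measurable_powY (s : R) : measurable_fun setT (fun w => poweR (py_Y Y w) s).
Proof. exact: (measurableT_comp (measurable_poweR _)). Qed.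

Definition powY (s : R) : PosRV R :=
  @MkPosRV R _ _ (py_P Y) (mfun_Sub (mem_set (measurable_powY s))) (fun w => poweR_ge0 _ _).

End powers.

Section radial.
Variables (R : realType) (d : nat) (I : Type) (X : I -> RVec R d).
Local Open Scope ereal_scope.

Definition radius i (w : rv_T (X i)) : R := eucl (rv_X (X i) w).

Lemma radius_ge0 i w : (0 <= @radius i w)%R.
Proof. exact: eucl_ge0. Qed.

Lemma measurable_radius i : measurable_fun setT (@radius i).
Proof.
apply: measurable_eucl => k.
exact: (measurableT_comp (measurable_coord k)).
Qed.

Lemma measurable_radius_powR i s : measurable_fun setT (fun w => (@radius i w `^ s)%R).
Proof. exact: (measurableT_comp (measurable_powR _) (@measurable_radius i)). Qed.

Lemma measurable_nrmp i s : measurable_fun setT (nrmp (X i) s).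
Proof. by apply/measurable_EFinP; exact: measurable_radius_powR. Qed.

Lemma nrmp_ge0 i s w : 0 <= nrmp (X i) s w.
Proof. by rewrite lee_fin powR_ge0. Qed.

Lemma nrm_nrmp1 : (fun i => nrm (X i)) = (fun i => nrmp (X i) 1).
Proof.
apply: functional_extensionality_dep => i; apply/funext => w.
by rewrite /nrm /nrmp powRr1 ?eucl_ge0.
Qed.

(** The map x -> x^s is an increasing bijection of [0, +oo], so raising both sides to a power only
    relabels the levels of the tail events. *)
Lemma st_bounded_pow (s : R) : (0 < s)%R ->
  (exists Y, r_integrableY s Y /\ st_bounded X (fun i => nrm (X i)) Y) <->
  (exists Y, integrableY Y /\ st_bounded X (fun i => nrmp (X i) s) Y).
Proof.
move=> s0; split => -[Y [Yint YX]].
- exists (powY Y s); split; first exact: Yint.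
  move=> i; apply: st_le_ge0 => [|t t0]; first exact: measurable_nrmp.
  have -> : [set w | t%:E < nrmp (X i) s w] = [set w | (t `^ s^-1)%:E < nrm (X i) w].
    by apply/funext => w /=; congr is_true; rewrite -[RHS](@lte_poweR R s) ?powR_ge0 ?powRVK ?gt_eqF ?lee_fin ?eucl_ge0.
  have E : [set w | (t `^ s^-1)%:E < py_Y Y w] = [set w | t%:E < poweR (py_Y Y w) s].
    by apply/funext => w /=; congr is_true; rewrite -[LHS](@lte_poweR R s) ?powR_ge0 ?powRVK ?gt_eqF// py_ge0.
  exact: (eq_ind _ (fun S => _ <= py_P Y S) (YX i _) _ E).
- exists (powY Y s^-1); split.
    rewrite /r_integrableY/=; under eq_integral do rewrite poweRVK ?gt_eqF ?py_ge0//.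
    exact: Yint.
  move=> i; apply: st_le_ge0 => [|t t0].
    by apply/measurable_EFinP; exact: measurable_radius.
  have -> : [set w | t%:E < nrm (X i) w] = [set w | (t `^ s)%:E < nrmp (X i) s w].
    by apply/funext => w /=; congr is_true; rewrite -[LHS](@lte_poweR R s)// lee_fin eucl_ge0.
  have E : [set w | (t `^ s)%:E < py_Y Y w] = [set w | t%:E < poweR (py_Y Y w) s^-1].
    by apply/funext => w /=; congr is_true; rewrite -[RHS](@lte_poweR R s) ?poweR_ge0 ?poweRVK ?py_ge0 ?gt_eqF.
  exact: (eq_ind _ (fun S => _ <= py_P Y S) (YX i _) _ E).
Qed.

(** For u >= 0 the event (Z - t)_+ > u is Z > u + t, so the stochastic order passes to the excesses
    and then to their expectations. *)
Lemma st_bounded_icx s Y : st_bounded X (fun i => nrmp (X i) s) Y ->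
  icx_bounded X (fun i => nrmp (X i) s) Y.
Proof.
move=> H i t t0; apply: st_le_integral.
- by apply: measurable_excess; exact: measurable_nrmp.
- by apply: measurable_excess; exact: measurable_funP.
- by move=> w; rewrite le_max lexx orbT.
- by move=> w; rewrite le_max lexx orbT.
move=> u u0; have := H i (u + t)%R.
have E T (Z : T -> \bar R) : [set w | (u + t)%:E < Z w] = [set w | u%:E < maxe (Z w - t%:E) 0].
  by apply/funext => w /=; rewrite lt_max [X in _ || X]ltNge lee_fin u0 orbF EFinN lteBrDr.
by rewrite !E.
Qed.

Lemma icx_integral_le s Y : icx_bounded X (fun i => nrmp (X i) s) Y ->
  forall i, \int[rv_P (X i)]_w nrmp (X i) s w <= \int[py_P Y]_w py_Y Y w.
Proof.
move=> H i; have := H i 0%R (lexx _).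
by congr (_ <= _); apply: eq_integral => w _; rewrite sube0; apply/max_idPl;
  [exact: nrmp_ge0|exact: py_ge0].
Qed.

Lemma icx_bounded_Lr s Y : integrableY Y -> icx_bounded X (fun i => nrmp (X i) s) Y ->
  bounded_Lr X s.
Proof.
move=> Yint /icx_integral_le H; exists (fine (\int[py_P Y]_w py_Y Y w)) => i.
by rewrite fineK// ge0_fin_numE// integral_ge0// => w _; exact: py_ge0.
Qed.

(** With a = t^s / 2, on {|X| > t} one has |X|^s >= 2a, hence |X|^s <= 2 (|X|^s - a): the moment
    beyond t is at most twice the expected excess over a. *)
Lemma icx_unif_integrable s Y : (0 < s)%R -> integrableY Y ->
  icx_bounded X (fun i => nrmp (X i) s) Y -> unif_r_integrable X s.
Proof.
move=> s0 Yint H e e0.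
have e20 : (0 < e / 2)%R by rewrite divr_gt0.
have [a0 a00 Ha0] := excess_small (measurable_funP (py_Y Y)) (@py_ge0 _ Y) Yint e20.
(* Beyond this threshold a = t^s / 2 is at least a0. *)
exists ((2 * a0) `^ s^-1)%R => t t0 i.
have tge0 : (0 <= t)%R := le_trans (powR_ge0 _ _) t0.
pose a : R := (t `^ s / 2)%R.
have a0a : (a0 <= a)%R.
  rewrite /a ler_pdivlMr// mulrC -(powRVK (s := s) (x := 2 * a0)) ?gt_eqF ?mulr_ge0//.
  by rewrite ler_powR_ge0// powR_ge0.
have mA : measurable [set w | (t < @radius i w)%R].
  by apply: measurable_gt_fun => j; exact: measurable_radius.
have mex : measurable_fun setT (fun w => maxe (nrmp (X i) s w - a%:E) 0).
  by apply: measurable_excess; exact: measurable_nrmp.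
apply: (@le_trans _ _ (\int[rv_P (X i)]_w (2%:E * maxe (nrmp (X i) s w - a%:E) 0))).
  apply: (@le_trans _ _ (\int[rv_P (X i)]_(w in [set w | (t < @radius i w)%R])
       (2%:E * maxe (nrmp (X i) s w - a%:E) 0))).
    apply: ge0_le_integral => //.
    - by move=> w _; exact: nrmp_ge0.
    - by apply: measurable_funTS; exact: measurable_nrmp.
    - by apply: measurable_funTS; exact: measurable_funeM.
    move=> w /= tw; apply: (@le_trans _ _ (2%:E * (nrmp (X i) s w - a%:E))); last first.
      by rewrite lee_pmul2l// le_max lexx.
    have : (t `^ s <= radius w `^ s)%R by rewrite ler_powR_ge0 ?radius_ge0// ltW.
    rewrite -EFinB -EFinM lee_fin /a /radius; move: (_ `^ s)%R (_ `^ s)%R => u v uv; lra.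
  apply: ge0_subset_integral => //; first exact: measurable_funeM.
  by move=> w _; rewrite mule_ge0// le_max lexx orbT.
rewrite ge0_integralZl_EFin//; last by move=> w _; rewrite le_max lexx orbT.
have := le_trans (H i a (le_trans a00 a0a)) (Ha0 a a0a).
by rewrite -(@lee_pmul2l _ 2%:E)// -EFinM mulrC divfK.
Qed.

End radial.

Section geometric.
Variable R : realType.
Local Open Scope ereal_scope.

Lemma nneseries_le_bound (u : nat -> R) (M : R) : (forall n, (0 <= u n)%R) ->
  (forall n, (\sum_(0 <= i < n) u i <= M)%R) -> \sum_(n <oo) (u n)%:E <= M%:E.
Proof.
move=> u0 H; apply: lime_le.
  by apply: is_cvg_nneseries => n _ _; rewrite lee_fin.
by apply: nearW => n; rewrite sumEFin lee_fin.
Qed.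

Lemma nneseries_geometric (a z : R) : (0 <= a)%R -> (0 <= z < 1)%R ->
  \sum_(n <oo) (a * z ^+ n)%:E < +oo.
Proof.
move=> a0 /andP[z0 z1].
apply: le_lt_trans (ltry (a / (1 - z))); apply: nneseries_le_bound => n.
  by rewrite mulr_ge0// exprn_ge0.
have := geometric_seriesE a (negbT (lt_eqF z1)).
move=> /(congr1 (fun f => f n)); rewrite /series/= => ->.
rewrite ler_pM2r ?invr_gt0 ?subr_gt0// -[leRHS]mulr1 ler_wpM2l//.
by rewrite lerBlDr lerDl exprn_ge0.
Qed.

Lemma dyadic_unbounded (x : R) : exists n, (x < 2 ^+ n)%R.
Proof.
exists (Num.truncn x).+1; apply: (lt_le_trans (truncnS_gt x)).
by rewrite -natrX ler_nat ltnW// ltn_expl.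
Qed.

Lemma dyadic_powR n (s : R) : ((2 ^+ n) `^ s = (2 `^ s) ^+ n :> R)%R.
Proof.
elim: n => [|n IH]; first by rewrite !expr0 powR1.
by rewrite !exprS powRM ?exprn_ge0// IH.
Qed.

(** Only dyadic levels below t contribute; their powers grow geometrically with ratio 2^s > 1, so
    the sum is comparable to its last term, which is below t^s. *)
Lemma sum_dyadic_lt (s t : R) : (0 < s)%R -> (0 <= t)%R ->
  \sum_(n <oo) ((2 ^+ n) `^ s * (2 ^+ n < t)%R%:R)%:E <=
  (2 `^ s / (2 `^ s - 1) * t `^ s)%:E.
Proof.
move=> s0 t0.
have z1 : (1 < 2 `^ s :> R)%R.
  rewrite [ltLHS](_ : 1 = 1 `^ s)%R; last by rewrite powR1.
  by rewrite ltr_powR_ge0// ltr1n.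
have z10 : (0 < 2 `^ s - 1 :> R)%R by rewrite subr_gt0.
apply: nneseries_le_bound => n; first by rewrite mulr_ge0// powR_ge0.
elim: n => [|n IH].
  by rewrite big_nil mulr_ge0 ?powR_ge0// divr_ge0 ?powR_ge0// ltW.
rewrite big_nat_recr//=; case: (ltP (2 ^+ n)%R t) => nt; last by rewrite mulr0 addr0.
rewrite mulr1; apply: (@le_trans _ _ (\sum_(0 <= i < n.+1) (2 `^ s) ^+ i)%R).
  rewrite [leRHS]big_nat_recr//= dyadic_powR lerD2r; apply: ler_sum => i _.
  by rewrite dyadic_powR ler_piMr ?exprn_ge0 ?powR_ge0//; case: (_ < _)%R.
rewrite mulrAC ler_pdivlMr// big_mkord mulrC -subrX1.
rewrite (@le_trans _ _ ((2 `^ s) ^+ n.+1)%R) ?lerBlDr ?lerDl// exprS ler_wpM2l ?powR_ge0//.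
by rewrite -dyadic_powR ler_powR_ge0 ?exprn_ge0// ltW.
Qed.

End geometric.

Section radial_bounds.
Variables (R : realType) (d : nat) (I : Type) (X : I -> RVec R d).
Local Open Scope ereal_scope.

Let measurable_tail i (t : R) : measurable [set w | (t < @radius R d I X i w)%R].
Proof. by apply: measurable_gt_fun => j; exact: measurable_radius. Qed.

Let measurable_tailp i s (t : R) : measurable [set w | (t < @radius R d I X i w `^ s)%R].
Proof.
apply: (measurable_gt_fun (Z := fun j w => (@radius R d I X j w `^ s)%R)) => j.
exact: measurable_radius_powR.
Qed.

Lemma st_bounded_dyadic (r : R) (H : nat -> R) : (0 < r)%R -> (forall n, (0 <= H n)%R) ->
  (forall i n, rv_P (X i) [set w | (2 ^+ n < @radius R d I X i w)%R] <= (H n)%:E) ->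
  \sum_(n <oo) ((2 ^+ n) `^ r * H n)%:E < +oo ->
  exists Y, integrableY Y /\ st_bounded X (fun i => nrmp (X i) r) Y.
Proof.
move=> r0 H0 HP Hsum.
pose b (n : nat) : R := (if n is 0 then 0 else (2 ^+ n) `^ r)%R.
have bge0 n : (0 <= b n)%R by case: n => //= n; exact: powR_ge0.
have bunb (t : R) : exists n, (t < b n)%R.
  pose x : R := Num.max t 0%R.
  have x0 : (0 <= x)%R by rewrite le_max lexx orbT.
  have [m xm] := dyadic_unbounded (x `^ r^-1)%R.
  exists m.+1; rewrite (@le_lt_trans _ _ x)//; first by rewrite le_max lexx.
  rewrite -(powRVK (s := r) (x := x)) ?gt_eqF// /b.
  by rewrite ltr_powR_ge0 ?powR_ge0 ?exprn_ge0// (lt_le_trans xm)// ler_eXn2l ?ltr1n.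
(* As b 0 is 0 and not 1, the bound H 0 says nothing about the tail at b 0; the summand for n = 0
   makes g 0 equal to 1. *)
pose g (n : nat) : R := (Num.min 1 ((n == 0%N)%:R + H n))%R.
have g01 n : (0 <= g n <= 1)%R by rewrite ge_min lexx andbT le_min ler01 addr_ge0.
exists (stairRV g (fun n => bge0 n.+1)); split.
  apply: stairRV_integrable => //.
  have C0 : (0 <= 2 `^ r :> R)%R := powR_ge0 _ _.
  (* Since b n.+1 = 2^r (2^n)^r, the series is compared with the assumed one; the indicator of n = 0
     is absorbed by the geometric series of ratio 1/2. *)
  apply: (@le_lt_trans _ _ (\sum_(n <oo) ((2 `^ r * 2^-1 ^+ n)%:E + (2 `^ r)%:E * ((2 ^+ n) `^ r * H n)%:E))).
    apply: lee_nneseries => [n _ _|n _].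
      by rewrite lee_fin mulr_ge0//; have /andP[] := g01 n.
    rewrite -EFinM -EFinD lee_fin /b exprS powRM ?exprn_ge0// -mulrA -mulrDr ler_wpM2l//.
    apply: (@le_trans _ _ ((2 ^+ n) `^ r * ((n == 0%N)%:R + H n))%R).
      by rewrite ler_wpM2l ?powR_ge0// ge_min lexx orbT.
    rewrite mulrDr lerD2r; case: n => [|n] /=; first by rewrite !expr0 mulr1 powR1.
    by rewrite mulr0 exprn_ge0.
  rewrite nneseriesD; [|by move=> n _ _; rewrite lee_fin mulr_ge0// exprn_ge0|
    by move=> n _ _; rewrite mule_ge0// lee_fin// mulr_ge0// powR_ge0].
  rewrite lte_add_pinfty//; first by apply: nneseries_geometric => //; rewrite invr_ge0 ler0n/= invf_lt1 ?ltr1n.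
  rewrite nneseriesZl; last by move=> n _; rewrite lee_fin mulr_ge0// powR_ge0.
  by rewrite lte_mul_pinfty.
apply: (st_bounded_stair (Z := fun i w => (radius w `^ r)%R)) => //.
- by move=> i; exact: measurable_radius_powR.
- move=> i n; rewrite /g EFin_min le_min; apply/andP; split.
    exact: probability_le1.
  case: n => [|n].
    rewrite eqxx (le_trans (probability_le1 _ _))//.
    by rewrite lee_fin lerDl.
  rewrite add0r /= (_ : [set _ | _] = [set w | (2 ^+ n.+1 < @radius R d I X i w)%R])//.
  by apply/funext => w /=; rewrite ltr_powR_ge0 ?radius_ge0// exprn_ge0.
Qed.

End radial_bounds.

Section radial_criteria.
Variables (R : realType) (d : nat) (I : Type) (X : I -> RVec R d).
Local Open Scope ereal_scope.

Let measurable_tail i (t : R) : measurable [set w | (t < @radius R d I X i w)%R].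
Proof. by apply: measurable_gt_fun => j; exact: measurable_radius. Qed.

Lemma markov_radius (s C t : R) i : (0 < s)%R -> (0 < t)%R ->
  \int[rv_P (X i)]_w nrmp (X i) s w <= C%:E ->
  rv_P (X i) [set w | (t < @radius R d I X i w)%R] <= (C / t `^ s)%:E.
Proof.
move=> s0 t0 HC; have ts : (0 < t `^ s)%R by rewrite powR_gt0.
rewrite EFinM lee_pdivlMr// muleC.
apply: le_trans HC; apply: le_cst_measure => //.
- exact: measurable_nrmp.
- by move=> w; exact: nrmp_ge0.
- exact: ltW.
- by move=> w tw; rewrite lee_fin ler_powR_ge0 ?radius_ge0// ltW.
Qed.

(** Markov's inequality at 2^n bounds the tail by C 2^(-ns), and the sum of 2^(nr) 2^(-ns) converges
    because r < s. *)
Lemma bounded_Lr_st (r s : R) : (0 < r)%R -> (r < s)%R -> bounded_Lr X s ->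
  exists Y, integrableY Y /\ st_bounded X (fun i => nrmp (X i) r) Y.
Proof.
move=> r0 rs [C0 HC0].
(* For an empty family the given bound may be negative. *)
pose C := Num.max C0 0%R.
have C_ge0 : (0 <= C)%R by rewrite le_max lexx orbT.
have HC i : \int[rv_P (X i)]_w nrmp (X i) s w <= C%:E.
  by apply: le_trans (HC0 i) _; rewrite lee_fin le_max lexx.
have s0 : (0 < s)%R := lt_trans r0 rs.
apply: (@st_bounded_dyadic _ _ _ _ r (fun n => C / (2 ^+ n) `^ s)%R) => //.
- by move=> n; rewrite divr_ge0// powR_ge0.
- by move=> i n; apply: markov_radius => //; rewrite exprn_gt0.
- have E n : ((2 ^+ n) `^ r * (C / (2 ^+ n) `^ s) = C * (2 `^ (r - s)) ^+ n :> R)%R.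
    rewrite mulrCA; congr (_ * _)%R.
    rewrite -dyadic_powR -powRN -powRD//.
    by rewrite expf_neq0// implybT.
  rewrite (eq_eseriesr (fun n _ => congr1 EFin (E n))).
  apply: nneseries_geometric => //; rewrite powR_ge0/=.
  by rewrite /powR gt_eqF// expR_lt1 nmulr_rlt0 ?subr_lt0// ln_gt0// ltr1n.
Qed.

Lemma bounded_Lr_tight (s : R) : (0 < s)%R -> bounded_Lr X s -> tight X.
Proof.
move=> s0 [C HC] e e0.
pose M : R := ((`|C| + 1) / e)%R.
have M0 : (0 < M)%R by rewrite divr_gt0// ltr_wpDl.
exists (M `^ s^-1)%R => t tM i.
have t0 : (0 < t)%R by apply: lt_le_trans tM; rewrite powR_gt0.
apply: le_trans (markov_radius s0 t0 (HC i)) _; rewrite lee_fin ler_pdivrMr ?powR_gt0//.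
have : (M <= t `^ s)%R.
  by rewrite -(powRVK (s := s) (x := M)) ?gt_eqF ?(ltW M0)// ler_powR_ge0 ?powR_ge0// ltW.
rewrite /M ler_pdivrMr// mulrC; apply: le_trans.
by rewrite (le_trans (ler_norm _))// lerDl.
Qed.

(** Levels v n are chosen beyond which the s-th moments are at most 2^(-n); these bound the expected
    excesses over b n.+1 = (v n)^s. The maximum with n makes the levels unbounded. *)
Lemma unif_integrable_icx (s : R) : (0 < s)%R -> unif_r_integrable X s ->
  exists Y, integrableY Y /\ icx_bounded X (fun i => nrmp (X i) s) Y.
Proof.
move=> s0 UI.
have half n : (0 < 2^-1 ^+ n :> R)%R by rewrite exprn_gt0// invr_gt0.
(* Splitting at one threshold shows that the s-th moments are bounded; this serves as the excess
   over the level b 0 = 0. *)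
have [t0 t00 Ht0] : exists2 t0 : R, (0 <= t0)%R & forall i,
    \int[rv_P (X i)]_w nrmp (X i) s w <= (t0 `^ s + 1)%:E.
  have [t0 H] := UI 1%R ltr01; pose t := Num.max t0 0%R.
  exists t; first by rewrite le_max lexx orbT.
  move=> i; have mA := measurable_tail i t.
  rewrite -(setvU [set w | (t < @radius R d I X i w)%R]) ge0_integral_setU//.
  - rewrite EFinD; apply: leeD; last by apply: H; rewrite le_max lexx.
    apply: (@le_trans _ _ (\int[rv_P (X i)]_(w in ~` [set w | (t < @radius R d I X i w)%R]) (t `^ s)%:E)).
      apply: ge0_le_integral => //.
      + exact: measurableC.
      + by move=> w _; exact: nrmp_ge0.
      + by apply: measurable_funTS; exact: measurable_nrmp.
      + move=> w /= /negP; rewrite -leNgt lee_fin ler_powR_ge0 ?radius_ge0//.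
        by rewrite le_max lexx orbT.
    rewrite integral_cst//; last exact: measurableC.
    rewrite -[leRHS]mule1 lee_wpmul2l// ?lee_fin ?powR_ge0//.
    by apply: probability_le1; exact: measurableC.
  - exact: measurableC.
  - by rewrite setvU; exact: measurable_nrmp.
  - by move=> w _; exact: nrmp_ge0.
  - by apply/disj_setPS => w [].
have /choice[u Hu] : forall n : nat, exists u : R, forall i,
    \int[rv_P (X i)]_(w in [set w | (Num.max u n%:R < @radius R d I X i w)%R])
      nrmp (X i) s w <= (2^-1 ^+ n)%:E.
  by move=> n; have [u H] := UI _ (half n); exists u => i; apply: H; rewrite le_max lexx.
pose v (n : nat) : R := (Num.max (u n) n%:R)%R.
have v0 n : (0 <= v n)%R by rewrite /v le_max ler0n orbT.
pose b (n : nat) : R := if n is m.+1 then (v m `^ s)%R else 0%R.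
have bge0 n : (0 <= b n)%R by case: n => //= n; exact: powR_ge0.
have bunb (t : R) : exists n, (t < b n)%R.
  pose x : R := Num.max t 0%R.
  have x0 : (0 <= x)%R by rewrite le_max lexx orbT.
  exists (Num.truncn (x `^ s^-1)%R).+2; rewrite (@le_lt_trans _ _ x)//; first by rewrite le_max lexx.
  rewrite -[ltLHS](powRVK (s := s) (x := x)) ?gt_eqF// /b.
  rewrite ltr_powR_ge0 ?powR_ge0// (lt_le_trans (truncnS_gt _))//.
  by rewrite /v le_max lexx orbT.
pose E (n : nat) : R := if n is m.+1 then (2^-1 ^+ m)%R else (t0 `^ s + 1)%R.
have E0 n : (0 <= E n)%R by case: n => /= [|n]; [rewrite addr_ge0// powR_ge0|exact: ltW].
have HE i n : \int[rv_P (X i)]_w maxe (nrmp (X i) s w - (b n)%:E) 0 <= (E n)%:E.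
  case: n => [|n] /=.
    rewrite (eq_integral (nrmp (X i) s)); first exact: Ht0.
    by move=> w _; rewrite sube0; apply/max_idPl; exact: nrmp_ge0.
  apply: le_trans (Hu n i); rewrite [leRHS]integral_mkcond.
  apply: ge0_le_integral => //.
  - by move=> w _; rewrite le_max lexx orbT.
  - by apply: measurable_excess; exact: measurable_nrmp.
  - apply/(measurable_restrictT _ _).1; first exact: (measurable_tail i (v n)).
    by apply: measurable_funTS; exact: measurable_nrmp.
  - move=> w _; rewrite patchE; case: ifPn => [_|/negP].
      by rewrite ge_max nrmp_ge0 andbT EFinN leeBlDr// leeDl// lee_fin powR_ge0.
    rewrite inE/= => /negP; rewrite -leNgt => H; rewrite ge_max lexx andbT.
    by rewrite EFinN leeBlDr// add0e lee_fin ler_powR_ge0 ?radius_ge0.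
(* The expectation of the stair is the sum of b n.+1 * g n and K n * g n. This g makes the first
   part at most 2^(-n), however fast b grows, and K = E / g makes the second equal to E n. *)
pose g (n : nat) : R := (2^-1 ^+ n / (b n.+1 + 1))%R.
have b1 n : (0 < b n + 1)%R by rewrite ltr_wpDl.
have g0 n : (0 < g n)%R by rewrite divr_gt0.
have g01 n : (0 <= g n <= 1)%R.
  rewrite ltW//= ler_pdivrMr// mul1r (@le_trans _ _ 1%R) ?lerDr//.
  by rewrite exprn_ile1// ?invf_le1 ?ler1n// invr_ge0.
pose K n : R := (E n / g n)%R.
have K0 n : (0 <= K n)%R by rewrite divr_ge0// ltW.
have cge0 n : (0 <= b n.+1 + K n)%R by rewrite addr_ge0.
exists (stairRV g cge0); split; last first.
  apply: (icx_bounded_stair (Z := fun i w => (radius w `^ s)%R)) => //.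
  - by move=> i; exact: measurable_radius_powR.
  - by move=> i n; rewrite divfK ?gt_eqF//; exact: HE.
apply: stairRV_integrable => //.
(* One unit for b n.+1 * g n and t0^s + 3 for E n, where E n.+1 = 2^(-n) is twice 2^(-(n+1)). *)
pose D : R := (t0 `^ s + 4)%R.
apply: (@le_lt_trans _ _ (\sum_(n <oo) (D * 2^-1 ^+ n)%:E)); last first.
  apply: nneseries_geometric; first by rewrite addr_ge0// powR_ge0.
  by rewrite invr_ge0 ler0n/= invf_lt1 ?ltr1n.
apply: lee_nneseries => n _; first by move=> _; rewrite lee_fin mulr_ge0// ltW.
rewrite lee_fin mulrDl divfK ?gt_eqF//.
have h1 : (b n.+1 * g n <= 2^-1 ^+ n)%R.
  by rewrite /g mulrA ler_pdivrMr// mulrC ler_wpM2l ?lerDl// ltW.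
have h2 : (E n <= (t0 `^ s + 3) * 2^-1 ^+ n)%R.
  case: n {h1} => [|n] /=; first by rewrite expr0 mulr1 lerD2l ler1n.
  rewrite exprS mulrA; apply: ler_peMl; first exact: ltW.
  have := powR_ge0 t0 s; lra.
by move: h1 h2; rewrite /D; move: (b _ * g n)%R (E n) (t0 `^ s)%R (2^-1 ^+ n)%R => ? ? ? ? ? ?; lra.
Qed.

(** Continuity from above: the events Y > n decrease to Y = +oo, which is null. *)
Lemma finite_st_tight : (exists Y, finiteY Y /\ st_bounded X (fun i => nrm (X i)) Y) -> tight X.
Proof.
move=> [Y [Yfin YX]] e e0.
pose A (n : nat) := [set w | n%:R%:E < py_Y Y w].
have mA n : measurable (A n) by apply: measurable_gt_ereal; exact: measurable_funP.
have cvg : py_P Y (A n) @[n --> \oo] --> py_P Y (\bigcap_n A n).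
  apply: nonincreasing_cvg_mu => //.
  - by rewrite (le_lt_trans (probability_le1 _ _)) ?ltry.
  - exact: bigcap_measurable.
  - move=> n m nm; apply/subsetPset => w /=; apply: le_lt_trans.
    by rewrite lee_fin ler_nat.
have A0 : py_P Y (\bigcap_n A n) = 0.
  rewrite (_ : \bigcap_n A n = ~` [set w | py_Y Y w < +oo]); last first.
    apply/seteqP; split=> w /= H.
      move=> woo; have wfin : py_Y Y w \is a fin_num by rewrite ge0_fin_numE// py_ge0.
      have := H (Num.truncn (fine (py_Y Y w))).+1 Logic.I; rewrite /A/= -(fineK wfin) lte_fin.
      by rewrite ltNge ltW// truncnS_gt.
    move=> n _; rewrite /A/=; case: (py_Y Y w) H => [r| |] //=; rewrite ?ltry//.
  rewrite probability_setC; first by rewrite [X in _ - X]Yfin subee.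
  by rewrite -[X in measurable X]setTI; apply: emeasurable_fun_infty_o => //; exact: measurable_funP.
have [n Hn] : exists n, py_P Y (A n) <= e%:E.
  apply: contrapT => /forallNP H.
  have : e%:E <= 0.
    rewrite -A0; apply: (cvge_ge _ cvg); apply: nearW => n.
    by apply: ltW; rewrite ltNge; apply/negP.
  by rewrite lee_fin leNgt e0.
exists n%:R => t nt i; apply: le_trans Hn.
apply: (@le_trans _ _ (py_P Y [set w | t%:E < py_Y Y w])).
  exact: YX.
apply: le_measure; rewrite ?inE//.
  by apply: measurable_gt_ereal; exact: measurable_funP.
by move=> w /=; apply: le_lt_trans; rewrite lee_fin.
Qed.

(** Levels with tails at most 2^(-n) give a stair with g n = 2^(-n); it need not be integrable, but
    almost surely only finitely many of its terms are nonzero. *)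
Lemma tight_finite_st : tight X -> exists Y, finiteY Y /\ st_bounded X (fun i => nrm (X i)) Y.
Proof.
move=> T; have half n : (0 < 2^-1 ^+ n :> R)%R by rewrite exprn_gt0// invr_gt0.
have /choice[u Hu] : forall n : nat, exists u : R, forall i,
    rv_P (X i) [set w | (Num.max u n%:R < @radius R d I X i w)%R] <= (2^-1 ^+ n.+1)%:E.
  by move=> n; have [u H] := T _ (half n.+1); exists u => i; apply: H; rewrite le_max lexx.
pose b (n : nat) : R := if n is m.+1 then (Num.max (u m) m%:R)%R else 0%R.
have bge0 n : (0 <= b n)%R by case: n => //= n; rewrite le_max ler0n orbT.
have bunb (t : R) : exists n, (t < b n)%R.
  exists (Num.truncn t).+2; rewrite (lt_le_trans (truncnS_gt _))//.
  by rewrite /b le_max lexx orbT.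
pose g (n : nat) : R := (2^-1 ^+ n)%R.
have half1 : (2^-1 <= 1 :> R)%R by rewrite invf_le1 ?ler1n.
have g01 n : (0 <= g n <= 1)%R by rewrite ltW//= exprn_ile1// invr_ge0.
exists (stairRV g (fun n => bge0 n.+1)); split.
  apply: stairRV_finite => //.
    by move=> n m nm; rewrite ler_wiXn2l// invr_ge0.
  move=> e e0; have [n] := dyadic_unbounded e^-1; exists n.
  by rewrite /g exprVn invf_plt ?posrE ?exprn_gt0.
apply: (st_bounded_stair (Z := fun i w => radius w)) => //.
- by move=> i; exact: measurable_radius.
- move=> i [|n]; last exact: (Hu n i).
  by rewrite /g expr0; apply: probability_le1; exact: measurable_tail.
Qed.

End radial_criteria.

Section dyadic_moments.
Variables (R : realType) (Y : PosRV R).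
Local Open Scope ereal_scope.

Lemma dyadic_half n (a : R) : ((2 ^+ n / 2 < a) = (2 ^+ n < 2 * a))%R.
Proof. by rewrite ltr_pdivrMr// mulrC. Qed.

(** Exchanging sum and integral leaves, pointwise in Y = y, the powers of the dyadic levels below
    2y. The factor 1/2 places the levels strictly below the spike heights 2^n, to which the bound
    will be applied. *)
Lemma sum_dyadic_tail (s : R) : (0 < s)%R -> r_integrableY s Y ->
  \sum_(n <oo) ((2 ^+ n) `^ s)%:E * py_P Y [set w | (2 ^+ n / 2)%:E < py_Y Y w] < +oo.
Proof.
move=> s0 Yint.
pose A n : set (py_T Y) := [set w | (2 ^+ n / 2)%:E < py_Y Y w].
have mA n : measurable (A n).
  by apply: measurable_gt_ereal; exact: measurable_funP.
pose f n w : \bar R := ((2 ^+ n) `^ s)%:E * (\1_(A n) w)%:E.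
have f0 n w : 0 <= f n w by rewrite mule_ge0// lee_fin// powR_ge0.
have mf n : measurable_fun setT (f n).
  by apply: measurable_funeM; apply/measurable_EFinP/measurable_indic.
rewrite (eq_eseriesr (g := fun n => \int[py_P Y]_w f n w)); last first.
  move=> n _; rewrite ge0_integralZl_EFin ?powR_ge0//; last first.
    by apply/measurable_EFinP/measurable_indic.
  by rewrite integral_indic// setIT.
rewrite -integral_nneseries//.
(* The constant of [sum_dyadic_lt] evaluated at 2y, with (2y)^s written as 2^s y^s. *)
pose D : R := (2 `^ s / (2 `^ s - 1) * 2 `^ s)%R.
have D0 : (0 < D)%R.
  rewrite !mulr_gt0 ?powR_gt0// invr_gt0 subr_gt0.
  by rewrite [ltLHS](_ : 1 = 1 `^ s)%R; [rewrite ltr_powR_ge0// ltr1n|rewrite powR1].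
apply: (@le_lt_trans _ _ (\int[py_P Y]_w (D%:E * poweR (py_Y Y w) s))); last first.
  rewrite ge0_integralZl_EFin ?(ltW D0)//.
  - by rewrite lte_mul_pinfty// lee_fin ltW.
  - by move=> w _; exact: poweR_ge0.
  - exact: measurable_powY.
apply: ge0_le_integral => //.
- by move=> w _; apply: nneseries_ge0 => n _ _; exact: f0.
- by apply: ge0_emeasurable_sum.
- by apply: measurable_funeM; exact: measurable_powY.
move=> w _; case E : (py_Y Y w) (py_ge0 w) => [y| |]// y0; last first.
  by rewrite poweRyr ?gt_eqF// mulry gtr0_sg// mul1e leey.
rewrite lee_fin in y0; rewrite poweR_EFin -EFinM /D -[X in (_ <= X%:E)]mulrA -powRM//.
apply: le_trans (sum_dyadic_lt s0 _); last by rewrite mulr_ge0.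
apply: lee_nneseries => [n _ _|n _]; first exact: f0.
rewrite /f indicE -EFinM lee_fin (_ : (w \in A n) = (2 ^+ n < 2 * y)%R)//.
by apply/idP/idP; rewrite inE /A/= E lte_fin dyadic_half.
Qed.

End dyadic_moments.

Section icx_st.
Variables (R : realType) (d : nat) (I : Type) (X : I -> RVec R d).
Local Open Scope ereal_scope.

(** Markov's inequality for the excess over half the level gives P(|X| > 2^n) <= (2 / 2^n) J n,
    where J n is the expected excess of Y over 2^n / 2. The resulting dyadic series is an integral
    over Y of a sum with exponent q - 1 > 0, comparable to Y^q. *)
Lemma icx_q_integrable_st (q : R) : (1 < q)%R ->
  (exists Y, r_integrableY q Y /\ icx_bounded X (fun i => nrm (X i)) Y) ->
  exists Y, integrableY Y /\ st_bounded X (fun i => nrmp (X i) q) Y.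
Proof.
move=> q1 [Y [Yint YX]]; have q0 : (0 < q)%R := lt_trans ltr01 q1.
have pow2 n : (0 < 2 ^+ n :> R)%R by rewrite exprn_gt0.
pose J n := \int[py_P Y]_w maxe (py_Y Y w - (2 ^+ n / 2)%:E) 0.
have J0 n : 0 <= J n by apply: integral_ge0 => w _; rewrite le_max lexx orbT.
(* This is the product of the weight (2^n)^q and Markov's factor 2 / 2^n. *)
pose k n : R := (2 * (2 ^+ n) `^ (q - 1))%R.
have k0 n : (0 < k n)%R by rewrite mulr_gt0 ?powR_gt0.
have Jsum : \sum_(n <oo) (k n)%:E * J n < +oo.
  pose f n w := (k n)%:E * maxe (py_Y Y w - (2 ^+ n / 2)%:E) 0.
  have f0 n w : 0 <= f n w by rewrite mule_ge0 ?le_max ?lexx ?orbT// lee_fin ltW.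
  have mex n : measurable_fun setT (fun w => maxe (py_Y Y w - (2 ^+ n / 2)%:E) 0).
    by apply: measurable_excess; exact: measurable_funP.
  have mf n : measurable_fun setT (f n) by apply: measurable_funeM.
  rewrite (eq_eseriesr (g := fun n => \int[py_P Y]_w f n w)); last first.
    move=> n _; rewrite ge0_integralZl_EFin ?ltW//.
    by move=> w _; rewrite le_max lexx orbT.
  rewrite -integral_nneseries//.
  pose C : R := (2 `^ (q - 1) / (2 `^ (q - 1) - 1))%R.
  have q10 : (0 < q - 1)%R by rewrite subr_gt0.
  have C0 : (0 < C)%R.
    rewrite !mulr_gt0 ?powR_gt0// invr_gt0 subr_gt0.
    by rewrite [ltLHS](_ : 1 = 1 `^ (q - 1))%R; [rewrite ltr_powR_ge0// ltr1n|rewrite powR1].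
  pose D : R := (C * 2 `^ q)%R.
  have D0 : (0 < D)%R by rewrite mulr_gt0// powR_gt0.
  apply: (@le_lt_trans _ _ (\int[py_P Y]_w (D%:E * poweR (py_Y Y w) q))); last first.
    rewrite ge0_integralZl_EFin ?(ltW D0)//.
    - by rewrite lte_mul_pinfty// lee_fin ltW.
    - by move=> w _; exact: poweR_ge0.
    - exact: measurable_powY.
  apply: ge0_le_integral => //.
  - by move=> w _; apply: nneseries_ge0 => n _ _; exact: f0.
  - by apply: ge0_emeasurable_sum.
  - by apply: measurable_funeM; exact: measurable_powY.
  move=> w _; case E : (py_Y Y w) (py_ge0 w) => [y| |]// y0; last first.
    by rewrite poweRyr ?gt_eqF// mulry gtr0_sg// mul1e leey.
  rewrite lee_fin in y0; rewrite poweR_EFin -EFinM.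
  have [yy0|yn0] := eqVneq y 0%R.
    rewrite eseries0.
      by rewrite lee_fin; apply: mulr_ge0; [exact: ltW|exact: powR_ge0].
    move=> n _ _; rewrite /f E yy0 sub0e -EFinN -EFin_max -EFinM; congr (_%:E).
    by rewrite max_r ?mulr0// oppr_le0 divr_ge0// ltW.
  have yp : (0 < y)%R by rewrite lt0r yn0.
  (* The excess of y over 2^n / 2 is at most y, and vanishes unless 2^n < 2y. *)
  apply: (@le_trans _ _ (\sum_(n <oo) ((2 * y)%:E * ((2 ^+ n) `^ (q - 1) * (2 ^+ n < 2 * y)%R%:R)%:E))).
    apply: lee_nneseries => [n _ _|n _]; first exact: f0.
    rewrite /f E -EFinB -EFin_max -!EFinM lee_fin /k -!mulrA ler_pM2l// mulrCA ler_wpM2l ?powR_ge0//.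
    rewrite ge_max; have := pow2 n; move: (2 ^+ n)%R => z z0; case: (ltP z (2 * y)%R) => h.
      by rewrite mulr1 y0 andbT; lra.
    by rewrite mulr0 lexx andbT; lra.
  rewrite nneseriesZl; last by move=> n _; rewrite lee_fin mulr_ge0// powR_ge0.
  have := sum_dyadic_lt q10 (mulr_ge0 (ler0n R 2) y0).
  move=> /(lee_wpmul2l (x := (2 * y)%:E)); rewrite lee_fin mulr_ge0// => /(_ isT)/le_trans; apply.
  rewrite -EFinM lee_fin -/C /D mulrCA.
  rewrite [leRHS](_ : _ = C * (2 * y) `^ q)%R; last by rewrite powRM// mulrA.
  rewrite ler_pM2l//.
  rewrite -[X in (X * _)%R](powRr1 (mulr_ge0 (ler0n R 2) y0)) -powRD; first by rewrite addrC subrK.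
  by rewrite mulf_neq0 ?implybT.
(* Each k n * J n is a term of a convergent nonnegative series and k n is positive. *)
have Jfin n : J n \is a fin_num.
  rewrite ge0_fin_numE//; have : (k n)%:E * J n < +oo.
    apply: le_lt_trans Jsum; rewrite (nneseriesD1 (n := n))//; last first.
      by move=> m _; apply: mule_ge0; [rewrite lee_fin ltW|exact: J0].
    apply: leeDl; apply: nneseries_ge0 => m _ _.
    by apply: mule_ge0; [rewrite lee_fin ltW|exact: J0].
  case: (J n) (J0 n) => [r _ _|_|//]; first exact: ltry.
  by rewrite mulry gtr0_sg// mul1e.
apply: (@st_bounded_dyadic _ _ _ _ q (fun n => 2 / 2 ^+ n * fine (J n))%R) => //.
- by move=> n; rewrite mulr_ge0 ?divr_ge0 ?fine_ge0// ltW.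
- move=> i n; have h : (0 < 2 ^+ n / 2 :> R)%R by rewrite divr_gt0.
  rewrite EFinM fineK// -[(2 / _)%R]invrK invf_div muleC lee_pdivlMr// muleC.
  apply: le_trans (YX i (2 ^+ n / 2)%R (ltW h)).
  apply: le_cst_measure.
  - by apply: measurable_excess; apply/measurable_EFinP; exact: measurable_radius.
  - by move=> w; rewrite le_max lexx orbT.
  - by apply: measurable_gt_fun => j; exact: measurable_radius.
  - exact: ltW.
  - move=> w /= hw; rewrite le_max; apply/orP; left.
    by rewrite -EFinB lee_fin lerBrDr -splitr ltW.
- rewrite (eq_eseriesr (g := fun n => (k n)%:E * J n))// => n _.
  rewrite -[X in _ = _ * X](fineK (Jfin n)) -EFinM; congr (_%:E); rewrite /k.
  rewrite mulrA; congr (_ * _)%R; rewrite mulrCA; congr (_ * _)%R.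
  rewrite -powR_inv1 ?(ltW (pow2 n))// -powRD//.
  by apply/implyP => _; rewrite gt_eqF.
Qed.

End icx_st.

(** * Counterexamples *)

Section spikes.
Variables (R : realType) (d : nat).
Hypothesis d_gt0 : (0 < d)%N.
Variable g : nat -> R.
Hypothesis g01 : forall n, 0 <= g n <= 1.
Local Open Scope ereal_scope.

Let U : probability (measurableTypeR R) R := uniform_prob (@ltr01 R).

Let mstep n : measurable ([set u | (u < g n)%R] : set (measurableTypeR R)).
Proof.
by rewrite (_ : [set _ | _] = `]-oo, g n[%classic)//; apply/seteqP; split=> x /=; rewrite in_itv.
Qed.

Definition spike_fun n (u : measurableTypeR R) : Rd R d :=
  \row_i (2 ^+ n * \1_([set u | (u < g n)%R] : set (measurableTypeR R)) u * (i == 0%N :> nat)%:R)%R.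

Lemma measurable_spike n : measurable_fun setT (spike_fun n).
Proof.
apply: measurable_Rd => i; under eq_fun do rewrite mxE.
by apply: measurable_funM => //; apply: measurable_funM => //; exact: measurable_indic.
Qed.

Definition spike n : RVec R d :=
  @MkRVec R d _ _ U (mfun_Sub (mem_set (measurable_spike n))).

Lemma eucl_spike n u : eucl (spike_fun n u) = (2 ^+ n * (u < g n)%R%:R)%R.
Proof.
rewrite /eucl (bigD1 (Ordinal d_gt0))//= big1 ?addr0.
  rewrite mxE/= mulr1 sqrtr_sqr ger0_norm ?mulr_ge0 ?exprn_ge0// indicE.
  by congr (_ * (nat_of_bool _)%:R)%R; apply/idP/idP; rewrite inE.
move=> i; rewrite -val_eqE/= => i0; rewrite mxE (negbTE i0).
by rewrite mulr0 expr0n.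
Qed.

Lemma spike_tail n (t : R) : (0 <= t < 2 ^+ n)%R ->
  rv_P (spike n) [set w | (t < eucl (rv_X (spike n) w))%R] = (g n)%:E.
Proof.
move=> /andP[t0 tn]; rewrite -(uniform01_lt (g01 n)).
congr (_ _); apply/funext => u /=; rewrite eucl_spike.
by case: (ltP u (g n)) => _; [rewrite mulr1 tn|rewrite mulr0 ltNge t0].
Qed.

Lemma spike_tail0 n (t : R) : (2 ^+ n <= t)%R ->
  [set w | (t < eucl (rv_X (spike n) w))%R] = set0.
Proof.
move=> tn; apply/seteqP; split=> // u /=; rewrite eucl_spike ltNge => /negP; apply.
by apply: le_trans tn; rewrite ler_piMr// ?exprn_ge0//; case: (_ < _)%R.
Qed.

Lemma spike_moment_tail n (s t : R) : (0 < s)%R -> (t < 2 ^+ n)%R ->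
  \int[rv_P (spike n)]_(w in [set w | (t < eucl (rv_X (spike n) w))%R]) nrmp (spike n) s w =
  ((2 ^+ n) `^ s * g n)%:E.
Proof.
move=> s0 tn; rewrite integral_mkcond.
rewrite (eq_integral (fun u => ((2 ^+ n) `^ s)%:E * (\1_([set u | (u < g n)%R] : set (measurableTypeR R)) u)%:E)).
  rewrite ge0_integralZl_EFin ?powR_ge0//; last exact/measurable_EFinP/measurable_indic.
  by rewrite integral_indic// setIT EFinM; congr (_ * _); exact: uniform01_lt.
move=> u _; rewrite patchE indicE /nrmp /=.
have -> : (u \in ([set u | (u < g n)%R] : set (measurableTypeR R))) = (u < g n)%R.
  by apply/idP/idP; rewrite inE.
have := eucl_spike n u; case: (ltP u (g n)) => ug E.
  by rewrite ifT ?mule1 ?E ?mulr1// inE/= E mulr1.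
by rewrite mule0 E mulr0 powR0 ?gt_eqF//; case: ifPn.
Qed.

Lemma spike_moment n (s : R) : (0 < s)%R ->
  \int[rv_P (spike n)]_w nrmp (spike n) s w = ((2 ^+ n) `^ s * g n)%:E.
Proof.
(* The threshold -1 turns the tail event into the whole space. *)
move=> s0; rewrite -(@spike_moment_tail n s (-1)%R)//; last first.
  by rewrite (lt_trans (ltrN10 _))// exprn_gt0.
congr integral; apply/seteqP; split=> // w _ /=.
by apply: lt_le_trans (eucl_ge0 _); exact: ltrN10.
Qed.

Lemma spike_bounded_Lr (s C : R) : (0 < s)%R ->
  (forall n, ((2 ^+ n) `^ s * g n <= C)%R) -> bounded_Lr spike s.
Proof. by move=> s0 H; exists C => n; rewrite spike_moment// lee_fin. Qed.

Lemma spike_unbounded_Lr (s : R) : (0 < s)%R ->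
  (forall C, exists n, (C < (2 ^+ n) `^ s * g n)%R) -> ~ bounded_Lr spike s.
Proof.
move=> s0 H [C HC]; have [n] := H C.
by rewrite ltNge => /negP; apply; have := HC n; rewrite spike_moment// lee_fin.
Qed.

(** Beyond t >= 2^N, spikes of height at most t contribute nothing, and the others have index at
    least N and hence small moment. *)
Lemma spike_unif (s : R) : (0 < s)%R ->
  (forall e : R, (0 < e)%R -> exists N, forall n, (N <= n)%N -> ((2 ^+ n) `^ s * g n <= e)%R) ->
  unif_r_integrable spike s.
Proof.
move=> s0 H e e0; have [N HN] := H _ e0; exists (2 ^+ N)%R => t tN n.
have [tn|tn] := leP (2 ^+ n)%R t.
  by rewrite (spike_tail0 tn) integral_set0 lee_fin ltW.
rewrite spike_moment_tail// lee_fin; apply: HN.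
by rewrite ltnW// -(@ltr_eXn2l R 2) ?ltr1n// (le_lt_trans tN).
Qed.

(** Whatever the threshold, some spike lies above it and keeps its whole moment, at least 1, against
    the tolerance 1/2. *)
Lemma spike_not_unif (s : R) : (0 < s)%R ->
  (forall n, (1 <= (2 ^+ n) `^ s * g n)%R) -> ~ unif_r_integrable spike s.
Proof.
move=> s0 H /(_ 2^-1%R ltac:(by rewrite invr_gt0))[t0 Ht0].
have [n tn] := dyadic_unbounded t0.
have := Ht0 t0 (lexx _) n; rewrite spike_moment_tail// lee_fin leNgt => /negP; apply.
by apply: lt_le_trans (H n); rewrite invf_lt1 ?ltr1n.
Qed.

(** A bound Y satisfies P(Y > 2^n / 2) >= g n for every n at once, so its dyadic moment sum
    dominates the harmonic series, contrary to [sum_dyadic_tail]. *)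
Lemma spike_not_st (s : R) : (0 < s)%R ->
  (forall n, (n.+1%:R^-1 <= (2 ^+ n) `^ s * g n)%R) ->
  ~ exists Y, r_integrableY s Y /\ st_bounded spike (fun i => nrm (spike i)) Y.
Proof.
move=> s0 H [Y [Yint YX]]; have := sum_dyadic_tail s0 Yint.
have : \sum_(n <oo) (n.+1%:R^-1 : R)%:E <=
    \sum_(n <oo) ((2 ^+ n) `^ s)%:E * py_P Y [set w | (2 ^+ n / 2)%:E < py_Y Y w].
  apply: lee_nneseries => [n _ _|n _]; first by rewrite lee_fin invr_ge0.
  apply: (@le_trans _ _ ((2 ^+ n) `^ s * g n)%:E); first by rewrite lee_fin.
  rewrite EFinM lee_wpmul2l ?lee_fin ?powR_ge0//.
  have h0 : (0 < 2 ^+ n :> R)%R by rewrite exprn_gt0.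
  rewrite -(@spike_tail n (2 ^+ n / 2)%R); last first.
    by rewrite divr_ge0 ?(ltW h0)//= ltr_pdivrMr// ltr_pMr// ltr1n.
  exact: (YX n (2 ^+ n / 2)%R).
move=> /le_lt_trans/[apply] Hfin; apply: (@dvg_harmonic R).
apply: nondecreasing_is_cvgn.
  by apply: nondecreasing_series => n _ _; rewrite invr_ge0.
exists (fine (\sum_(n <oo) (n.+1%:R^-1 : R)%:E)) => _ [n _ <-].
have S0 : 0 <= \sum_(n <oo) (n.+1%:R^-1 : R)%:E.
  by apply: nneseries_ge0 => k _ _; rewrite lee_fin invr_ge0.
rewrite -lee_fin fineK ?ge0_fin_numE// /series/= -sumEFin.
by apply: nneseries_lim_ge => k _ _; rewrite lee_fin invr_ge0.
Qed.

End spikes.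

Section chain.
Variables (R : realType) (d : nat) (p q : R).
Hypotheses (p0 : 0 < p) (p1 : p < 1) (q1 : 1 < q).

Let q0 : 0 < q := lt_trans ltr01 q1.

Lemma prop1E (I : Type) (X : I -> RVec R d) : prop1 q X <->
  exists Y, integrableY Y /\ st_bounded X (fun i => nrmp (X i) q) Y.
Proof. exact: st_bounded_pow. Qed.

Lemma prop7E (I : Type) (X : I -> RVec R d) : prop7 p X <->
  exists Y, integrableY Y /\ st_bounded X (fun i => nrmp (X i) p) Y.
Proof. exact: st_bounded_pow. Qed.

Lemma prop4E (I : Type) (X : I -> RVec R d) : prop4 X <->
  exists Y, r_integrableY 1 Y /\ st_bounded X (fun i => nrm (X i)) Y.
Proof.
have E (Y : PosRV R) : r_integrableY 1 Y <-> integrableY Y.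
  by rewrite /r_integrableY /integrableY; under eq_integral do rewrite poweRe1 ?py_ge0//.
by split=> -[Y [/E Yint YX]]; exists Y.
Qed.

Lemma unif_icxE (I : Type) (X : I -> RVec R d) (s : R) : 0 < s ->
  (exists Y, integrableY Y /\ icx_bounded X (fun i => nrmp (X i) s) Y) <->
  unif_r_integrable X s.
Proof.
move=> s0; split; last exact: unif_integrable_icx.
by move=> [Y [Yint]]; exact: icx_unif_integrable.
Qed.

Lemma prop5E (I : Type) (X : I -> RVec R d) : prop5 X <-> unif_r_integrable X 1.
Proof. by rewrite /prop5 nrm_nrmp1; exact: unif_icxE. Qed.

Lemma prop10E (I : Type) (X : I -> RVec R d) : prop10 X <-> tight X.
Proof. by split; [exact: finite_st_tight|exact: tight_finite_st]. Qed.

Lemma prop1_icx (I : Type) (X : I -> RVec R d) : prop1 q X <->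
  exists Y, r_integrableY q Y /\ icx_bounded X (fun i => nrm (X i)) Y.
Proof.
split; last by move=> /(icx_q_integrable_st q1)/prop1E.
move=> [Y [Yint YX]]; exists Y; split => //.
by move: YX; rewrite /prop1 nrm_nrmp1; exact: st_bounded_icx.
Qed.

(** One pattern recurs for the exponents q, 1 and p: an st-bound is an icx-bound, this bounds the
    moments, and by Markov bounded moments give an st-bound for any smaller exponent, or tightness
    at the end. *)
Lemma prop_chain (I : Type) (X : I -> RVec R d) (k : nat) : (1 <= k <= 9)%N ->
  prop p q X k -> prop p q X k.+1.
Proof.
have st_icx s : (exists Y, integrableY Y /\ st_bounded X (fun i => nrmp (X i) s) Y) ->
    exists Y, integrableY Y /\ icx_bounded X (fun i => nrmp (X i) s) Y.
  by move=> [Y [Yint YX]]; exists Y; split => //; exact: st_bounded_icx.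
have icx_bd s : (exists Y, integrableY Y /\ icx_bounded X (fun i => nrmp (X i) s) Y) ->
    bounded_Lr X s.
  by move=> [Y [Yint YX]]; exact: icx_bounded_Lr YX.
case: k => [|[|[|[|[|[|[|[|[|[|]]]]]]]]]]//= _.
- by move=> /prop1E; exact: st_icx.
- exact: icx_bd.
- by move=> /(bounded_Lr_st ltr01 q1); rewrite /prop4 nrm_nrmp1.
- by rewrite /prop4 /prop5 nrm_nrmp1; exact: st_icx.
- by rewrite /prop5 nrm_nrmp1; exact: icx_bd.
- by move=> /(bounded_Lr_st p0 p1)/prop7E.
- by move=> /prop7E; exact: st_icx.
- exact: icx_bd.
- by move=> /(bounded_Lr_tight p0)/prop10E.
Qed.

End chain.

Section counterexamples.
Variables (R : realType) (d : nat) (p q : R).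
Hypotheses (p0 : 0 < p) (p1 : p < 1) (q1 : 1 < q) (d_gt0 : (0 < d)%N).

Let q0 : 0 < q := lt_trans ltr01 q1.

Let g (s : R) (n : nat) : R := ((2 ^+ n) `^ s)^-1.
Let h (s : R) (n : nat) : R := g s n / n.+1%:R.

Let pow_ge1 s n : 0 < s -> 1 <= (2 ^+ n) `^ s :> R.
Proof.
move=> s0; rewrite dyadic_powR exprn_ege1//.
by rewrite [leLHS](_ : 1 = 1 `^ s); [rewrite ler_powR_ge0// ler1n|rewrite powR1].
Qed.

Let g01 s : 0 < s -> forall n, 0 <= g s n <= 1.
Proof.
move=> s0 n; rewrite invr_ge0 powR_ge0/= invf_le1 ?pow_ge1//.
Qed.

Let h01 s : 0 < s -> forall n, 0 <= h s n <= 1.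
Proof.
move=> s0 n; have /andP[g0 g1] := g01 s0 n.
by rewrite divr_ge0//= ler_pdivrMr// mul1r (le_trans g1)// ler1n.
Qed.

Let mulg s n : 0 < s -> (2 ^+ n) `^ s * g s n = 1.
Proof. by move=> s0; rewrite mulfV// gt_eqF// (lt_le_trans ltr01)// pow_ge1. Qed.

Let mulh s n : 0 < s -> (2 ^+ n) `^ s * h s n = n.+1%:R^-1.
Proof. by move=> s0; rewrite mulrA mulg// mul1r. Qed.

Let small (e : R) : 0 < e -> exists N, forall n, (N <= n)%N -> (n.+1%:R^-1 <= e :> R).
Proof.
move=> e0; exists (Num.truncn e^-1) => n Nn.
rewrite -(invrK e) lef_pV2 ?posrE ?invr_gt0//.
by rewrite (le_trans (ltW (truncnS_gt _)))// ler_nat.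
Qed.

Let mulg_unbounded (s t C : R) : 0 < s -> s < t -> exists n, C < (2 ^+ n) `^ t * g s n.
Proof.
move=> s0 st; have ts : 0 < t - s by rewrite subr_gt0.
pose x := Num.max C 0; have x0 : 0 <= x by rewrite le_max lexx orbT.
have [n xn] := dyadic_unbounded (x `^ (t - s)^-1).
exists n; rewrite /g -powRN -powRD; last first.
  by apply/implyP => _; rewrite gt_eqF// exprn_gt0.
apply: (@le_lt_trans _ _ x); first by rewrite le_max lexx.
by rewrite -(powRVK (s := t - s) (x := x)) ?gt_eqF// ltr_powR_ge0 ?powR_ge0// exprn_ge0.
Qed.

(** For s equal to q, 1 or p, the spikes with [h s] are uniformly s-integrable but not st-bounded,
    and those with [g s] are bounded in L^s but not uniformly s-integrable. The steps that lower the
    exponent use [g s] with s strictly between the two exponents, or s = p / 2 for the last. *)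
Lemma prop_irreversible (k : nat) : (1 <= k <= 9)%N ->
  exists (I : Type) (X : I -> RVec R d), prop p q X k.+1 /\ ~ prop p q X k.
Proof.
have UI s : 0 < s -> unif_r_integrable (spike d (h s)) s.
  move=> s0; apply: (spike_unif d_gt0 (h01 s0) s0) => e /small[N HN].
  by exists N => n /HN; rewrite mulh.
have nst s : 0 < s -> ~ exists Y, r_integrableY s Y /\
    st_bounded (spike d (h s)) (fun i => nrm (spike d (h s) i)) Y.
  by move=> s0; apply: (spike_not_st d_gt0 (h01 s0) s0) => n; rewrite mulh.
have bd s : 0 < s -> bounded_Lr (spike d (g s)) s.
  by move=> s0; apply: (@spike_bounded_Lr _ _ d_gt0 _ (g01 s0) _ 1) => // n; rewrite mulg.
have nUI s : 0 < s -> ~ unif_r_integrable (spike d (g s)) s.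
  by move=> s0; apply: (spike_not_unif d_gt0 (g01 s0) s0) => n; rewrite mulg.
have nbd s t : 0 < s -> s < t -> ~ bounded_Lr (spike d (g s)) t.
  move=> s0 st; apply: (spike_unbounded_Lr d_gt0 (g01 s0) (lt_trans s0 st)) => C.
  exact: mulg_unbounded.
case: k => [|[|[|[|[|[|[|[|[|[|]]]]]]]]]]//= _.
- exists nat, (spike d (h q)); split; last exact: nst.
  by apply/unif_icxE => //; exact: UI.
- exists nat, (spike d (g q)); split; first exact: bd.
  by move=> /unif_icxE => /(_ q0); exact: nUI.
- pose s := (1 + q) / 2; have s1 : 1 < s by rewrite /s; have := p0; have := p1; have := q1; lra.
  have s0 : 0 < s := lt_trans ltr01 s1.
  exists nat, (spike d (g s)); split; last by apply: nbd => //; rewrite /s; have := p0; have := p1; have := q1; lra.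
  by rewrite /prop4 nrm_nrmp1; apply: bounded_Lr_st s1 (bd _ s0).
- exists nat, (spike d (h 1)); split; last by move=> /prop4E; exact: nst.
  by apply/prop5E; exact: UI.
- exists nat, (spike d (g 1)); split; first exact: bd.
  by move=> /prop5E; exact: nUI.
- pose s := (1 + p) / 2; have ps : p < s by rewrite /s; have := p0; have := p1; have := q1; lra.
  have s0 : 0 < s := lt_trans p0 ps.
  exists nat, (spike d (g s)); split; last by apply: nbd => //; rewrite /s; have := p0; have := p1; have := q1; lra.
  by apply/prop7E => //; apply: bounded_Lr_st ps (bd _ s0).
- exists nat, (spike d (h p)); split; last exact: nst.
  by apply/unif_icxE => //; exact: UI.
- exists nat, (spike d (g p)); split; first exact: bd.
  by move=> /unif_icxE => /(_ p0); exact: nUI.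
- pose s := p / 2; have s0 : 0 < s by rewrite divr_gt0.
  exists nat, (spike d (g s)); split; last by apply: nbd => //; rewrite /s; have := p0; have := p1; have := q1; lra.
  by apply/prop10E; apply: bounded_Lr_tight s0 (bd _ s0).
Qed.

End counterexamples.

(** * Couplings and the Wasserstein distance *)

Section power_inequalities.
Variable R : realType.
Local Open Scope ring_scope.

(** From a + b <= 2 max(a, b); this constant is valid for every r > 0, whereas convexity would ask
    for r >= 1. *)
Lemma powR_add_le (r a b : R) : 0 < r -> 0 <= a -> 0 <= b ->
  (a + b) `^ r <= 2 `^ r * (a `^ r + b `^ r).
Proof.
move=> r0; wlog ab : a b / a <= b => [H a0 b0|a0 b0].
  have [ab|/ltW ba] := leP a b; first exact: H.
  by rewrite addrC [a `^ r + _]addrC; exact: H.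
apply: (@le_trans _ _ ((2 * b) `^ r)).
  by rewrite ler_powR_ge0// ?addr_ge0 ?mulr_ge0//; lra.
by rewrite powRM// ler_wpM2l ?powR_ge0// lerDr powR_ge0.
Qed.

Lemma integral_powR_add d (T : measurableType d) (P : probability T R) (a b c : T -> R) (r : R) :
  0 < r -> measurable_fun setT a -> measurable_fun setT b -> measurable_fun setT c ->
  (forall z, 0 <= a z) -> (forall z, 0 <= b z) -> (forall z, 0 <= c z <= a z + b z) ->
  (\int[P]_z (c z `^ r)%:E <=
    (2 `^ r)%:E * (\int[P]_z (a z `^ r)%:E + \int[P]_z (b z `^ r)%:E))%E.
Proof.
move=> r0 ma mb mc a0 b0 c0.
have mp f : measurable_fun setT f -> measurable_fun setT (fun z : T => (f z `^ r)%:E).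
  by move=> mf; apply/measurable_EFinP; exact: (measurableT_comp (measurable_powR _) mf).
have p0 (f : T -> R) z : (0 <= (f z `^ r)%:E)%E by rewrite lee_fin powR_ge0.
rewrite -ge0_integralD//; [|exact: mp..].
rewrite -ge0_integralZl_EFin ?powR_ge0//; last 2 first.
- by move=> z _; exact: adde_ge0.
- by apply: emeasurable_funD; exact: mp.
apply: ge0_le_integral => //.
- exact: mp.
- by apply: measurable_funeM; apply: emeasurable_funD; exact: mp.
move=> z _; rewrite -EFinD -EFinM lee_fin; apply: le_trans (powR_add_le r0 (a0 _) (b0 _)).
by have /andP[cz cab] := c0 z; rewrite ler_powR_ge0 ?addr_ge0.
Qed.

End power_inequalities.

Section marginals.
Local Open Scope ereal_scope.
Context d1 d2 (T1 : measurableType d1) (T2 : measurableType d2) (R : realType).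
Variable g : probability (T1 * T2)%type R.

Lemma integral_fst (P : probability T1 R) (f : T1 -> \bar R) :
  (forall A, measurable A -> g (A `*` setT) = P A) ->
  measurable_fun setT f -> (forall x, 0 <= f x) ->
  \int[g]_z f z.1 = \int[P]_x f x.
Proof.
move=> H mf f0.
have mfst : measurable_fun setT (fst : T1 * T2 -> T1) by exact: measurable_fst.
transitivity (\int[pushforward g (fst : T1 * T2 -> T1)]_x f x).
  by rewrite ge0_integral_pushforward.
apply: eq_measure_integral => A mA _; transitivity (g (A `*` setT)); last exact: H.
by congr (g _); apply/seteqP; split=> z //= [].
Qed.

Lemma integral_snd (P : probability T2 R) (f : T2 -> \bar R) :
  (forall A, measurable A -> g (setT `*` A) = P A) ->
  measurable_fun setT f -> (forall x, 0 <= f x) ->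
  \int[g]_z f z.2 = \int[P]_x f x.
Proof.
move=> H mf f0.
have msnd : measurable_fun setT (snd : T1 * T2 -> T2) by exact: measurable_snd.
transitivity (\int[pushforward g (snd : T1 * T2 -> T2)]_x f x).
  by rewrite ge0_integral_pushforward.
apply: eq_measure_integral => A mA _; transitivity (g (setT `*` A)); last exact: H.
by congr (g _); apply/seteqP; split=> z //= [].
Qed.

End marginals.

Section wasserstein_moments.
Variables (R : realType) (d : nat).
Local Open Scope ereal_scope.
Notation PM := (probability (Rd R d) R).

Lemma measurable_eucl_id : measurable_fun setT (fun x : Rd R d => eucl (x : 'rV[R]_d)).
Proof. by apply: measurable_eucl => i; exact: measurable_coord. Qed.

Lemma measurable_eucl_pow r : measurable_fun setT (fun x : Rd R d => ((eucl (x : 'rV[R]_d)) `^ r)%:E).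
Proof.
by apply/measurable_EFinP; exact: (measurableT_comp (measurable_powR _) measurable_eucl_id).
Qed.

Definition dist (z : Rd R d * Rd R d) : R := eucl (z.1 - z.2 : 'rV[R]_d).

Lemma dist_ge0 z : (0 <= dist z)%R. Proof. exact: eucl_ge0. Qed.

Lemma measurable_dist : measurable_fun setT dist.
Proof.
apply: measurable_eucl => i; under eq_fun do rewrite !mxE.
by apply: measurable_funB; apply: (measurableT_comp (measurable_coord i)).
Qed.

Lemma measurable_dist_pow r : measurable_fun setT (fun z => (dist z `^ r)%:E).
Proof.
by apply/measurable_EFinP; exact: (measurableT_comp (measurable_powR _) measurable_dist).
Qed.

Definition moment (r : R) (mu : PM) := \int[mu]_x ((eucl (x : 'rV[R]_d)) `^ r)%:E.
Definition cost (r : R) (g : probability (Rd R d * Rd R d)%type R) := \int[g]_z (dist z `^ r)%:E.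

Lemma moment_ge0 r mu : 0 <= moment r mu.
Proof. by apply: integral_ge0 => x _; rewrite lee_fin powR_ge0. Qed.

Lemma cost_ge0 r g : 0 <= cost r g.
Proof. by apply: integral_ge0 => x _; rewrite lee_fin powR_ge0. Qed.

Lemma coupling_fst (mu nu : PM) g (f : Rd R d -> \bar R) : couplings mu nu g ->
  measurable_fun setT f -> (forall x, 0 <= f x) -> \int[g]_z f z.1 = \int[mu]_x f x.
Proof. by move=> H; apply: integral_fst => A /H[]. Qed.

Lemma coupling_snd (mu nu : PM) g (f : Rd R d -> \bar R) : couplings mu nu g ->
  measurable_fun setT f -> (forall x, 0 <= f x) -> \int[g]_z f z.2 = \int[nu]_x f x.
Proof. by move=> H; apply: integral_snd => A /H[]. Qed.

Lemma couplings_prod (mu nu : PM) : couplings mu nu (mu \x nu).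
Proof.
move=> A mA; split.
  by have /= -> := product_measure1E mu nu mA measurableT; rewrite probability_setT mule1.
by have /= -> := product_measure1E mu nu measurableT mA; rewrite probability_setT mul1e.
Qed.

Lemma moment_fst r (mu nu : PM) g : couplings mu nu g ->
  moment r mu = \int[g]_z (eucl (z.1 : 'rV[R]_d) `^ r)%:E.
Proof.
move=> cg; symmetry; apply: (coupling_fst cg (measurable_eucl_pow r)) => x.
by rewrite lee_fin powR_ge0.
Qed.

Lemma moment_snd r (mu nu : PM) g : couplings mu nu g ->
  moment r nu = \int[g]_z (eucl (z.2 : 'rV[R]_d) `^ r)%:E.
Proof.
move=> cg; symmetry; apply: (coupling_snd cg (measurable_eucl_pow r)) => x.
by rewrite lee_fin powR_ge0.
Qed.

Lemma cost_le_moments (r : R) (mu nu : PM) g : (0 < r)%R -> couplings mu nu g ->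
  cost r g <= (2 `^ r)%:E * (moment r mu + moment r nu).
Proof.
move=> r0 cg; rewrite (moment_fst r cg) (moment_snd r cg).
apply: (integral_powR_add g r0).
- exact: (measurableT_comp measurable_eucl_id).
- exact: (measurableT_comp measurable_eucl_id).
- exact: measurable_dist.
- by move=> z; exact: eucl_ge0.
- by move=> z; exact: eucl_ge0.
- by move=> z; rewrite dist_ge0 (le_trans (ler_euclD _ _))// euclN.
Qed.

Lemma moment_le_cost (r : R) (mu nu : PM) g : (0 < r)%R -> couplings mu nu g ->
  moment r nu <= (2 `^ r)%:E * (moment r mu + cost r g).
Proof.
move=> r0 cg; rewrite (moment_fst r cg) (moment_snd r cg).
apply: (integral_powR_add g r0).
- exact: (measurableT_comp measurable_eucl_id).
- exact: measurable_dist.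
- exact: (measurableT_comp measurable_eucl_id).
- by move=> z; exact: eucl_ge0.
- by move=> z; exact: dist_ge0.
- by move=> z; rewrite eucl_ge0 /dist eucl_subC eucl_dist.
Qed.

Lemma dW_le_cost (r c : R) (mu nu : PM) g : (0 < r)%R -> couplings mu nu g ->
  cost r g <= c%:E -> dW r mu nu <= (c `^ r^-1)%:E.
Proof.
move=> r0 cg gc; rewrite -poweR_EFin /dW; apply: gt0_ler_poweR.
- by rewrite invr_ge0 ltW.
- by rewrite in_itv/= leey andbT; apply: le_ereal_inf_tmp => _ [h _ <-]; exact: cost_ge0.
- by rewrite in_itv/= leey andbT (le_trans (cost_ge0 _ _) gc).
- by apply: le_trans gc; apply: ereal_inf_lbound; exists g.
Qed.

Lemma dW_lt_cost (r c : R) (mu nu : PM) : (0 < r)%R -> (0 <= c)%R -> dW r mu nu < c%:E ->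
  exists2 g, couplings mu nu g & cost r g < (c `^ r)%:E.
Proof.
move=> r0 c0; rewrite /dW; set D := ereal_inf _ => Dc.
have D0 : 0 <= D by apply: le_ereal_inf_tmp => _ [h _ <-]; exact: cost_ge0.
have : D < (c `^ r)%:E.
  case: D D0 Dc => [x| |]//.
    rewrite lee_fin poweR_EFin !lte_fin => x0 xc.
    by rewrite -(powRVK (s := r) (x := x)) ?gt_eqF// ltr_powR_ge0 ?powR_ge0.
  by move=> _; rewrite poweRyr// invr_neq0// gt_eqF.
by move=> /ereal_inf_lt[_ [g cg <-] gc]; exists g.
Qed.

Lemma law_moment (X : RVec R d) r : moment r (law X) = \int[rv_P X]_w nrmp X r w.
Proof.
rewrite /moment /law ge0_integral_distribution//; first exact: measurable_eucl_pow.
by move=> x; rewrite lee_fin powR_ge0.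
Qed.

(** Bounded moments bound the cost of product couplings. Conversely, the moment of any law is
    controlled by that of one fixed law and the cost of a coupling with it. *)
Lemma bounded_LrE (I : Type) (X : I -> RVec R d) (r : R) : (0 < r)%R ->
  bounded_Lr X r <-> mbounded (Mr r) (dW r) (laws X).
Proof.
move=> r0; split=> [[C HC]|[XM [C HC]]].
- have mC i : moment r (law (X i)) <= C%:E by rewrite law_moment.
  split; first by move=> _ [i _ <-]; exact: le_lt_trans (mC i) (ltry _).
  exists ((2 `^ r * (C + C)) `^ r^-1)%R => _ _ [i _ <-] [j _ <-].
  apply: (dW_le_cost r0 (couplings_prod _ _)).
  apply: le_trans (cost_le_moments r0 (couplings_prod _ _)) _.
  by rewrite EFinM lee_wpmul2l ?lee_fin ?powR_ge0// EFinD leeD.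
- have [[i0]|noI] := pselect (inhabited I); last first.
    by exists 0%R => i; exfalso; apply: noI; constructor.
  (* The infimum defining [dW] need not be attained; a strict bound provides an actual coupling. *)
  have C1 : (C < `|C| + 1)%R by rewrite (le_lt_trans (ler_norm _))// ltrDl.
  have m0 : moment r (law (X i0)) \is a fin_num.
    by rewrite ge0_fin_numE ?moment_ge0//; apply: XM; exists i0.
  exists (2 `^ r * (fine (moment r (law (X i0))) + (`|C| + 1) `^ r))%R => i.
  have : dW r (law (X i0)) (law (X i)) < (`|C| + 1)%:E.
    by apply: le_lt_trans (HC _ _ _ _) _; [exists i0|exists i|rewrite lte_fin].
  move=> /dW_lt_cost[//||g cg gc]; first by rewrite addr_ge0.
  rewrite -law_moment; apply: le_trans (moment_le_cost r0 cg) _.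
  by rewrite EFinM lee_wpmul2l ?lee_fin ?powR_ge0// EFinD fineK// leeD2l// ltW.
Qed.

End wasserstein_moments.

(** * Compactness and tails *)

Lemma minkowski_le (R : realType) d (T : measurableType d) (P : probability T R) (a b c : T -> R) (r : R) :
  1 <= r -> measurable_fun setT a -> measurable_fun setT b -> measurable_fun setT c ->
  (forall z, 0 <= a z) -> (forall z, 0 <= b z) -> (forall z, 0 <= c z <= a z + b z) ->
  (poweR (\int[P]_z (c z `^ r)%:E) r^-1 <=
   poweR (\int[P]_z (a z `^ r)%:E) r^-1 + poweR (\int[P]_z (b z `^ r)%:E) r^-1)%E.
Proof.
move=> r1 ma mb mc a0 b0 c0; have r0 : 0 < r := lt_le_trans ltr01 r1.
have LE (f : T -> R) : (forall z, 0 <= f z) ->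
    Lnorm P r%:E (EFin \o f) = poweR (\int[P]_z (f z `^ r)%:E)%E r^-1.
  move=> f0; rewrite Lnorm.unlock; apply: (congr1 (fun v => poweR v r^-1)); apply: eq_integral => z _.
  by rewrite /= (ger0_norm (f0 z)).
have ab0 z : 0 <= (a \+ b) z by exact: addr_ge0.
have := minkowski_EFin P ma mb r1; rewrite (LE _ a0) (LE _ b0) (LE _ ab0).
apply: le_trans; apply: gt0_ler_poweR; first by rewrite invr_ge0 ltW.
- by rewrite in_itv/= leey andbT integral_ge0// => z _; rewrite lee_fin powR_ge0.
- by rewrite in_itv/= leey andbT integral_ge0// => z _; rewrite lee_fin powR_ge0.
have mp (f : T -> R) : measurable_fun setT f -> measurable_fun setT (fun z => (f z `^ r)%:E).
  by move=> mf; apply/measurable_EFinP; exact: (measurableT_comp (measurable_powR _) mf).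
apply: ge0_le_integral => //.
- by move=> z _; rewrite lee_fin powR_ge0.
- exact: mp.
- by apply: mp; exact: measurable_funD.
- by move=> z _; have /andP[? ?] := c0 z; rewrite lee_fin ler_powR_ge0// addr_ge0.
Qed.

Section compact_exhaustion.
Variables (R : realType) (X : Type) (S : set X) (dist : X -> X -> \bar R).

(** The sets V n cover the closure of A, and an increasing cover with a finite subcover is exhausted
    by its largest member. The hypothesis on dist x x puts A inside its closure. *)
Lemma rel_compact_exhaust (A : set X) (V : nat -> set X) :
  (forall x, S x -> forall r : R, 0 < r -> (dist x x < r%:E)%E) ->
  rel_compact S dist A -> (forall n, mopen S dist (V n)) ->
  (forall n m, (n <= m)%N -> V n `<=` V m) -> S `<=` \bigcup_n V n ->
  exists n, A `<=` V n.
Proof.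
move=> dxx [AS [_ K]] oV incV SV.
have AK : A `<=` mclosure S dist A.
  move=> x Ax; split; first exact: AS.
  by move=> r r0; exists x; split => //; split; [exact: AS|exact: dxx (AS _ Ax) _ r0].
have [|x Kx|G [finG GF KG]] := K (range V).
- by move=> _ [n _ <-].
- by have [n _ Vx] := SV x (proj1 Kx); exists (V n) => //; exists n.
(* A finite subcover is a family of sets, so indices are recovered by choice before taking their
   maximum. *)
have /choice[idx Hidx] (U : set X) : exists n, G U -> U = V n.
  have [/GF[n _ <-]|nG] := pselect (G U); first by exists n.
  by exists 0%N.
have [s GE] : exists s : seq nat, forall U, G U -> idx U \in s.
  have /finite_seqP[s sE] := finite_image idx finG.
  exists s => U GU; have : [set` s] (idx U) by rewrite -sE; exists U.
  by [].
exists (\max_(i <- s) i) => x /AK/KG[U GU Ux].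
apply: (incV (idx U)); last by rewrite -(Hidx _ GU).
by rewrite (leq_bigmax_seq (F := id))//; exact: GE.
Qed.

End compact_exhaustion.

Section law_tails.
Variables (R : realType) (d : nat).
Local Open Scope ereal_scope.
Notation PM := (probability (Rd R d) R).

Definition utight (A : set PM) := forall e : R, (0 < e)%R -> exists n : nat,
  forall mu, A mu -> mu [set x | (n%:R < eucl (x : 'rV[R]_d))%R] <= e%:E.

(** Being 1-Lipschitz, unlike |x| 1{|x| > n}, it makes bounds on tail moments open and closed under
    small Wasserstein perturbations, up to an arbitrarily small loss. *)
Definition overshoot (n : nat) (x : Rd R d) : R := (Num.max (eucl (x : 'rV[R]_d) - n%:R) 0)%R.

Definition tail_moment (r : R) (n : nat) (mu : PM) := \int[mu]_x (overshoot n x `^ r)%:E.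

Definition uexcess (r : R) (A : set PM) := forall e : R, (0 < e)%R -> exists n : nat,
  forall mu, A mu -> tail_moment r n mu <= e%:E.

Lemma overshoot_ge0 n x : (0 <= overshoot n x)%R.
Proof. by rewrite le_max lexx orbT. Qed.

Lemma measurable_overshoot n : measurable_fun setT (overshoot n).
Proof.
apply: measurable_maxr; last exact: measurable_cst.
by apply: measurable_funB; [exact: measurable_eucl_id|exact: measurable_cst].
Qed.

Lemma measurable_overshoot_pow r n : measurable_fun setT (fun x => (overshoot n x `^ r)%:E).
Proof.
by apply/measurable_EFinP; exact: (measurableT_comp (measurable_powR _) (measurable_overshoot _)).
Qed.

Lemma measurable_gt_eucl (t : R) : measurable [set x : Rd R d | (t < eucl (x : 'rV[R]_d))%R].
Proof.
have /measurable_EFinP/(measurable_gt_ereal t%:E) := @measurable_eucl_id R d.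
by under eq_set do rewrite lte_fin.
Qed.

Lemma tail_moment_ge0 r n mu : 0 <= tail_moment r n mu.
Proof. by apply: integral_ge0 => x _; rewrite lee_fin powR_ge0. Qed.

Lemma law_tail (X : RVec R d) (t : R) :
  law X [set x | (t < eucl (x : 'rV[R]_d))%R] = rv_P X [set w | (t < eucl (rv_X X w))%R].
Proof. by []. Qed.

Lemma law_tail_moment (X : RVec R d) r n :
  tail_moment r n (law X) = \int[rv_P X]_w (overshoot n (rv_X X w) `^ r)%:E.
Proof.
rewrite /tail_moment /law ge0_integral_distribution//; first exact: measurable_overshoot_pow.
by move=> x; rewrite lee_fin powR_ge0.
Qed.

Lemma tightE (I : Type) (X : I -> RVec R d) : tight X <-> utight (laws X).
Proof.
split=> H e /H[].
- move=> t0 Ht0; exists (Num.truncn t0).+1 => _ [i _ <-].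
  by rewrite law_tail; apply: Ht0; rewrite ltW// truncnS_gt.
- move=> n Hn; exists n%:R => t nt i.
  apply: le_trans (Hn (law (X i)) _); last by exists i.
  rewrite -law_tail; apply: le_measure; rewrite ?inE; [exact: measurable_gt_eucl..|].
  by move=> x /=; apply: le_lt_trans.
Qed.

(** The overshoot is at most |x| and vanishes for |x| <= n; conversely |x| <= 2 (|x| - n) once |x| >
    2n, which explains the factor 2^r and the threshold 2n. *)
Lemma unifE (I : Type) (X : I -> RVec R d) (r : R) : (0 < r)%R ->
  unif_r_integrable X r <-> uexcess r (laws X).
Proof.
move=> r0; split=> H e e0.
- have [t0 Ht0] := H _ e0; exists (Num.truncn t0).+1 => _ [i _ <-]; rewrite law_tail_moment.
  set n := (_ .+1)%N; apply: le_trans (Ht0 n%:R _ i); last by rewrite ltW// truncnS_gt.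
  rewrite [leRHS]integral_mkcond.
  apply: ge0_le_integral => //.
  + by move=> w _; rewrite lee_fin powR_ge0.
  + by apply: (measurableT_comp (measurable_overshoot_pow r n)).
  + apply/(measurable_restrictT _ _).1.
      by apply: (measurable_gt_fun (Z := fun j w => radius w)) => j; exact: measurable_radius.
    by apply: measurable_funTS; exact: measurable_nrmp.
  + move=> w _; rewrite patchE; case: ifPn => [_|/negP].
      rewrite lee_fin ler_powR_ge0 ?overshoot_ge0 ?eucl_ge0//.
      by rewrite ge_max eucl_ge0 andbT lerBlDr lerDl.
    rewrite inE/= => /negP; rewrite -leNgt => h.
    by rewrite /overshoot max_r ?subr_le0// powR0// gt_eqF.
- have e20 : (0 < e / 2 `^ r)%R by rewrite divr_gt0// powR_gt0.
  have [n Hn] := H _ e20; exists (2 * n%:R)%R => t nt i.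
  have := Hn (law (X i)) (ex_intro2 _ _ i Logic.I erefl); rewrite law_tail_moment.
  rewrite EFinM lee_pdivlMr ?powR_gt0// muleC; apply: le_trans.
  have mo : measurable_fun setT (fun w => (overshoot n (rv_X (X i) w) `^ r)%:E).
    by apply: (measurableT_comp (measurable_overshoot_pow r n)).
  rewrite -ge0_integralZl_EFin ?powR_ge0//; last by move=> w _; rewrite lee_fin powR_ge0.
  rewrite [leLHS]integral_mkcond; apply: ge0_le_integral => //.
  + by move=> w _; rewrite patchE; case: ifPn => // _; exact: nrmp_ge0.
  + apply/(measurable_restrictT _ _).1.
      by apply: (measurable_gt_fun (Z := fun j w => radius w)) => j; exact: measurable_radius.
    by apply: measurable_funTS; exact: measurable_nrmp.
  + exact: measurable_funeM.
  + move=> w _; rewrite patchE; case: ifPn => [|_]; last by rewrite -EFinM lee_fin mulr_ge0 ?powR_ge0.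
    rewrite inE/= => tw; rewrite -EFinM lee_fin -powRM ?overshoot_ge0//.
    rewrite ler_powR_ge0 ?eucl_ge0 ?mulr_ge0 ?overshoot_ge0//.
    rewrite /overshoot max_l; last by have := ler0n R n; lra.
    lra.
Qed.

(** The identity on the space carrying mu; it lets criteria for families of random vectors apply to
    a single law. *)
Definition of_law (mu : PM) : RVec R d :=
  @MkRVec R d _ _ mu (mfun_Sub (mem_set (@measurable_id _ (Rd R d) setT))).

Definition nrmp_RV (X : RVec R d) (s : R) : PosRV R :=
  @MkPosRV R _ _ (rv_P X) (mfun_Sub (mem_set (@measurable_nrmp R d unit (fun _ => X) tt s)))
    (@nrmp_ge0 R d unit (fun _ => X) tt s).

(** The norm of a random vector with law mu is its own finite st-bound. *)
Lemma tight_single (mu : PM) (e : R) : (0 < e)%R -> exists n : nat,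
  mu [set x | (n%:R < eucl (x : 'rV[R]_d))%R] <= e%:E.
Proof.
pose X := fun _ : unit => of_law mu.
have : tight X.
  apply: finite_st_tight; exists (nrmp_RV (of_law mu) 1); split.
    rewrite /finiteY/= (_ : [set w | _] = setT) ?probability_setT//.
    by apply/seteqP; split=> // w _ /=; rewrite ltry.
  by rewrite nrm_nrmp1 => i.
move=> /tightE H e0; have [n Hn] := H e e0; exists n.
by apply: (Hn (law (of_law mu))); exists tt.
Qed.

(** The integrable variable |X|^r is its own icx-bound. *)
Lemma tail_moment_single (r : R) (mu : PM) (e : R) : (0 < r)%R -> Mr r mu -> (0 < e)%R ->
  exists n : nat, tail_moment r n mu <= e%:E.
Proof.
move=> r0 mur e0; pose X := fun _ : unit => of_law mu.
have : unif_r_integrable X r.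
  by apply: (@icx_unif_integrable _ _ _ X r (nrmp_RV (of_law mu) r)) => // i t t0.
move=> /(unifE _ r0) H; have [n Hn] := H e e0; exists n.
apply: le_trans (Hn (law (of_law mu)) _); last by exists tt.
(* The law of the identity agrees with mu on all sets without being the same record. *)
rewrite le_eqVlt; apply/orP; left; apply/eqP; exact: eq_measure_integral.
Qed.

End law_tails.

Section prohorov.
Variables (R : realType) (d : nat).
Local Open Scope ereal_scope.
Notation PM := (probability (Rd R d) R).

Lemma eps_nbhd_measurable (B : set (Rd R d)) (e : R) : measurable (eps_nbhd B e : set (Rd R d)).
Proof.
apply: eopen_measurable => x [y By xy]; have [r r0 Hr] := @eopen_lt_eucl R d y e x xy.
by exists r => // z zx; exists y => //; apply: Hr.
Qed.

Lemma subset_eps_nbhd (B : set (Rd R d)) (e : R) : (0 < e)%R -> B `<=` eps_nbhd B e.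
Proof. by move=> e0 x Bx; exists x; rewrite // subrr eucl0. Qed.

Lemma dP_lt (mu nu : PM) (c : R) : dP mu nu < c%:E -> exists e : R, [/\ (0 < e)%R, (e < c)%R &
  forall B : set (Rd R d), measurable B ->
    mu B <= nu (eps_nbhd B e) + e%:E /\ nu B <= mu (eps_nbhd B e) + e%:E].
Proof. by move=> /ereal_inf_lt[_ [e [e0 H] <-]]; rewrite lte_fin => ec; exists e. Qed.

Lemma dP_le (mu nu : PM) (e : R) : (0 < e)%R ->
  (forall B : set (Rd R d), measurable B ->
    mu B <= nu (eps_nbhd B e) + e%:E /\ nu B <= mu (eps_nbhd B e) + e%:E) -> dP mu nu <= e%:E.
Proof. by move=> e0 H; apply: ereal_inf_lbound; exists e. Qed.

Lemma dP_refl (mu : PM) (r : R) : (0 < r)%R -> dP mu mu < r%:E.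
Proof.
move=> r0; have r20 : (0 < r / 2)%R by rewrite divr_gt0.
apply: (@le_lt_trans _ _ (r / 2)%:E); last by rewrite lte_fin ltr_pdivrMr// ltr_pMr// ltr1n.
apply: dP_le => // B mB; suff H : mu B <= mu (eps_nbhd B (r / 2)) + (r / 2)%:E by split.
rewrite -[leLHS]adde0 leeD//; last by rewrite lee_fin ltW.
by apply: le_measure; rewrite ?inE//; [exact: eps_nbhd_measurable|exact: subset_eps_nbhd].
Qed.

Let far (t : R) : set (Rd R d) := [set x | (t < eucl (x : 'rV[R]_d))%R].

Let mfar t : measurable (far t). Proof. exact: measurable_gt_eucl. Qed.

(** A neighbourhood of radius e < c of {|x| > t} stays inside {|x| > t - c}. *)
Lemma dP_far (mu nu : PM) (t c : R) : dP mu nu < c%:E -> nu (far t) <= mu (far (t - c)) + c%:E.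
Proof.
move=> /dP_lt[e [e0 ec /(_ _ (mfar t))[_ H]]]; apply: le_trans H _.
rewrite leeD ?lee_fin ?(ltW ec)//; apply: le_measure; rewrite ?inE//.
  exact: eps_nbhd_measurable.
move=> x [y /= ty xy]; rewrite /far/= ltrBlDr (lt_trans ty)//.
by rewrite (le_lt_trans (eucl_dist y x))// ltrD2l eucl_subC (lt_trans xy).
Qed.

Lemma dP_rel_compact_tight (A : set PM) : rel_compact setT (@dP R d) A -> utight A.
Proof.
move=> KA e e0.
(* The slack h makes V n open although mu may charge spheres. *)
pose V (n : nat) : set PM := [set mu | exists2 h : R, (0 < h)%R & mu (far (n%:R - h)) + h%:E < e%:E].
have far_mono (mu : PM) (s t : R) : (s <= t)%R -> mu (far t) <= mu (far s).
  by move=> st; apply: le_measure; rewrite ?inE// => x /=; apply: le_lt_trans.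
have [n Hn] : exists n, A `<=` V n.
  apply: rel_compact_exhaust KA _ _ _.
  - by move=> mu _ r; exact: dP_refl.
  - move=> n; split=> // mu [h h0 Hh]; exists (h / 2)%R; first by rewrite divr_gt0.
    (* Half of the slack pays for the change of radius and of mass within Prohorov distance h/2, and
       the other half remains as slack for nu. *)
    move=> nu [_ munu]; exists (h / 2)%R; first by rewrite divr_gt0.
    apply: le_lt_trans Hh; have := dP_far (n%:R - h / 2)%R munu.
    rewrite -addrA -opprD -splitr => /(leeD2r (h / 2)%:E)/le_trans; apply.
    by rewrite -addeA -EFinD -splitr.
  - move=> n m nm mu [h h0 Hh]; exists h => //; apply: le_lt_trans Hh.
    by rewrite leeD2r// far_mono// lerB// ler_nat.
  - move=> mu _; have e40 : (0 < e / 4)%R by rewrite divr_gt0.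
    have [n Hn] := tight_single mu e40; exists n.+1 => //.
    (* Slack at most 1 keeps the level n + 1 - h above n, where the tail is known. *)
    exists (Num.min 1 (e / 4))%R; first by rewrite lt_min ltr01.
    apply: (@le_lt_trans _ _ ((e / 4)%:E + (e / 4)%:E)); last by rewrite -EFinD lte_fin; lra.
    apply: leeD; last by rewrite lee_fin ge_min lexx orbT.
    apply: le_trans Hn; apply: far_mono; rewrite -natr1 -addrA lerDl subr_ge0.
    by rewrite ge_min lexx.
exists n => mu /Hn[h h0 Hh]; apply: le_trans (ltW Hh); rewrite -[leLHS]adde0.
by rewrite leeD ?lee_fin ?(ltW h0)// far_mono// lerBlDr lerDl ltW.
Qed.

End prohorov.

Section wasserstein_compact.
Variables (R : realType) (d : nat) (r : R).
Hypothesis r1 : 1 <= r.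
Local Open Scope ereal_scope.
Notation PM := (probability (Rd R d) R).

Let r0 : (0 < r)%R := lt_le_trans ltr01 r1.

Lemma dW_refl (mu : PM) (e : R) : (0 < e)%R -> dW r mu mu < e%:E.
Proof.
move=> e0.
have mD : measurable_fun setT (fun x : Rd R d => (x, x)).
  by apply: measurable_fun_pair; exact: measurable_id.
pose g : probability (Rd R d * Rd R d)%type R := distribution mu (mfun_Sub (mem_set mD)).
have cg : couplings mu mu g.
  by move=> A mA; split; congr (mu _); apply/seteqP; split=> x //= [].
apply: (@le_lt_trans _ _ (0 `^ r^-1)%:E); last by rewrite powR0 ?invr_neq0 ?gt_eqF// lte_fin.
apply: (dW_le_cost r0 cg); rewrite /cost ge0_integral_distribution//.
- by rewrite integral0_eq// => x _; rewrite /dist/= subrr eucl0 powR0 ?gt_eqF.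
- exact: measurable_dist_pow.
- by move=> z; rewrite lee_fin powR_ge0.
Qed.

(* The overshoot is 1-Lipschitz, so that tail_moment^(1/r) is 1-Lipschitz for dW
   by Minkowski's inequality. *)
Lemma tail_moment_dW (mu nu : PM) n (c : R) : (0 < c)%R -> poweR (tail_moment r n mu) r^-1 \is a fin_num ->
  dW r mu nu < c%:E ->
  poweR (tail_moment r n nu) r^-1 < poweR (tail_moment r n mu) r^-1 + c%:E.
Proof.
move=> c0 mfin /(dW_lt_cost r0 (ltW c0))[g cg gc].
have E1 : tail_moment r n mu = \int[g]_z (overshoot n z.1 `^ r)%:E.
  symmetry; apply: (coupling_fst cg (measurable_overshoot_pow r n)) => x.
  by rewrite lee_fin powR_ge0.
rewrite E1 in mfin *.
have -> : tail_moment r n nu = \int[g]_z (overshoot n z.2 `^ r)%:E.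
  symmetry; apply: (coupling_snd cg (measurable_overshoot_pow r n)) => x.
  by rewrite lee_fin powR_ge0.
have C : poweR (cost r g) r^-1 < c%:E.
  have := gc; case: (cost r g) (cost_ge0 r g) => [x| |]// x0.
  rewrite poweR_EFin !lte_fin => xc; rewrite -(powRK (s := r) (x := c)) ?gt_eqF ?(ltW c0)//.
  by rewrite ltr_powR_ge0 ?invr_gt0 ?powR_ge0.
apply: (le_lt_trans (minkowski_le (a := fun z => overshoot n z.1) (b := @dist R d) g r1 _ _ _ _ _ _)).
- exact: (measurableT_comp (measurable_overshoot n)).
- exact: measurable_dist.
- exact: (measurableT_comp (measurable_overshoot n)).
- by move=> z; exact: overshoot_ge0.
- by move=> z; exact: dist_ge0.
- move=> z; rewrite overshoot_ge0/= ge_max; apply/andP; split; last first.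
    by rewrite addr_ge0 ?overshoot_ge0 ?dist_ge0.
  have := eucl_dist (z.2 : 'rV[R]_d) z.1; rewrite eucl_subC -/(dist z) => h.
  have : (eucl (z.1 : 'rV[R]_d) - n%:R <= overshoot n z.1)%R by rewrite le_max lexx.
  by move: h; move: (eucl _) (eucl _) (dist z) (overshoot _ _) => a b e f; lra.
by rewrite lteD2lE.
Qed.

Lemma dW_rel_compact_uexcess (A : set PM) : rel_compact (Mr r) (dW r) A -> uexcess r A.
Proof.
(* The condition is stated for r-th roots, which are the Lipschitz quantities; c is the root of
   e. *)
move=> KA e e0; pose c : R := (e `^ r^-1)%R; have c0 : (0 < c)%R by rewrite powR_gt0.
pose N n (mu : PM) := poweR (tail_moment r n mu) r^-1.
have Nmono n m mu : (n <= m)%N -> N m mu <= N n mu.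
  move=> nm; apply: gt0_ler_poweR; first by rewrite invr_ge0 ltW.
  - by rewrite in_itv/= leey andbT tail_moment_ge0.
  - by rewrite in_itv/= leey andbT tail_moment_ge0.
  apply: ge0_le_integral => //.
  - by move=> x _; rewrite lee_fin powR_ge0.
  - exact: measurable_overshoot_pow.
  - exact: measurable_overshoot_pow.
  - move=> x _; rewrite lee_fin ler_powR_ge0 ?overshoot_ge0//.
    rewrite ge_max overshoot_ge0 andbT le_max; apply/orP; left.
    by rewrite lerB// ler_nat.
pose V (n : nat) : set PM := [set mu | Mr r mu /\ N n mu < c%:E].
have [n Hn] : exists n, A `<=` V n.
  apply: rel_compact_exhaust KA _ _ _.
  - by move=> mu _ h; exact: dW_refl.
  - move=> n; split=> [mu [//]|mu [mur Nc]].
    have Nfin : N n mu \is a fin_num by rewrite ge0_fin_numE ?poweR_ge0// (lt_trans Nc) ?ltry.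
    exists (c - fine (N n mu))%R; first by rewrite subr_gt0 -lte_fin fineK.
    move=> nu [nur munu]; split=> //.
    have h : (0 < c - fine (N n mu))%R by rewrite subr_gt0 -lte_fin fineK.
    apply: lt_le_trans (tail_moment_dW h Nfin munu) _.
    by rewrite -[X in X + _]fineK// -EFinD addrC subrK.
  - by move=> n m nm mu [mur Nc]; split; [exact: mur|exact: (le_lt_trans (Nmono _ _ mu nm) Nc)].
  - move=> mu mur; have c2 : (0 < (c / 2) `^ r)%R by rewrite powR_gt0// divr_gt0.
    have [n Hn] := tail_moment_single r0 mur c2; exists n => //; split => //.
    apply: (@le_lt_trans _ _ (c / 2)%:E); last by rewrite lte_fin ltr_pdivrMr// ltr_pMr// ltr1n.
    rewrite -(powRK (s := r) (x := c / 2)) ?gt_eqF ?divr_ge0 ?(ltW c0)// -poweR_EFin.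
    apply: gt0_ler_poweR => //; first by rewrite invr_ge0 ltW.
      by rewrite in_itv/= leey andbT tail_moment_ge0.
    by rewrite in_itv/= leey andbT lee_fin ltW.
exists n => mu /Hn[_ Nc].
rewrite -(powRVK (s := r) (x := e)) ?gt_eqF ?(ltW e0)// -poweR_EFin.
rewrite -(poweRVK (s := r) (y := tail_moment r n mu)) ?gt_eqF ?tail_moment_ge0//.
apply: gt0_ler_poweR; rewrite ?(ltW r0)//; last exact: ltW.
- by rewrite in_itv/= leey andbT poweR_ge0.
- by rewrite in_itv/= leey andbT lee_fin ltW.
Qed.

End wasserstein_compact.

(** * Limits of ultrafilters of laws *)

(** If a cover of the closure had no finite subcover, the complements of its finite unions would
    generate a proper filter. An ultrafilter refining it converges to a point of some member U of
    the cover, and would contain both U and its complement. *)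
Lemma ultra_rel_compact (R : realType) (X : Type) (S : set X) (dist : X -> X -> \bar R) (A : set X) :
  A `<=` S ->
  (forall FF : set_system X, UltraFilter FF -> FF (mclosure S dist A) ->
     exists2 x, mclosure S dist A x & forall r : R, 0 < r -> FF (mball S dist x r)) ->
  rel_compact S dist A.
Proof.
move=> AS H; split=> //; set K := mclosure S dist A; split; first by move=> x [].
move=> F oF KF; apply: contrapT => noG.
pose F0 : set_system X := [set P | exists G : set (set X),
  [/\ finite_set G, G `<=` F & K `\` \bigcup_(U in G) U `<=` P]].
have PF0 : ProperFilter F0.
  split.
    move=> [G [finG GF KG]]; apply: noG; exists G; split=> // x Kx.
    by apply: contrapT => nGx; exact: (KG x).
  split.
  - by exists set0; split=> //.
  - move=> P Q [G [finG GF KG]] [G' [finG' GF' KG']]; exists (G `|` G'); split.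
    + by rewrite finite_setU.
    + by move=> U [/GF|/GF'].
    + move=> x [Kx nx]; split; [apply: KG|apply: KG']; split=> // -[U GU Ux]; apply: nx; exists U => //.
        by left.
      by right.
  - by move=> P Q PQ [G [finG GF KG]]; exists G; split=> //; exact: subset_trans KG PQ.
have [FF [uFF sFF]] := ultraFilterLemma PF0.
have FFK : FF K by apply: sFF; exists set0; split=> // x [].
have [x Kx Hx] := H FF uFF FFK.
have [U FU Ux] := KF x Kx; have [r r0 rU] := (oF U FU).2 x Ux.
have FFU : FF U by apply: filterS (Hx r r0).
have FFcU : FF (~` U).
  apply: sFF; exists [set U]; split; [exact: finite_set1|by move=> _ ->|].
  by move=> y [Ky nUy] Uy; apply: nUy; exists U.
have PF : ProperFilter FF := @ultra_proper _ _ uFF.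
by apply: (@filter_not_empty _ FF PF); rewrite -(setICr U); exact: filterI.
Qed.

(** * Gluing two laws along a finite partition *)

Section gluing.
Context d1 d2 (T1 : measurableType d1) (T2 : measurableType d2) (R : realType).
Variables (P1 : probability T1 R) (P2 : probability T2 R) (F : finType) (i1 : T1 -> F) (i2 : T2 -> F).
Hypothesis mi1 : forall s, measurable (i1 @^-1` [set s]).
Hypothesis mi2 : forall s, measurable (i2 @^-1` [set s]).

Let m s : R := fine (P1 (i1 @^-1` [set s])).
Let w s : R := fine (P2 (i2 @^-1` [set s])).

Let mE s : P1 (i1 @^-1` [set s]) = (m s)%:E.
Proof. by rewrite fineK// fin_num_measure. Qed.

Let wE s : P2 (i2 @^-1` [set s]) = (w s)%:E.
Proof. by rewrite fineK// fin_num_measure. Qed.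

Let m0 s : 0 <= m s. Proof. by rewrite fine_ge0. Qed.
Let w0 s : 0 <= w s. Proof. by rewrite fine_ge0. Qed.

Let sum_fibers d (T : measurableType d) (P : probability T R) (i : T -> F)
  (mi : forall s, measurable (i @^-1` [set s])) (A : set T) : measurable A ->
  (\sum_s P (A `&` i @^-1` [set s]) = P A)%E.
Proof.
move=> mA; transitivity (\int[P]_(x in A) (\sum_s (\1_(i @^-1` [set s]) x)%:E))%E.
  rewrite ge0_integral_sum//.
  - by apply: eq_bigr => s _; rewrite integral_indic// setIC.
  - by move=> s; apply: measurable_funTS; apply/measurable_EFinP/measurable_indic.
rewrite (eq_integral (cst 1%E)); first by rewrite integral_cst// mul1e.
move=> x _; rewrite (bigD1 (i x))//= big1 ?adde0; last first.
  by move=> s si; rewrite indicE memNset//= => E; rewrite E eqxx in si.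
by rewrite indicE mem_set.
Qed.

Let a s : R := Num.max (m s - w s) 0.
Let b s : R := Num.max (w s - m s) 0.
Let delta : R := \sum_s a s.

(* The weights of the coupling of (m s) and (w t): the common mass sits on the
   diagonal and the excess is spread independently.  When delta = 0 both a and b
   vanish, so that the junk value of the quotient does not matter. *)
Let c s t : R := (s == t)%:R * Num.min (m s) (w s) + a s * b t / delta.
(** Density of the coupling with respect to P1 x P2 on a product of cells: given the two cells, the
    points are independent. When a cell mass is 0, the weight c vanishes too and the quotient is
    0. *)
Let k (p : F * F) : R := c p.1 p.2 / (m p.1 * w p.2).

Let B (p : F * F) : set (T1 * T2) := (i1 @^-1` [set p.1]) `*` (i2 @^-1` [set p.2]).

Let mB p : measurable (B p). Proof. exact: measurableX. Qed.

Let a0 s : 0 <= a s. Proof. by rewrite le_max lexx orbT. Qed.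
Let b0 s : 0 <= b s. Proof. by rewrite le_max lexx orbT. Qed.

Let c0 s t : 0 <= c s t.
Proof.
rewrite addr_ge0// ?mulr_ge0 ?ler0n ?le_min ?m0 ?w0//.
by rewrite invr_ge0 sumr_ge0.
Qed.

Let k0 p : 0 <= k p. Proof. by rewrite divr_ge0// mulr_ge0. Qed.

Let sum_m : \sum_s m s = 1.
Proof.
apply: EFin_inj; rewrite -sumEFin -(probability_setT P1) -(sum_fibers P1 mi1 measurableT).
by apply: eq_bigr => s _; rewrite setTI mE.
Qed.

Let sum_w : \sum_s w s = 1.
Proof.
apply: EFin_inj; rewrite -sumEFin -(probability_setT P2) -(sum_fibers P2 mi2 measurableT).
by apply: eq_bigr => s _; rewrite setTI wE.
Qed.

Let sum_b : \sum_s b s = delta.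
Proof.
apply/eqP; rewrite -subr_eq0 /delta -sumrB (eq_bigr (fun s => w s - m s)).
  by rewrite sumrB sum_m sum_w subrr.
move=> s _; rewrite /a /b; have [h|h] := leP (m s) (w s).
  by rewrite max_l ?subr_ge0// max_r ?subr_le0// subr0.
by rewrite max_r ?subr_le0 ?ltW// max_l ?subr_ge0 ?ltW// sub0r opprB.
Qed.

Let min_a s : Num.min (m s) (w s) + a s = m s.
Proof.
rewrite /a; have [h|h] := leP (m s) (w s); first by rewrite max_r ?subr_le0// addr0.
by rewrite max_l ?subr_ge0 ?ltW// addrC subrK.
Qed.

Let min_b s : Num.min (m s) (w s) + b s = w s.
Proof.
rewrite /b; have [h|h] := leP (m s) (w s); first by rewrite max_l ?subr_ge0// addrC subrK.
by rewrite max_r ?subr_le0 ?ltW// addr0.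
Qed.

Let delta_le s : (delta = 0) -> a s = 0 /\ b s = 0.
Proof.
move=> d0; split; apply/eqP; rewrite eq_le ?a0 ?b0 andbT.
  by rewrite -d0 /delta (bigD1 s)//= lerDl sumr_ge0.
by rewrite -d0 -sum_b (bigD1 s)//= lerDl sumr_ge0.
Qed.

Let sum_c_row s : \sum_t c s t = m s.
Proof.
rewrite big_split/= -[RHS]min_a; congr (_ + _).
  rewrite (bigD1 s)//= eqxx mul1r big1 ?addr0// => t ts.
  by rewrite eq_sym (negbTE ts) mul0r.
rewrite -mulr_suml -mulr_sumr sum_b; have [d0|d0] := eqVneq delta 0.
  by have [-> _] := delta_le s d0; rewrite !mul0r.
by rewrite mulfK.
Qed.

Let sum_c_col t : \sum_s c s t = w t.
Proof.
rewrite big_split/= -[RHS]min_b; congr (_ + _).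
  rewrite (bigD1 t)//= eqxx mul1r big1 ?addr0// => s st.
  by rewrite (negbTE st) mul0r.
rewrite -mulr_suml -mulr_suml -/delta; have [d0|d0] := eqVneq delta 0.
  by have [_ ->] := delta_le t d0; rewrite !mulr0 mul0r.
by rewrite mulrAC divff// mul1r.
Qed.

Let c_le_m s t : c s t <= m s.
Proof. by rewrite -sum_c_row (bigD1 t)//= lerDl sumr_ge0. Qed.

Let c_le_w s t : c s t <= w t.
Proof. by rewrite -sum_c_col (bigD1 s)//= lerDl sumr_ge0. Qed.

Local Open Scope ereal_scope.

Let dens (z : T1 * T2) : \bar R := \sum_p (k p)%:E * (\1_(B p) z)%:E.

Let dens_ge0 z : 0 <= dens z.
Proof. by apply: sume_ge0 => p _; rewrite mule_ge0// lee_fin ?k0. Qed.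

Let mdens : measurable_fun setT dens.
Proof.
by apply: emeasurable_sum => p; apply: measurable_funeM; apply/measurable_EFinP/measurable_indic.
Qed.

Let glue (E : set (T1 * T2)) : \bar R := \int[P1 \x P2]_(z in E) dens z.

Let glueE E : measurable E -> glue E = \sum_p (k p)%:E * (P1 \x P2) (B p `&` E).
Proof.
move=> mE'; rewrite /glue ge0_integral_sum//.
- apply: eq_bigr => p _; rewrite ge0_integralZl_EFin//.
  + by rewrite integral_indic.
  + by apply: measurable_funTS; apply/measurable_EFinP/measurable_indic.
- move=> p; apply: measurable_funTS; apply: measurable_funeM.
  by apply/measurable_EFinP/measurable_indic.
- by move=> p z _; rewrite mule_ge0// lee_fin ?k0.
Qed.

Let glue_fst A : measurable A -> glue (A `*` setT) = P1 A.
Proof.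
move=> mA; rewrite glueE; last exact: measurableX.
rewrite -(sum_fibers P1 mi1 mA).
rewrite -(pair_bigA _ (fun s t => (k (s, t))%:E * (P1 \x P2) (B (s, t) `&` A `*` setT)))/=.
apply: eq_bigr => s _.
rewrite (eq_bigr (fun t => (k (s, t) * w t)%:E * P1 (A `&` i1 @^-1` [set s]))); last first.
  move=> t _; transitivity ((k (s, t))%:E * ((w t)%:E * P1 (A `&` i1 @^-1` [set s])));
    last by rewrite muleA.
  apply: (congr1 (fun v => (k (s, t))%:E * v)).
  rewrite (_ : _ `&` _ = (A `&` i1 @^-1` [set s]) `*` (i2 @^-1` [set t])); last first.
    by apply/seteqP; split=> z /=; [move=> [[? ?] [? _]]|move=> [[? ?] ?]].
  have /= -> := product_measure1E P1 P2 (measurableI _ _ mA (mi1 s)) (mi2 t).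
  by rewrite wE muleC.
rewrite -ge0_sume_distrl//; last by move=> t _; rewrite lee_fin mulr_ge0// ?k0 ?w0.
(* The cancellation of m s below needs a cell of positive mass; over a null cell both sides
   vanish. *)
have [ms0|ms0] := eqVneq (m s) 0%R.
  have -> : P1 (A `&` i1 @^-1` [set s]) = 0.
    apply/eqP; rewrite eq_le measure_ge0 andbT -[leRHS]/(0%:E) -ms0 -mE.
    by apply: le_measure; rewrite ?inE//; exact: measurableI.
  by rewrite mule0.
rewrite sumEFin (_ : \sum_t k (s, t) * w t = 1)%R ?mul1e//.
transitivity (\sum_t c s t / m s)%R; last by rewrite -mulr_suml sum_c_row divff.
apply: eq_bigr => t _; rewrite /k/=; have [wt0|wt0] := eqVneq (w t) 0%R.
  have -> : c s t = 0%R by apply/eqP; rewrite eq_le c0 andbT -wt0 c_le_w.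
  by rewrite !mul0r.
by rewrite invfM mulrA mulfVK.
Qed.

Let glue_snd A : measurable A -> glue (setT `*` A) = P2 A.
Proof.
move=> mA; rewrite glueE; last exact: measurableX.
rewrite -(sum_fibers P2 mi2 mA).
rewrite -(pair_bigA _ (fun s t => (k (s, t))%:E * (P1 \x P2) (B (s, t) `&` setT `*` A)))/=.
rewrite exchange_big/=; apply: eq_bigr => t _.
rewrite (eq_bigr (fun s => (k (s, t) * m s)%:E * P2 (A `&` i2 @^-1` [set t]))); last first.
  move=> s _; transitivity ((k (s, t))%:E * ((m s)%:E * P2 (A `&` i2 @^-1` [set t])));
    last by rewrite muleA.
  apply: (congr1 (fun v => (k (s, t))%:E * v)).
  rewrite (_ : _ `&` _ = (i1 @^-1` [set s]) `*` (A `&` i2 @^-1` [set t])); last first.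
    by apply/seteqP; split=> z /=; [move=> [[? ?] [_ ?]]|move=> [? [? ?]]].
  have /= -> := product_measure1E P1 P2 (mi1 s) (measurableI _ _ mA (mi2 t)).
  by rewrite mE.
rewrite -ge0_sume_distrl//; last by move=> s _; rewrite lee_fin mulr_ge0// ?k0 ?m0.
have [wt0|wt0] := eqVneq (w t) 0%R.
  have -> : P2 (A `&` i2 @^-1` [set t]) = 0.
    apply/eqP; rewrite eq_le measure_ge0 andbT -[leRHS]/(0%:E) -wt0 -wE.
    by apply: le_measure; rewrite ?inE//; exact: measurableI.
  by rewrite mule0.
rewrite sumEFin (_ : \sum_s k (s, t) * m s = 1)%R ?mul1e//.
transitivity (\sum_s c s t / w t)%R; last by rewrite -mulr_suml sum_c_col divff.
apply: eq_bigr => s _; rewrite /k/=; have [ms0|ms0] := eqVneq (m s) 0%R.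
  have -> : c s t = 0%R by apply/eqP; rewrite eq_le c0 andbT -ms0 c_le_m.
  by rewrite !mul0r.
move: ms0 wt0; move: (m s) (w t) (c s t) => x y z x0 y0; by field; rewrite x0 y0.
Qed.

Let glue0 : glue set0 = 0. Proof. by rewrite /glue integral_set0. Qed.

Let glue_ge0 E : 0 <= glue E. Proof. exact: integral_ge0. Qed.

Let glue_sigma_additive : semi_sigma_additive glue.
Proof.
move=> G mG tG mUG; rewrite /glue; apply: cvg_toP.
  apply: ereal_nondecreasing_is_cvgn => n n' nn'.
  by apply: lee_sum_nneg_natr => // j _ _; apply: integral_ge0.
by rewrite ge0_integral_bigcup//=; exact: measurable_funTS.
Qed.

HB.instance Definition _ := isMeasure.Build _ _ _ glue glue0 glue_ge0 glue_sigma_additive.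

Let glueT : glue setT = 1.
Proof. by rewrite -setXTT glue_fst// probability_setT. Qed.

HB.instance Definition _ := Measure_isProbability.Build _ _ _ glue glueT.

(** The row and column sums of the weights c are the cell masses, which gives the marginals. In row
    s the diagonal carries at least min(m s, w s), so at most (m s - w s)_+ is mismatched; summed,
    this is the total variation distance of the cell masses. *)
Lemma gluing : exists g : probability (T1 * T2)%type R,
  [/\ forall A, measurable A -> g (A `*` setT) = P1 A,
      forall A, measurable A -> g (setT `*` A) = P2 A &
      g [set z | i1 z.1 != i2 z.2] <=
        (\sum_s Num.max (fine (P1 (i1 @^-1` [set s])) - fine (P2 (i2 @^-1` [set s]))) 0)%:E].
Proof.
exists (glue : probability _ _); split; [exact: glue_fst|exact: glue_snd|].
have EE : [set z | i1 z.1 != i2 z.2] = \bigcup_(p in [set p | p.1 != p.2]) B p.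
  apply/seteqP; split=> z /=; first by move=> ne; exists (i1 z.1, i2 z.2).
  by move=> [p /= ne [/= -> ->]].
have mE' : measurable [set z | i1 z.1 != i2 z.2].
  by rewrite EE; apply: fin_bigcup_measurable => //; exact: finite_finset.
rewrite [X in X <= _](_ : _ = glue [set z | i1 z.1 != i2 z.2])// glueE//.
have mw0 p : (m p.1 * w p.2 == 0)%R -> c p.1 p.2 = 0%R.
  rewrite mulf_eq0 => /orP[] /eqP h; apply/eqP; rewrite eq_le c0 andbT -h.
    exact: c_le_m.
  exact: c_le_w.
have kp p : (k p)%:E * (P1 \x P2) (B p `&` [set z | i1 z.1 != i2 z.2]) =
    ((p.1 != p.2)%:R * c p.1 p.2)%:E.
  case: (boolP (p.1 != p.2)) => pp; last first.
    rewrite (_ : _ `&` _ = set0) ?measure0 ?mule0 ?mul0r//.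
    by apply/seteqP; split=> // z /= [[-> ->]]; exact/negP.
  rewrite (_ : _ `&` _ = B p); last first.
    by apply/seteqP; split=> [z []//|z /= [h1 h2]]; split=> //=; rewrite h1 h2.
  have /= -> := product_measure1E P1 P2 (mi1 p.1) (mi2 p.2).
  rewrite mE wE -!EFinM mul1r /k; congr (_%:E).
  have [/mw0 ->|h] := boolP (m p.1 * w p.2 == 0)%R; first by rewrite !mul0r.
  by rewrite divfK.
rewrite (eq_bigr _ (fun p _ => kp p)) sumEFin lee_fin.
rewrite -(pair_bigA _ (fun s t => ((s != t)%:R * c s t)%R))/=.
apply: ler_sum => s _; rewrite (bigD1 s)//= eqxx mul0r add0r.
rewrite (eq_bigr (fun t => c s t)); last by move=> t ts; rewrite eq_sym ts mul1r.
have := sum_c_row s; rewrite (bigD1 s)//= -/(a s) -(min_a s) => h.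
suff : (Num.min (m s) (w s) <= c s s)%R by lra.
rewrite /c eqxx mul1r lerDl divr_ge0 ?mulr_ge0// ?a0 ?b0//.
by rewrite sumr_ge0.
Qed.

End gluing.

(** * Binary coding of points by rational half-spaces *)

Section bits.
Variables (R : realType) (d : nat).
Implicit Types (x y : Rd R d) (i : 'I_d) (a b : rat).

(** Numbering the conditions a <= x_i makes the first n of them a partition into at most 2^n
    cells. *)
Definition code i a : nat := pickle (i, a).

Definition bit (k : nat) x : bool :=
  if unpickle k is Some (i, a) then ratr a <= (x : 'rV[R]_d) ord0 i else false.

Lemma bit_code i a x : bit (code i a) x = (ratr a <= (x : 'rV[R]_d) ord0 i).
Proof. by rewrite /bit /code pickleK. Qed.

Lemma measurable_bit k (c : bool) : measurable [set x | bit k x = c].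
Proof.
have mb : measurable [set x | bit k x].
  rewrite /bit; case: (unpickle k : option ('I_d * rat)) => [[i a]|]; last first.
    by rewrite (_ : [set _ | _] = set0); [exact: measurable0|apply/seteqP; split].
  have := @measurable_coord R d i measurableT `[ratr a, +oo[%classic (measurable_itv _).
  by rewrite setTI; congr measurable; apply/seteqP; split=> x /=; rewrite in_itv/= andbT.
case: c; first exact: mb.
rewrite (_ : [set _ | _] = ~` [set x | bit k x]); first exact: measurableC.
by apply/seteqP; split=> x /=; [move=> ->|move/negP/negbTE].
Qed.

(* [compat v y] holds for the bits [v] of any point whose coordinates are
   within the rational bounds that [v] encodes, up to the boundary *)
Definition compat (v : nat -> bool) y := forall i a b,
  v (code i a) -> ~~ v (code i b) -> ratr a <= (y : 'rV[R]_d) ord0 i <= ratr b.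

Lemma compat_bit x : compat (bit^~ x) x.
Proof. by move=> i a b; rewrite !bit_code -ltNge => -> /ltW ->. Qed.

Lemma bits_close (e M : R) : 0 < e -> 0 <= M -> exists n, forall x v y,
  eucl (x : 'rV[R]_d) <= M -> (forall k, (k < n)%N -> bit k x = v k) -> compat v y ->
  eucl (x - y : 'rV[R]_d) <= e.
Proof.
move=> e0 M0.
pose m := (Num.truncn (d%:R / e)).+1.
have m0 : (0 < m%:R :> R) by rewrite ltr0n.
pose L := (Num.truncn (M * m%:R)).+1.
have LM : M * m%:R <= L%:R by rewrite ltW// truncnS_gt.
pose q (j : nat) : rat := (j%:R - L%:R) / m%:R.
have qE j : ratr (q j) = (j%:R - L%:R) / m%:R :> R.
  by rewrite /q fmorph_div rmorphB /= !ratr_nat.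
(* All grid conditions must be among the first n. The grid index j runs up to 2L and j + 1 is used
   as well, hence 2L + 2 grid points. *)
exists (\max_(p : 'I_d * 'I_(2 * L).+2) code p.1 (q p.2)).+1 => x v y xM xv vy.
have close i : `|(x - y : 'rV[R]_d) ord0 i| <= m%:R^-1.
  have xi := le_trans (coord_le_eucl x i) xM.
  pose z := (x : 'rV[R]_d) ord0 i * m%:R + L%:R.
  have zL : `|(x : 'rV[R]_d) ord0 i * m%:R| <= L%:R.
    by rewrite normrM (ger0_norm (ltW m0)) (le_trans _ LM)// ler_wpM2r// ltW.
  have z0 : 0 <= z by move: zL; rewrite ler_norml /z => /andP[h _]; lra.
  have /andP[jz zj] := truncn_itv z0; set j := Num.truncn z in jz zj.
  have jL : (j <= 2 * L)%N.
    have : (j%:R <= (2 * L)%N%:R :> R); last by rewrite ler_nat.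
    by apply: (le_trans jz); move: zL; rewrite ler_norml /z natrM => /andP[_ h]; lra.
  have bound k : (k <= j.+1)%N ->
      bit (code i (q k)) x = v (code i (q k)).
    move=> kj; apply: xv; rewrite ltnS.
    have kL : (k < (2 * L).+2)%N by rewrite ltnS (leq_trans kj).
    exact: (@leq_bigmax _ (fun p : 'I_d * 'I_(2 * L).+2 => code p.1 (q p.2)) (i, Ordinal kL)).
  have b1 : bit (code i (q j)) x.
    by rewrite bit_code qE ler_pdivrMr// lerBlDr.
  have b2 : ~~ bit (code i (q j.+1)) x.
    by rewrite bit_code qE -ltNge ltr_pdivlMr// ltrBrDr.
  have /andP[y1 y2] : ratr (q j) <= (y : 'rV[R]_d) ord0 i <= ratr (q j.+1).
    by apply: vy; rewrite -bound.
  have /andP[x1 x2] := compat_bit b1 b2.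
  move: y1 y2 x1 x2; rewrite !qE !mxE -natr1.
  have -> : (j%:R + 1 - L%:R) / m%:R = (j%:R - L%:R) / m%:R + m%:R^-1 :> R.
    by rewrite addrAC mulrDl div1r.
  move: ((j%:R - L%:R) / m%:R : R) => a; move: (m%:R^-1 : R) => b y1 y2 x1 x2; rewrite ler_norml; apply/andP; split; lra.
apply: (le_trans (eucl_le_sum _)); apply: (@le_trans _ _ (\sum_(i < d) m%:R^-1)).
  by apply: ler_sum => i _; exact: close.
rewrite sumr_const card_ord -[_ *+ d]mulr_natl ler_pdivrMr// mulrC -ler_pdivrMr//.
by rewrite ltW// truncnS_gt.
Qed.

Definition prefix n x : n.-tuple bool := [tuple of mkseq (bit^~ x) n].

Lemma prefix_eq n x (s : n.-tuple bool) : prefix n x = s <-> forall j : 'I_n, bit j x = tnth s j.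
Proof.
split=> [<- j|H]; first by rewrite (tnth_nth false) /= nth_mkseq.
by apply: eq_from_tnth => j; rewrite -H (tnth_nth false) /= nth_mkseq.
Qed.

Lemma measurable_prefix n (s : n.-tuple bool) : measurable (prefix n @^-1` [set s]).
Proof.
rewrite (_ : _ @^-1` _ = \bigcap_(j in [set: 'I_n]) [set x | bit j x = tnth s j]).
  by apply: fin_bigcap_measurable => // j _; exact: measurable_bit.
apply/seteqP; split=> x /=; first by move=> /prefix_eq H j _; exact: H.
by move=> H; apply/prefix_eq => j; exact: H.
Qed.

Lemma prefix_bit n x y k : prefix n x = prefix n y -> (k < n)%N -> bit k x = bit k y.
Proof.
move=> /(congr1 val)/= E kn.
by rewrite -(nth_mkseq false (bit^~ x) kn) E nth_mkseq.
Qed.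

End bits.

(** * Couplings that are close in probability *)

Section near.
Variables (R : realType) (d : nat).
Local Open Scope ereal_scope.
Notation PM := (probability (Rd R d) R).
Notation RR := (Rd R d * Rd R d)%type.

Definition apart (e : R) : set RR := [set z | (e < dist z)%R].

Lemma measurable_apart e : measurable (apart e).
Proof.
have /measurable_EFinP/(measurable_gt_ereal e%:E) := @measurable_dist R d.
by under eq_set do rewrite lte_fin.
Qed.

(** A coupling with Ky Fan distance at most e. It follows from a small [dW], bounds [dP], and gives
    back a small [dW] when tail moments are small, so both metrics are treated through it. *)
Definition near (e : R) (mu nu : PM) := exists2 g, couplings mu nu g & g (apart e) <= e%:E.

Lemma couplings_push (dS : measure_display) (T : measurableType dS) (P : probability T R)
  (f1 f2 : T -> Rd R d) (mu nu : PM) :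
  measurable_fun setT f1 -> measurable_fun setT f2 ->
  (forall A, measurable A -> P (f1 @^-1` A) = mu A) ->
  (forall A, measurable A -> P (f2 @^-1` A) = nu A) ->
  exists g : probability RR R, [/\ couplings mu nu g,
    forall E, g E = P [set t | E (f1 t, f2 t)] &
    forall f : RR -> \bar R, measurable_fun setT f -> (forall z, 0 <= f z) ->
      \int[g]_z f z = \int[P]_t f (f1 t, f2 t)].
Proof.
move=> m1 m2 H1 H2.
have mf : measurable_fun setT (fun t => (f1 t, f2 t)) by exact: measurable_fun_pair.
exists (distribution P (mfun_Sub (mem_set mf))); split.
- move=> A mA; split.
    by rewrite -H1//; congr (P _); apply/seteqP; split=> t //= [].
  by rewrite -H2//; congr (P _); apply/seteqP; split=> t //= [].
- by move=> E.
- by move=> f mf' f0; exact: (ge0_integral_distribution _ mf' f0).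
Qed.

Lemma couplings_swap (mu nu : PM) g : couplings mu nu g ->
  exists h : probability RR R, [/\ couplings nu mu h,
    forall E, h E = g [set z | E (z.2, z.1)] & forall r, cost r h = cost r g].
Proof.
move=> cg; have [||A mA|A mA|h [ch hE hI]] := @couplings_push _ _ g snd fst nu mu.
- exact: measurable_snd.
- exact: measurable_fst.
- by have [_ <-] := cg _ mA; congr (g _); apply/seteqP; split=> t //= [].
- by have [<- _] := cg _ mA; congr (g _); apply/seteqP; split=> t //= [].
exists h; split=> // r; rewrite /cost (hI _ (measurable_dist_pow r)); last first.
  by move=> z; rewrite lee_fin powR_ge0.
by apply: eq_integral => z _; rewrite /dist/= eucl_subC.
Qed.

Lemma near_sym e (mu nu : PM) : near e mu nu -> near e nu mu.
Proof.
move=> [g cg ge]; have [h [ch hE _]] := couplings_swap cg; exists h => //.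
rewrite hE; apply: le_trans ge; rewrite le_eqVlt; apply/orP; left; apply/eqP.
by congr (g _); apply/seteqP; split=> z; rewrite /apart/= /dist/= eucl_subC.
Qed.

(** The coupling gives distance at most e whereas [eps_nbhd] asks for a strict inequality, hence the
    factor 2. *)
Lemma near_le (e : R) (mu nu : PM) (B : set (Rd R d)) : (0 < e)%R -> near e mu nu -> measurable B ->
  mu B <= nu (eps_nbhd B (2 * e)) + (2 * e)%:E.
Proof.
move=> e0 [g cg ge] mB; have mN := eps_nbhd_measurable B (2 * e)%R.
rewrite -(cg _ mB).1 -(cg _ mN).2.
apply: (@le_trans _ _ (g ((setT `*` eps_nbhd B (2 * e)) `|` apart e))).
  apply: le_measure; rewrite ?inE.
  - exact: measurableX.
  - by apply: measurableU; [exact: measurableX|exact: measurable_apart].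
  - move=> z /= [Bz _]; have [h|h] := leP (dist z) e; last by right.
    left; split=> //; exists z.1 => //; rewrite eucl_subC.
    by rewrite (le_lt_trans h)// ltr_pMl// ltr1n.
apply: (le_trans (measureU2 _ _ _)); first exact: measurableX.
  exact: measurable_apart.
by rewrite leeD2l// (le_trans ge)// lee_fin ler_peMl// ?ler1n// ltW.
Qed.

Lemma near_dP (e : R) (mu nu : PM) : (0 < e)%R -> near e mu nu -> dP mu nu <= (2 * e)%:E.
Proof.
move=> e0 H; apply: dP_le; first by rewrite mulr_gt0.
by move=> B mB; split; apply: near_le => //; exact: near_sym.
Qed.

(** Markov's inequality for the r-th power of the distance: a coupling of cost below e^r * e charges
    {distance > e} by less than e. *)
Lemma dW_near (r e : R) : (0 < r)%R -> (0 < e)%R -> exists2 c : R, (0 < c)%R &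
  forall mu nu : PM, dW r mu nu < c%:E -> near e mu nu.
Proof.
move=> r0 e0; have er : (0 < e `^ r)%R by rewrite powR_gt0.
exists ((e `^ r * e) `^ r^-1)%R; first by rewrite powR_gt0// mulr_gt0.
move=> mu nu /(dW_lt_cost r0 (powR_ge0 _ _))[g cg gc]; exists g => //.
rewrite powRVK ?gt_eqF ?mulr_ge0 ?(ltW er) ?(ltW e0)// in gc.
rewrite -(@lee_pmul2l _ (e `^ r)%:E)// -EFinM; apply: le_trans (ltW gc).
apply: le_cst_measure.
- exact: measurable_dist_pow.
- by move=> z; rewrite lee_fin powR_ge0.
- exact: measurable_apart.
- exact: ltW.
- by move=> z ez; rewrite lee_fin ler_powR_ge0 ?dist_ge0// ltW.
Qed.

Lemma dW_sym (r : R) (mu nu : PM) (c : R) : (0 < r)%R -> (0 < c)%R ->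
  dW r mu nu < c%:E -> dW r nu mu <= c%:E.
Proof.
move=> r0 c0 /(dW_lt_cost r0 (ltW c0))[g cg gc].
rewrite -(powRK (s := r) (x := c)) ?gt_eqF ?(ltW c0)//.
have [h [ch _ hc]] := couplings_swap cg.
by apply: (dW_le_cost r0 ch); rewrite hc ltW.
Qed.

(* The couplings are glued along the cells of their middle coordinates, which
   puts these coordinates within e of each other outside a set of mass e. *)
Lemma near_trans (e : R) (lam kap mu : PM) : (0 < e)%R ->
  near e lam kap -> near e kap mu -> near (3 * e) lam mu.
Proof.
move=> e0 [g1 cg1 ge1] [g2 cg2 ge2].
have [M HM] := tight_single kap e0.
have [n Hn] := @bits_close R d e M%:R e0 (ler0n _ M).
pose i1 (z : RR) := prefix n z.2.
pose i2 (z : RR) := prefix n z.1.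
have m1 s : measurable (i1 @^-1` [set s]).
  rewrite (_ : _ @^-1` _ = setT `*` (prefix n @^-1` [set s])).
    by apply: measurableX => //; exact: measurable_prefix.
  by apply/seteqP; split=> z //= [].
have m2 s : measurable (i2 @^-1` [set s]).
  rewrite (_ : _ @^-1` _ = (prefix n @^-1` [set s]) `*` setT).
    by apply: measurableX => //; exact: measurable_prefix.
  by apply/seteqP; split=> z //= [].
have E1 s : g1 (i1 @^-1` [set s]) = kap (prefix n @^-1` [set s]).
  rewrite -(cg1 _ (measurable_prefix s)).2; congr (g1 _).
  by apply/seteqP; split=> z //= [].
have E2 s : g2 (i2 @^-1` [set s]) = kap (prefix n @^-1` [set s]).
  rewrite -(cg2 _ (measurable_prefix s)).1; congr (g2 _).
  by apply/seteqP; split=> z //= [].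
have [G [GA GB Gne]] := gluing g1 g2 m1 m2.
(* Both couplings have [kap] as middle marginal, so the cell masses agree and no mass is
   mismatched. *)
rewrite big1 in Gne; last by move=> s _; rewrite E1 E2 subrr maxxx.
have m11 : measurable_fun setT (fun t : RR * RR => t.1.1).
  exact: (measurableT_comp measurable_fst measurable_fst).
have m22 : measurable_fun setT (fun t : RR * RR => t.2.2).
  exact: (measurableT_comp measurable_snd measurable_snd).
have [A mA|A mA|h [ch hE _]] := @couplings_push _ _ G _ _ lam mu m11 m22.
- rewrite -(cg1 _ mA).1 -GA; last exact: measurableX.
  by congr (G _); apply/seteqP; split=> t //= [[]].
- rewrite -(cg2 _ mA).2 -GB; last exact: measurableX.
  by congr (G _); apply/seteqP; split=> t //= [_ []].
exists h => //; rewrite hE.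
pose far := [set x : Rd R d | (M%:R < eucl (x : 'rV[R]_d))%R].
have mfar : measurable far by exact: measurable_gt_eucl.
pose D1 : set (RR * RR) := apart e `*` setT.
pose D2 : set (RR * RR) := setT `*` apart e.
pose D3 : set (RR * RR) := (setT `*` far) `*` setT.
pose D4 : set (RR * RR) := [set t | i1 t.1 != i2 t.2].
have mD1 : measurable D1 by apply: measurableX => //; exact: measurable_apart.
have mD2 : measurable D2 by apply: measurableX => //; exact: measurable_apart.
have mD3 : measurable D3 by apply: measurableX => //; exact: measurableX.
have mD4 : measurable D4.
  rewrite (_ : D4 = \bigcup_(p in [set p | p.1 != p.2]) ((i1 @^-1` [set p.1]) `*` (i2 @^-1` [set p.2]))).
    apply: fin_bigcup_measurable => [|p _]; first exact: finite_finset.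
    exact: measurableX.
  apply/seteqP; split=> t /=; first by move=> ne; exists (i1 t.1, i2 t.2).
  by move=> [p /= ne [/= E E']]; rewrite /D4/= E E'.
apply: (@le_trans _ _ (G (((D1 `|` D2) `|` D3) `|` D4))).
  apply: le_measure; rewrite ?inE.
  - rewrite (_ : [set t | _] = (fun t : RR * RR => (t.1.1, t.2.2)) @^-1` apart (3 * e))//.
    have m12 : measurable_fun setT (fun t : RR * RR => (t.1.1, t.2.2)).
      exact: measurable_fun_pair.
    by have := m12 measurableT _ (measurable_apart (3 * e)); rewrite setTI.
  - by apply: measurableU => //; apply: measurableU => //; exact: measurableU.
  - move=> t; rewrite /apart/= => t3; apply: contrapT.
    move=> /not_orP[/not_orP[/not_orP[n1 n2] n3] n4].
    have d1 : (dist t.1 <= e)%R by rewrite leNgt; apply/negP => h1; apply: n1.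
    have d2 : (dist t.2 <= e)%R by rewrite leNgt; apply/negP => h1; apply: n2.
    have d3 : (eucl (t.1.2 : 'rV[R]_d) <= M%:R)%R.
      by rewrite leNgt; apply/negP => h1; apply: n3.
    have d4 : prefix n t.1.2 = prefix n t.2.1 by apply/eqP/negPn/negP => h1; apply: n4.
    have d5 := Hn _ _ _ d3 (fun k kn => prefix_bit d4 kn) (@compat_bit R d _).
    move: t3; rewrite ltNge => /negP; apply; rewrite /dist/=.
    have -> : ((t.1.1 : 'rV[R]_d) - t.2.2 = (t.1.1 - t.1.2) + ((t.1.2 - t.2.1) + (t.2.1 - t.2.2)))%R.
      by rewrite !addrA !subrK.
    rewrite (le_trans (ler_euclD _ _))//.
    have := @ler_euclD R d (t.1.2 - t.2.1)%R (t.2.1 - t.2.2)%R.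
    by move: d1 d2 d5; rewrite /dist; move: (eucl _) (eucl _) (eucl _) (eucl _) => *; lra.
(* Failure of either coupling and a far middle point cost e each; mismatched middle cells cost
   nothing. *)
have -> : (3 * e)%:E = e%:E + e%:E + e%:E + 0 by rewrite adde0 -!EFinD; congr (_%:E); lra.
have GD1 : G D1 <= e%:E by rewrite GA//; exact: measurable_apart.
have GD2 : G D2 <= e%:E by rewrite GB//; exact: measurable_apart.
have GD3 : G D3 <= e%:E.
  by rewrite GA; [rewrite (cg1 _ mfar).2|exact: measurableX].
apply: (le_trans (measureU2 _ _ mD4)); first by do 2 apply: measurableU => //.
apply: leeD => //; apply: (le_trans (measureU2 _ _ mD3)); first exact: measurableU.
apply: leeD => //; apply: (le_trans (measureU2 _ mD1 mD2)).
exact: leeD.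
Qed.

End near.

Section near_wasserstein.
Variables (R : realType) (d : nat) (r : R).
Hypothesis r1 : 1 <= r.
Local Open Scope ereal_scope.
Notation PM := (probability (Rd R d) R).
Notation RR := (Rd R d * Rd R d)%type.

Let r0 : (0 < r)%R := lt_le_trans ltr01 r1.

Lemma eucl_le_overshoot n (x : Rd R d) : (eucl (x : 'rV[R]_d) <= n%:R + overshoot n x)%R.
Proof. by rewrite -lerBlDl le_max lexx. Qed.

(** The distance is at most e + 2n 1{apart} plus the overshoots of both points: where the points are
    apart, it is bounded by the sum of the norms. Three uses of [integral_powR_add] separate these
    terms. *)
Lemma near_cost (e : R) (n : nat) (mu nu : PM) g : (0 < e)%R -> couplings mu nu g ->
  g (apart e) <= e%:E ->
  cost r g <= (2 `^ r)%:E * ((2 `^ r)%:E * ((e `^ r)%:E + ((2 * n%:R) `^ r * e)%:E) +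
     (2 `^ r)%:E * (tail_moment r n mu + tail_moment r n nu)).
Proof.
move=> e0 cg ge.
have c2 : (0 <= 2 * n%:R :> R)%R by rewrite mulr_ge0.
pose jump (z : RR) : R := (2 * n%:R * \1_(apart e) z)%R.
have mA : measurable_fun setT jump.
  by apply: measurable_funM => //; apply: measurable_indic; exact: measurable_apart.
have o1 : measurable_fun setT (fun z : RR => overshoot n z.1).
  exact: (measurableT_comp (measurable_overshoot n) measurable_fst).
have o2 : measurable_fun setT (fun z : RR => overshoot n z.2).
  exact: (measurableT_comp (measurable_overshoot n) measurable_snd).
have ge0A z : (0 <= jump z)%R by rewrite mulr_ge0// indicE.
have T1 : tail_moment r n mu = \int[g]_z (overshoot n z.1 `^ r)%:E.
  symmetry; apply: (coupling_fst cg (measurable_overshoot_pow r n)) => x.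
  by rewrite lee_fin powR_ge0.
have T2 : tail_moment r n nu = \int[g]_z (overshoot n z.2 `^ r)%:E.
  symmetry; apply: (coupling_snd cg (measurable_overshoot_pow r n)) => x.
  by rewrite lee_fin powR_ge0.
have I1 : \int[g]_z (e `^ r)%:E = (e `^ r)%:E.
  transitivity ((e `^ r)%:E * g setT); last by rewrite probability_setT mule1.
  exact: integral_cst.
have I2 : \int[g]_z (jump z `^ r)%:E <= ((2 * n%:R) `^ r * e)%:E.
  rewrite (eq_integral (fun z => ((2 * n%:R) `^ r)%:E * (\1_(apart e) z)%:E)).
    rewrite ge0_integralZl_EFin ?powR_ge0//; last first.
      by apply/measurable_EFinP/measurable_indic; exact: measurable_apart.
    rewrite (integral_indic g measurableT (measurable_apart e)) setIT EFinM.
    by rewrite lee_wpmul2l// lee_fin powR_ge0.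
  move=> z _; rewrite -EFinM; congr (_%:E); rewrite /jump indicE; case: (_ \in _).
    by rewrite !mulr1.
  by rewrite !mulr0 powR0// gt_eqF.
have H1 := @integral_powR_add R _ _ g (cst e) jump
  (fun z => (e + jump z)%R) r r0 (measurable_cst _) mA
  (measurable_funD (measurable_cst _) mA) (fun _ => ltW e0) ge0A.
have H2 := @integral_powR_add R _ _ g (fun z => overshoot n z.1) (fun z => overshoot n z.2)
  (fun z => (overshoot n z.1 + overshoot n z.2)%R) r r0 o1 o2 (measurable_funD o1 o2)
  (fun _ => overshoot_ge0 _ _) (fun _ => overshoot_ge0 _ _).
have H3 := @integral_powR_add R _ _ g (fun z => (e + jump z)%R)
  (fun z => (overshoot n z.1 + overshoot n z.2)%R) (@dist R d) r r0
  (measurable_funD (measurable_cst _) mA) (measurable_funD o1 o2) (@measurable_dist R d).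
apply: (le_trans (H3 _ _ _)).
- by move=> z; rewrite addr_ge0// ltW.
- by move=> z; rewrite addr_ge0// overshoot_ge0.
- move=> z; rewrite dist_ge0/= /jump indicE; case: (boolP (z \in apart e)) => h.
    rewrite mulr1; have := ler_euclD (z.1 : 'rV[R]_d) (- z.2)%R; rewrite euclN -/(dist z).
    have := eucl_le_overshoot n z.1; have := eucl_le_overshoot n z.2.
    move: e0; move: (eucl _) (eucl _) (dist z) (overshoot n z.1) (overshoot n z.2) => *; lra.
  move: h; rewrite notin_setE /apart/= => /negP; rewrite -leNgt => h.
  by rewrite mulr0 addr0 (le_trans h)// lerDl addr_ge0 ?overshoot_ge0.
rewrite lee_wpmul2l ?lee_fin ?powR_ge0//; apply: leeD.
  apply: (le_trans (H1 _)).
    by move=> z; rewrite lexx andbT addr_ge0// ltW.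
  rewrite lee_wpmul2l ?lee_fin ?powR_ge0//; apply: leeD => //.
  by rewrite -[leRHS]I1.
rewrite T1 T2; apply: H2 => z.
by rewrite lexx andbT addr_ge0// overshoot_ge0.
Qed.

(** The order of the quantifiers matters: [tau] depends on c alone, the level n is then dictated by
    the tails, and e is chosen last to beat (2n)^r. *)
Lemma near_dW (c : R) : (0 < c)%R -> exists2 tau : R, (0 < tau)%R & forall n : nat,
  exists2 e : R, (0 < e)%R & forall mu nu : PM, near e mu nu ->
    tail_moment r n mu <= tau%:E -> tail_moment r n nu <= tau%:E -> dW r mu nu < c%:E.
Proof.
move=> c0; pose b : R := ((c / 2) `^ r)%R.
have b0 : (0 < b)%R by rewrite powR_gt0// divr_gt0.
pose K : R := (2 `^ r * 2 `^ r)%R; have K0 : (0 < K)%R by rewrite mulr_gt0// powR_gt0.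
(* The two tail moments together contribute K * 2 tau = b / 2, half of the target b = (c / 2)^r. *)
exists (b / (4 * K))%R; first by rewrite divr_gt0// mulr_gt0.
move=> n; pose L : R := (1 + (2 * n%:R) `^ r)%R.
have L0 : (0 < L)%R by rewrite ltr_pwDl// powR_ge0.
(* For e <= 1 and r >= 1, e^r <= e, so the remaining terms are at most K * L * e <= b / 2. *)
exists (Num.min 1 (b / (2 * K * L)))%R; first by rewrite lt_min ltr01 divr_gt0// !mulr_gt0.
set e : R := Num.min 1%R _ => mu nu [g cg ge] tmu tnu.
have e0 : (0 < e)%R by rewrite lt_min ltr01 divr_gt0// !mulr_gt0.
have e1 : (e <= 1)%R by rewrite ge_min lexx.
have er : (e `^ r <= e)%R.
  by rewrite -[leRHS](powRr1 (ltW e0)) ger_powR// e0.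
have eL : (e * (2 * K * L) <= b)%R.
  by rewrite -ler_pdivlMr ?mulr_gt0// ge_min lexx orbT.
apply: (@le_lt_trans _ _ (b `^ r^-1)%:E); last first.
  by rewrite powRK ?gt_eqF ?divr_ge0 ?(ltW c0)// lte_fin ltr_pdivrMr// ltr_pMr// ltr1n.
apply: (dW_le_cost r0 cg); apply: (le_trans (near_cost n e0 cg ge)).
apply: (@le_trans _ _ ((2 `^ r)%:E * ((2 `^ r)%:E * (e%:E + ((2 * n%:R) `^ r * e)%:E) +
     (2 `^ r)%:E * ((b / (4 * K))%:E + (b / (4 * K))%:E)))).
  rewrite lee_wpmul2l ?lee_fin ?powR_ge0//; apply: leeD; rewrite lee_wpmul2l ?lee_fin ?powR_ge0//.
    by rewrite -?EFinD ?lee_fin lerD2r.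
  exact: leeD.
rewrite -!(EFinD, EFinM) lee_fin.
have -> : (2 `^ r * (2 `^ r * (e + (2 * n%:R) `^ r * e) + 2 `^ r * (b / (4 * K) + b / (4 * K))) =
   e * (2 * K * L) / 2 + b / 2 :> R)%R.
  rewrite /L; have K00 : (K != 0)%R by rewrite gt_eqF.
  transitivity (K * (e + (2 * n%:R) `^ r * e + (b / (4 * K) + b / (4 * K))))%R.
    by rewrite /K; ring.
  by field.
lra.
Qed.

(** On {|x| > n + 1} the overshoot over n is at least 1. *)
Lemma uexcess_tight (A : set PM) : uexcess r A -> utight A.
Proof.
move=> H e e0; have [n Hn] := H e e0; exists n.+1 => mu Amu.
apply: le_trans (Hn mu Amu); rewrite -[leLHS]mul1e.
apply: le_cst_measure => //.
- exact: measurable_overshoot_pow.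
- by move=> x; rewrite lee_fin powR_ge0.
- exact: measurable_gt_eucl.
- move=> x /= nx; rewrite lee_fin [leLHS](_ : 1 = 1 `^ r)%R; last by rewrite powR1.
  rewrite ler_powR_ge0 ?overshoot_ge0// le_max; apply/orP; left.
  by rewrite lerBrDr addrC natr1 ltW.
Qed.

Lemma tail_moment_Mr n (mu : PM) : tail_moment r n mu < +oo -> Mr r mu.
Proof.
move=> H; have := @integral_powR_add R _ _ mu (cst n%:R) (@overshoot R d n)
   (fun x : Rd R d => eucl (x : 'rV[R]_d)) r r0 (measurable_cst _) (measurable_overshoot n)
   (@measurable_eucl_id R d) (fun _ => ler0n _ n) (@overshoot_ge0 R d n).
have mn x : (0 <= eucl (x : 'rV[R]_d) <= cst n%:R x + overshoot n x)%R.
  by rewrite eucl_ge0 eucl_le_overshoot.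
move=> /(_ mn) /le_lt_trans; apply; rewrite lte_mul_pinfty ?lee_fin ?powR_ge0//.
have I1 : \int[mu]_x ((cst n%:R x : R) `^ r)%:E = (n%:R `^ r)%:E.
  transitivity ((n%:R `^ r)%:E * mu setT); last by rewrite probability_setT mule1.
  by rewrite -(integral_cst mu measurableT).
by apply: lte_add_pinfty; [rewrite I1 ltry|exact: H].
Qed.

End near_wasserstein.

Section ultra_limit.
Variables (R : realType) (T : Type) (FF : set_system T).
Context {uFF : UltraFilter FF}.

(** The limit is the supremum of the levels c with f >= c on a set of the ultrafilter; above the
    supremum the ultrafilter must contain the complement. *)
Lemma ultra_cvg01 (f : T -> R) : (forall t, 0 <= f t <= 1) ->
  exists a : R, forall e : R, 0 < e -> FF [set t | `|f t - a| < e].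
Proof.
move=> f01; have PF : ProperFilter FF := @ultra_proper _ _ uFF.
pose S := [set c : R | FF [set t | c <= f t]].
have S0 : S 0 by apply: filterS filterT => t _ /=; have /andP[] := f01 t.
have S1 : ubound S 1.
  move=> c Sc; rewrite leNgt; apply/negP => c1; apply: (@filter_not_empty _ FF PF).
  apply: filterS Sc => t /= ct; have /andP[_ f1] := f01 t.
  by have := lt_le_trans c1 (le_trans ct f1); rewrite ltxx.
have hS : has_sup S by split; [exists 0|exists 1].
exists (sup S) => e e0; have [c Sc cS] := sup_adherent e0 hS.
have Sup : FF [set t | f t < sup S + e].
  have [h|h] := in_ultra_setVsetC [set t | sup S + e <= f t] uFF.
    have /(ub_le_sup _) : S (sup S + e) by [].
    move=> /(_ (ex_intro _ _ S1)); by rewrite gerDl leNgt e0.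
  by apply: filterS h => t /= /negP; rewrite -ltNge.
apply: filterS (filterI Sc Sup) => t /= [h1 h2]; rewrite ltr_norml.
by apply/andP; split; lra.
Qed.

End ultra_limit.

(** * Realizing a weighted binary tree on the unit interval *)

Section tree.
Variables (R : realType) (w : seq bool -> R).
Hypothesis w_ge0 : forall s, 0 <= w s.
Hypothesis w_nil : w [::] = 1.
Hypothesis w_split : forall s, w s = w (rcons s false) + w (rcons s true).

Let U : probability (measurableTypeR R) R := uniform_prob (@ltr01 R).

(** Total weight of the cells of the same level that precede s lexicographically: each true bit
    skips its false sibling. *)
Definition left_end (s : seq bool) : R :=
  \sum_(j < size s) (nth false s j)%:R * w (rcons (take j s) false).

Lemma left_end_rcons s c : left_end (rcons s c) = left_end s + c%:R * w (rcons s false).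
Proof.
rewrite /left_end size_rcons big_ord_recr/= nth_rcons ltnn eqxx; congr (_ + _).
  apply: eq_bigr => j _; rewrite nth_rcons ltn_ord.
  by rewrite (_ : take j (rcons s c) = take j s)// -cats1 takel_cat// ltnW.
by rewrite (_ : take (size s) (rcons s c) = s)// -cats1 takel_cat// take_size.
Qed.

(* Each cell s occupies an interval of length w s starting at left_end s, and
   str n u is the cell of level n whose interval contains u. *)
Fixpoint str (n : nat) (u : R) : seq bool :=
  if n is m.+1 then rcons (str m u) (left_end (str m u) + w (rcons (str m u) false) <= u)
  else [::].

Lemma size_str n u : size (str n u) = n.
Proof. by elim: n => //= n IH; rewrite size_rcons IH. Qed.

Lemma str_bounds n u : 0 <= u < 1 ->
  left_end (str n u) <= u < left_end (str n u) + w (str n u).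
Proof.
move=> u01; elim: n => [|n /andP[IH1 IH2]] /=; first by rewrite /left_end big_ord0 w_nil add0r.
rewrite left_end_rcons; case: (leP (left_end (str n u) + w (rcons (str n u) false)) u) => h.
  by rewrite mul1r h/= -addrA -w_split.
by rewrite mul0r addr0 IH1.
Qed.

Lemma left_end_bounds s : 0 <= left_end s /\ left_end s + w s <= 1.
Proof.
elim/last_ind: s => [|s c [IH1 IH2]]; first by rewrite /left_end big_ord0 w_nil add0r.
rewrite left_end_rcons; split; first by rewrite addr_ge0// mulr_ge0.
apply: le_trans IH2; rewrite -addrA lerD2l (w_split s).
have := w_ge0 (rcons s true); have := w_ge0 (rcons s false).
by case: c => /=; rewrite ?mul1r ?mul0r//; lra.
Qed.

Lemma str_eq s u : left_end s <= u < left_end s + w s -> str (size s) u = s.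
Proof.
elim/last_ind: s => //= s c IH; rewrite size_rcons/= left_end_rcons => /andP[h1 h2].
have E : str (size s) u = s.
  apply: IH; move: h1 h2; have := w_split s; have := w_ge0 (rcons s true); have := w_ge0 (rcons s false).
  by case: c => /=; rewrite ?mul1r ?mul0r => *; apply/andP; split; lra.
rewrite E; congr (rcons _ _); move: h1 h2; case: c => /=; rewrite ?mul1r ?mul0r ?addr0.
  by move=> ->.
by move=> _; rewrite ltNge => /negbTE.
Qed.

Lemma measurable_str n s : measurable ([set u | str n u = s] : set (measurableTypeR R)).
Proof.
elim: n s => [|n IH] s /=.
  have [->|ns] := eqVneq s [::]; first by rewrite (_ : [set _ | _] = setT)//; apply/seteqP; split.
  rewrite (_ : [set _ | _] = set0)//; apply/seteqP; split=> // u /= E.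
  by rewrite -E eqxx in ns.
case/lastP: s => [|s c].
  rewrite (_ : [set _ | _] = set0)//; apply/seteqP; split=> // u /= /(congr1 size).
  by rewrite size_rcons.
pose H : set (measurableTypeR R) := `[left_end s + w (rcons s false), +oo[%classic.
have mH : measurable H by exact: measurable_itv.
rewrite (_ : [set _ | _] = [set u | str n u = s] `&` (if c then H else ~` H)).
  by apply: measurableI; [exact: IH|case: c => //; exact: measurableC].
apply/seteqP; split=> u /=.
  move=> /rcons_inj[E1 E2]; split => //; rewrite -E2 /H.
  by case E : (_ <= u); rewrite /= in_itv/= andbT -E1 E.
move=> [E1]; rewrite E1 /H; case: c => /=; rewrite in_itv/= andbT; first by move=> ->.
by move=> /negP/negbTE ->.
Qed.

(** Inside [0, 1) the event is exactly the interval of s; outside, [str] still takes values, but the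
    uniform law does not charge them. *)
Lemma uniform_str s : U [set u | str (size s) u = s] = (w s)%:E.
Proof.
have [l0 l1] := left_end_bounds s.
have U01 : U `[0%R, 1%R[%classic = 1%E by rewrite uniform01_itv// subr0.
have UC : U (~` `[0%R, 1%R[%classic) = 0%E by rewrite probability_setC// U01 subee.
have mS := measurable_str (size s) s.
have <- : U `[left_end s, left_end s + w s[%classic = (w s)%:E.
  by rewrite uniform01_itv// ?lerDl// addrC addKr.
apply/eqP; rewrite eq_le; apply/andP; split; last first.
  apply: le_measure; rewrite ?inE//.
  by move=> u /=; rewrite in_itv/= => /str_eq.
apply: (@le_trans _ _ (U (`[left_end s, left_end s + w s[%classic `|` ~` `[0%R, 1%R[%classic))).
  apply: le_measure; rewrite ?inE//.
    by apply: measurableU => //; exact: measurableC.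
  move=> u /= us; have [u01|u01] := boolP (0 <= u < 1); last by right; rewrite /= in_itv; exact/negP.
  by left; have := str_bounds (size s) u01; rewrite us /= in_itv.
apply: (le_trans (measureU2 _ _ _)) => //; first exact: measurableC.
have UC0 : (U (~` `[0%R, 1%R[%classic) <= 0)%E by rewrite UC.
by rewrite -[leRHS]adde0; apply: leeD.
Qed.

Definition ubit (k : nat) (u : R) : bool := nth false (str k.+1 u) k.

Lemma str_mkseq n u : str n u = mkseq (ubit^~ u) n.
Proof.
elim: n => //= n IH; rewrite mkseqS -IH; congr (rcons _ _).
by rewrite /ubit/= nth_rcons size_str ltnn eqxx.
Qed.

Lemma measurable_ubit k : measurable ([set u | ubit k u] : set (measurableTypeR R)).
Proof.
rewrite (_ : [set u | ubit k u] = \bigcup_(s in [set s : k.+1.-tuple bool | nth false s k])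
    [set u | str k.+1 u = s]).
  apply: fin_bigcup_measurable => [|s _]; first exact: finite_finset.
  exact: measurable_str.
apply/seteqP; split=> u.
  move=> ku; have hs : size (str k.+1 u) == k.+1 by rewrite size_str.
  by exists (Tuple hs).
by move=> [s sk us]; change (is_true (ubit k u)); rewrite /ubit (us : str k.+1 u = s).
Qed.

End tree.

Section limit.
Variables (R : realType) (d : nat).
Notation PM := (probability (Rd R d) R).
Variable FF : set_system PM.
Context {uFF : UltraFilter FF}.
Hypothesis FF_tight : forall e : R, 0 < e -> exists n : nat,
  FF [set kap : PM | (kap [set x | (n%:R < eucl (x : 'rV[R]_d))%R] <= e%:E)%E].

Let PF : ProperFilter FF := @ultra_proper _ _ uFF.

Let mass_exists (E : set (Rd R d)) : measurable E ->
  exists a : R, forall e : R, 0 < e -> FF [set kap : PM | `|fine (kap E) - a| < e].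
Proof.
move=> mE; apply: ultra_cvg01 => kap; rewrite fine_ge0//=.
by rewrite -lee_fin fineK ?probability_le1// fin_num_measure.
Qed.

Definition cell (s : seq bool) : set (Rd R d) :=
  [set x | forall j, (j < size s)%N -> bit j x = nth false s j].

Lemma cellE n (s : n.-tuple bool) : prefix n @^-1` [set s] = cell s.
Proof.
apply/seteqP; split=> x /=.
  move=> /prefix_eq H j; rewrite size_tuple => jn; have := H (Ordinal jn).
  by rewrite (tnth_nth false).
move=> H; apply/prefix_eq => j; rewrite (tnth_nth false); apply: H.
by rewrite size_tuple.
Qed.

Lemma measurable_cell s : measurable (cell s).
Proof. by have := @measurable_prefix R d _ (in_tuple s); rewrite cellE. Qed.

Let wP s : {a : R | forall e : R, 0 < e -> FF [set kap : PM | `|fine (kap (cell s)) - a| < e]}.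
Proof. exact: cid (mass_exists (measurable_cell s)). Qed.

Let w s : R := sval (wP s).

Let w_lim s e : 0 < e -> FF [set kap : PM | `|fine (kap (cell s)) - w s| < e].
Proof. exact: (svalP (wP s)). Qed.

Let kap_fin (kap : PM) s : kap (cell s) = (fine (kap (cell s)))%:E.
Proof. by rewrite fineK// fin_num_measure//; exact: measurable_cell. Qed.

Let small_eq (a b : R) : (forall e, 0 < e -> `|a - b| <= e) -> a = b.
Proof.
move=> H; apply/eqP; rewrite -subr_eq0 -normr_eq0 eq_le normr_ge0 andbT.
by apply/ler_addgt0Pr => e e0; rewrite add0r; exact: H.
Qed.

Let w_ge0 s : 0 <= w s.
Proof.
rewrite leNgt; apply/negP => w0; have w0' : 0 < - w s by rewrite oppr_gt0.
have [kap /=] := filter_ex (w_lim s w0').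
have : 0 <= fine (kap (cell s)) by exact: fine_ge0.
by rewrite ltr_norml => h /andP[_]; lra.
Qed.

Let w_nil : w [::] = 1.
Proof.
apply: small_eq => e e0; have [kap /= h] := filter_ex (w_lim [::] e0).
move: h; have -> : cell [::] = setT by apply/seteqP; split.
by rewrite probability_setT/= distrC => /ltW.
Qed.

Let cell_split s : cell s = cell (rcons s false) `|` cell (rcons s true).
Proof.
apply/seteqP; split=> x /=.
  move=> H; case E : (bit (size s) x); [right|left] => j; rewrite size_rcons ltnS nth_rcons => js;
    (have [jlt|jge] := ltnP j (size s); first exact: H);
    have -> : j = size s by apply/eqP; rewrite eqn_leq js jge.
    by rewrite eqxx.
  by rewrite eqxx.
by move=> [] H j js; have := H j; rewrite size_rcons nth_rcons js; apply; rewrite ltnS ltnW.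
Qed.

Let w_split s : w s = w (rcons s false) + w (rcons s true).
Proof.
apply: small_eq => e e0; have e4 : 0 < e / 4 by rewrite divr_gt0.
have [kap /= [[h h0] h1]] := filter_ex (filterI (filterI (w_lim s e4) (w_lim (rcons s false) e4))
  (w_lim (rcons s true) e4)).
have K : fine (kap (cell s)) = fine (kap (cell (rcons s false))) + fine (kap (cell (rcons s true))).
  apply: EFin_inj; rewrite EFinD -!kap_fin cell_split measureU//; try exact: measurable_cell.
  apply/seteqP; split=> // x /= [/(_ (size s)) H0 /(_ (size s)) H1].
  move: H0 H1; rewrite !size_rcons !nth_rcons ltnn eqxx ltnSn => H0 H1.
  by have := H0 isT; rewrite H1.
rewrite K in h; move: h h0 h1; rewrite !ltr_norml ler_norml => /andP[? ?] /andP[? ?] /andP[? ?].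
by apply/andP; split; lra.
Qed.

(** An empty cell has mass 0 under every law, at distance w s from the limiting mass. This ties the
    bits of the tree to genuine points. *)
Let w_cell s : 0 < w s -> exists x, cell s x.
Proof.
move=> ws; apply: contrapT => /forallNP H.
have [kap /=] := filter_ex (w_lim s ws).
have -> : cell s = set0 by apply/seteqP; split=> // x /H.
by rewrite measure0/= sub0r normrN gtr0_norm// ltxx.
Qed.

Let U : probability (measurableTypeR R) R := uniform_prob (@ltr01 R).

(* Coordinate i of the limit point is the supremum of the rationals a such that
   the bit of the condition a <= x_i is set. *)
Let coordk (i : 'I_d) (k : nat) (u : measurableTypeR R) : \bar R :=
  if unpickle k is Some a then if ubit w (code i a) u then (ratr a)%:E else -oo%E else -oo%E.

Let measurable_coordk i k : measurable_fun setT (coordk i k).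
Proof.
rewrite /coordk; case: (unpickle k : option rat) => [a|]; last exact: measurable_cst.
apply: measurable_fun_ifT; [|exact: measurable_cst|exact: measurable_cst].
by apply: (measurable_fun_bool true); rewrite setTI; exact: measurable_ubit.
Qed.

Let Xlim (u : measurableTypeR R) : Rd R d := \row_i fine (esups (coordk i ^~ u) 0%N).

Let measurable_Xlim : measurable_fun setT Xlim.
Proof.
apply: measurable_Rd => i; under eq_fun do rewrite mxE.
apply: measurableT_comp; first exact: fine_measurable.
by apply: measurable_fun_esups => k; exact: measurable_coordk.
Qed.

(** The level-N cell of u has positive weight since its interval contains u, so a genuine point y
    shares the first N bits. Hence a rational with true bit never exceeds one with false bit, and
    the supremum is finite and between them. *)
Let compat_Xlim u : 0 <= u < 1 -> compat (ubit w ^~ u) (Xlim u).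
Proof.
move=> u01 i a b ua ub; rewrite mxE.
have Hle (a' : rat) : ubit w (code i a') u -> ratr a' <= ratr b :> R.
  move=> ua'; pose N := (maxn (code i a') (code i b)).+1.
  have /andP[h1 h2] := str_bounds w_nil w_split N u01.
  have : 0 < w (str w N u) by rewrite -(ltrD2l (left_end w (str w N u))) addr0 (le_lt_trans h1).
  move=> /w_cell[y yN].
  have yb k : (k < N)%N -> bit k y = ubit w k u.
    by move=> kN; rewrite yN ?size_str// str_mkseq nth_mkseq.
  have : bit (code i a') y by rewrite yb ?ltnS ?leq_maxl.
  have : ~~ bit (code i b) y by rewrite yb ?ltnS ?leq_maxr.
  by rewrite !bit_code -ltNge => /ltW h3 /le_trans; apply.
set S := esups _ _.
have Sa : ((ratr a)%:E <= S)%E.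
  apply: ereal_sup_ubound; exists (pickle a) => //=.
  by rewrite /coordk pickleK ua.
have Sb : (S <= (ratr b)%:E)%E.
  apply: ge_ereal_sup => _ [k _ <-]; rewrite /coordk.
  case: (unpickle k : option rat) => [a'|]; last exact: leNye.
  by case: ifPn => [/Hle h|_]; [rewrite lee_fin|exact: leNye].
have Sfin : S \is a fin_num.
  by rewrite fin_real// (lt_le_trans (ltNyr _) Sa) (le_lt_trans Sb (ltry _)).
by rewrite -!lee_fin fineK// Sa Sb.
Qed.

(** The uniform variable and [kap] are glued along n bits, those of the tree on one side and those
    of the point on the other. The K cell masses differ by less than e / 2 / K each, so the mismatch
    costs e / 2; points beyond M, where [bits_close] does not apply, cost the other e / 2. *)
Lemma ultra_near : exists lam : PM, forall e : R, 0 < e -> FF [set kap : PM | near e lam kap].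
Proof.
pose lam : PM := distribution U (mfun_Sub (mem_set measurable_Xlim)).
exists lam => e e0; have e2 : 0 < e / 2 by rewrite divr_gt0.
have [M HM] := FF_tight e2.
have [n Hn] := @bits_close R d e M%:R e0 (ler0n _ M).
pose K : R := #|{: n.-tuple bool}|%:R.
have K0 : 0 < K by rewrite ltr0n card_tuple expn_gt0 card_bool.
have HW : FF [set kap : PM | forall s : n.-tuple bool, `|fine (kap (cell s)) - w s| < e / 2 / K].
  apply: filter_forall => s; apply: w_lim.
  by rewrite divr_gt0.
apply: filterS (filterI HM HW) => kap [farM Hw].
pose i1 (u : measurableTypeR R) : n.-tuple bool := [tuple of mkseq (ubit w ^~ u) n].
pose i2 (x : Rd R d) : n.-tuple bool := prefix n x.
have i1E (s : n.-tuple bool) : i1 @^-1` [set s] = [set u | str w (size s) u = s].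
  apply/seteqP; split=> u /=; first by move=> <-; rewrite /= size_mkseq str_mkseq.
  by rewrite size_tuple str_mkseq => h; apply: val_inj.
have m1 s : measurable (i1 @^-1` [set s]) by rewrite i1E; exact: measurable_str.
have m2 s : measurable (i2 @^-1` [set s]) by exact: measurable_prefix.
have [G [GA GB Gne]] := gluing U kap m1 m2.
have Gne2 : (G [set z | i1 z.1 != i2 z.2] <= (e / 2)%:E)%E.
  apply: (le_trans Gne); rewrite lee_fin.
  apply: (@le_trans _ _ (\sum_(s : n.-tuple bool) (e / 2 / K))); last first.
    by rewrite sumr_const -[_ *+ _]mulr_natr divfK// gt_eqF.
  apply: ler_sum => s _; rewrite i1E cellE.
  have -> : fine (U [set u | str w (size s) u = s]) = w s.
    by have /= -> := uniform_str w_ge0 w_nil w_split s.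
  rewrite ge_max (ltW (divr_gt0 e2 K0)) andbT.
  by have := Hw s; rewrite ltr_norml => /andP[h _]; lra.
have m11 : measurable_fun setT (fun t : measurableTypeR R * Rd R d => Xlim t.1).
  exact: (measurableT_comp measurable_Xlim measurable_fst).
have m22 : measurable_fun setT (fun t : measurableTypeR R * Rd R d => t.2).
  exact: measurable_snd.
have [A mA|A mA|h [ch hE _]] := @couplings_push R d _ _ G _ _ lam kap m11 m22.
- have mXA : measurable (Xlim @^-1` A) by rewrite -[X in measurable X]setTI; exact: measurable_Xlim.
  transitivity (U (Xlim @^-1` A)); last by [].
  by rewrite -GA//; congr (G _); apply/seteqP; split=> t //= [].
- by rewrite -GB//; congr (G _); apply/seteqP; split=> t //= [].
exists h => //; rewrite hE.
pose far := [set x : Rd R d | M%:R < eucl (x : 'rV[R]_d)].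
have mfar : measurable far by exact: measurable_gt_eucl.
pose D1 : set (measurableTypeR R * Rd R d) := setT `*` far.
pose D2 : set (measurableTypeR R * Rd R d) := [set t | i1 t.1 != i2 t.2].
(* The limit map is compatible with its bits only for u in [0, 1); the rest of the real line is
   null. *)
pose D3 : set (measurableTypeR R * Rd R d) := (~` `[0%R, 1%R[%classic) `*` setT.
have mD1 : measurable D1 by apply: measurableX.
have mD2 : measurable D2.
  rewrite (_ : D2 = \bigcup_(p in [set p | p.1 != p.2]) ((i1 @^-1` [set p.1]) `*` (i2 @^-1` [set p.2]))).
    apply: fin_bigcup_measurable => [|p _]; first exact: finite_finset.
    exact: measurableX.
  apply/seteqP; split=> t /=; first by move=> ne; exists (i1 t.1, i2 t.2).
  by move=> [p /= ne [/= E E']]; rewrite /D2/= E E'.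
have mI : measurable (~` `[0%R, 1%R[%classic : set (measurableTypeR R)) by exact: measurableC.
have mD3 : measurable D3 by apply: measurableX.
have GD1 : (G D1 <= (e / 2)%:E)%E by rewrite GB.
have GD3 : (G D3 <= 0)%E.
  rewrite GA// probability_setC//.
  have /= -> := uniform01_itv (lexx (0 : R)) ler01 (lexx 1).
  by rewrite subr0 subee.
apply: (@le_trans _ _ (G ((D1 `|` D2) `|` D3))).
  apply: le_measure; rewrite ?inE.
  - have m12 : measurable_fun setT (fun t : measurableTypeR R * Rd R d => (Xlim t.1, t.2)).
      exact: measurable_fun_pair.
    by have := m12 measurableT _ (measurable_apart e); rewrite setTI.
  - by apply: measurableU => //; exact: measurableU.
  - move=> t; rewrite /apart/= => te; apply: contrapT.
    move=> /not_orP[/not_orP[n1 n2] n3].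
    have u01 : 0 <= t.1 < 1.
      by apply/negPn/negP => h1; apply: n3; split => //=; rewrite in_itv/=; exact/negP.
    have xM : eucl (t.2 : 'rV[R]_d) <= M%:R by rewrite leNgt; apply/negP => h1; apply: n1.
    have d4 : i1 t.1 = i2 t.2 by apply/eqP/negPn/negP => h1; apply: n2.
    have bk k : (k < n)%N -> bit k t.2 = ubit w k t.1.
      move=> kn; have /(congr1 (fun s : n.-tuple bool => nth false s k)) := d4.
      by rewrite /= !nth_mkseq.
    have := Hn _ _ _ xM bk (compat_Xlim u01).
    by rewrite eucl_subC leNgt => /negP; apply; exact: te.
have -> : e%:E = ((e / 2)%:E + (e / 2)%:E + 0)%E by rewrite adde0 -EFinD -splitr.
apply: (le_trans (measureU2 _ _ mD3)); first exact: measurableU.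
apply: leeD => //; apply: (le_trans (measureU2 _ mD1 mD2)).
exact: leeD.
Qed.

End limit.

(** * From tightness to Prohorov compactness *)

Section prohorov_compact.
Variables (R : realType) (d : nat).
Local Open Scope ereal_scope.
Notation PM := (probability (Rd R d) R).

Lemma dP_sym (mu nu : PM) (c : R) : dP mu nu < c%:E -> dP nu mu < c%:E.
Proof.
move=> /dP_lt[e [e0 ec H]]; apply: (@le_lt_trans _ _ e%:E); last by rewrite lte_fin.
by apply: dP_le => // B /H[].
Qed.

Lemma dP_trans (mu nu rho : PM) (a b : R) : dP mu nu < a%:E -> dP nu rho < b%:E ->
  dP mu rho < (a + b)%:E.
Proof.
move=> /dP_lt[e [e0 ea He]] /dP_lt[f [f0 fb Hf]].
apply: (@le_lt_trans _ _ (e + f)%:E); last by rewrite lte_fin ltrD.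
have NN (B : set (Rd R d)) (s t : R) : eps_nbhd (eps_nbhd B s) t `<=` eps_nbhd B (s + t).
  move=> x [y [z Bz yz] xy]; exists z => //.
  have -> : (x - z = (y - z) + (x - y))%R by rewrite [RHS]addrC addrA subrK.
  by rewrite (le_lt_trans (ler_euclD _ _))// ltrD.
have le_nbhd (P : PM) (B : set (Rd R d)) (s t : R) :
    P (eps_nbhd (eps_nbhd B s) t) <= P (eps_nbhd B (s + t)).
  apply: le_measure; rewrite ?inE; [exact: eps_nbhd_measurable|exact: eps_nbhd_measurable|].
  exact: NN.
apply: dP_le; first by rewrite addr_gt0.
move=> B mB; split.
- apply: (le_trans (He _ mB).1).
  rewrite [X in _ <= _ + X%:E]addrC EFinD addeA leeD2r//.
  apply: (le_trans (Hf _ (eps_nbhd_measurable B e)).1).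
  by rewrite leeD2r// le_nbhd.
- apply: (le_trans (Hf _ mB).2); rewrite EFinD addeA leeD2r//.
  apply: (le_trans (He _ (eps_nbhd_measurable B f)).2).
  by rewrite leeD2r// [X in _ <= mu (eps_nbhd B X)]addrC le_nbhd.
Qed.

Lemma utight_rel_compact (A : set PM) : utight A -> rel_compact setT (@dP R d) A.
Proof.
move=> HA; apply: ultra_rel_compact => // FF uFF FFK.
have PF : ProperFilter FF := @ultra_proper _ _ uFF.
(* The ultrafilter lives on the closure of A, so tightness is first transferred from A to the
   closure, at the price of one unit in the level. *)
have HK (e : R) : (0 < e)%R -> exists n : nat,
    FF [set kap : PM | (kap [set x | (n%:R < eucl (x : 'rV[R]_d))%R] <= e%:E)].
  move=> e0; have e2 : (0 < e / 2)%R by rewrite divr_gt0.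
  have [n Hn] := HA _ e2; exists n.+1; apply: filterS FFK => kap [_ Kk].
  pose c : R := (Num.min 1 (e / 2))%R.
  have c0 : (0 < c)%R by rewrite lt_min ltr01.
  have [mu [Amu [_ /dP_sym kmu]]] := Kk c c0.
  apply: (le_trans (dP_far n.+1%:R kmu)).
  rewrite [in leRHS](splitr e) EFinD; apply: leeD; last by rewrite lee_fin ge_min lexx orbT.
  apply: le_trans (Hn mu Amu); apply: le_measure; rewrite ?inE; [exact: measurable_gt_eucl..|].
  move=> x /=; apply: le_lt_trans; rewrite -natr1 -addrA lerDl subr_ge0.
  by rewrite ge_min lexx.
have [lam Hlam] := ultra_near HK.
have near_small (r : R) : (0 < r)%R -> FF [set kap | dP lam kap < r%:E].
  move=> r0; have r4 : (0 < r / 4)%R by rewrite divr_gt0.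
  apply: filterS (Hlam _ r4) => kap /(near_dP r4)/le_lt_trans; apply.
  by rewrite lte_fin; lra.
exists lam; last by move=> r /near_small; apply: filterS => kap.
(* The limit is itself in the closure: some [kap] of the closure is close to it, and a member of A
   is close to [kap]. *)
split=> // r r0; have r2 : (0 < r / 2)%R by rewrite divr_gt0.
have [kap [/= lk [_ Kk]]] := filter_ex (filterI (near_small _ r2) FFK).
have [mu [Amu [_ kmu]]] := Kk _ r2; exists mu; split=> //; split=> //.
by rewrite (splitr r); exact: dP_trans lk kmu.
Qed.

End prohorov_compact.

(** * From uniform moment tails to Wasserstein compactness *)

Section wasserstein_limit.
Variables (R : realType) (d : nat) (r : R).
Hypothesis r1 : 1 <= r.
Local Open Scope ereal_scope.
Notation PM := (probability (Rd R d) R).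

Let r0 : (0 < r)%R := lt_le_trans ltr01 r1.

Lemma tail_moment_mono n m (mu : PM) : (n <= m)%N -> tail_moment r m mu <= tail_moment r n mu.
Proof.
move=> nm; apply: ge0_le_integral => //.
- by move=> x _; rewrite lee_fin powR_ge0.
- exact: measurable_overshoot_pow.
- exact: measurable_overshoot_pow.
- move=> x _; rewrite lee_fin ler_powR_ge0 ?overshoot_ge0//.
  rewrite ge_max overshoot_ge0 andbT le_max; apply/orP; left.
  by rewrite lerB// ler_nat.
Qed.

Let trunc n (T : nat) (x : Rd R d) : R := Num.min (overshoot n x) T%:R.

Let trunc_ge0 n T x : (0 <= trunc n T x)%R.
Proof. by rewrite le_min overshoot_ge0 ler0n. Qed.

Let measurable_trunc n T : measurable_fun setT (fun x => (trunc n T x `^ r)%:E).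
Proof.
apply/measurable_EFinP; apply: (measurableT_comp (measurable_powR _)).
by apply: measurable_minr; [exact: measurable_overshoot|exact: measurable_cst].
Qed.

(** Where the points are within e <= 1, the overshoot over n + 1 of one is at most the overshoot
    over n of the other; elsewhere truncation bounds it by T. This is the origin of the shift by one
    level. *)
Let trunc_near n T (e tau : R) (lam kap : PM) : (0 < e)%R -> (e <= 1)%R -> near e lam kap ->
  tail_moment r n kap <= tau%:E ->
  \int[lam]_x (trunc n.+1 T x `^ r)%:E <= (tau + T%:R `^ r * e)%:E.
Proof.
move=> e0 e1 [g cg ge] tk.
have <- : \int[g]_z (trunc n.+1 T z.1 `^ r)%:E = \int[lam]_x (trunc n.+1 T x `^ r)%:E.
  apply: (coupling_fst cg (measurable_trunc n.+1 T)) => x.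
  by rewrite lee_fin powR_ge0.
have T2 : \int[g]_z (overshoot n z.2 `^ r)%:E = tail_moment r n kap.
  apply: (coupling_snd cg (measurable_overshoot_pow r n)) => x.
  by rewrite lee_fin powR_ge0.
have mo : measurable_fun setT (fun z : Rd R d * Rd R d => (overshoot n z.2 `^ r)%:E).
  exact: (measurableT_comp (measurable_overshoot_pow r n) measurable_snd).
have mA : measurable_fun setT (fun z : Rd R d * Rd R d => (T%:R `^ r)%:E * (\1_(apart e) z)%:E).
  by apply: measurable_funeM; apply/measurable_EFinP/measurable_indic; exact: measurable_apart.
have IA : \int[g]_z ((T%:R `^ r)%:E * (\1_(apart e) z)%:E) <= (T%:R `^ r * e)%:E.
  rewrite ge0_integralZl_EFin ?powR_ge0//; last first.
    by apply/measurable_EFinP/measurable_indic; exact: measurable_apart.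
  rewrite (integral_indic g measurableT (measurable_apart e)) setIT EFinM.
  by rewrite lee_wpmul2l// lee_fin powR_ge0.
apply: (@le_trans _ _ (\int[g]_z ((overshoot n z.2 `^ r)%:E + (T%:R `^ r)%:E * (\1_(apart e) z)%:E))).
  apply: ge0_le_integral => //.
  - by move=> z _; rewrite lee_fin powR_ge0.
  - exact: (measurableT_comp (measurable_trunc n.+1 T) measurable_fst).
  - exact: emeasurable_funD.
  move=> z _; rewrite -EFinM -EFinD lee_fin indicE; case: (boolP (z \in apart e)) => h.
    rewrite mulr1 (@le_trans _ _ (T%:R `^ r)%R)// ?lerDr ?powR_ge0//.
    by rewrite ler_powR_ge0 ?trunc_ge0// ge_min lexx orbT.
  move: h; rewrite notin_setE /apart/= => /negP; rewrite -leNgt => h.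
  rewrite mulr0 addr0 ler_powR_ge0 ?trunc_ge0 ?overshoot_ge0//.
  apply: (@le_trans _ _ (overshoot n.+1 z.1)); first by rewrite ge_min lexx.
  rewrite ge_max overshoot_ge0 andbT le_max; apply/orP; left.
  have := eucl_dist (z.1 : 'rV[R]_d) z.2; rewrite -/(dist z) -natr1.
  move: h e1; move: (eucl _) (eucl _) (dist z) (n%:R : R) => *; lra.
rewrite ge0_integralD//; last by move=> z _; rewrite lee_fin powR_ge0.
by rewrite T2 EFinD; apply: leeD.
Qed.

(** A Fatou-type argument: e tends to 0 for a fixed truncation T, then T grows and monotone
    convergence removes the truncation. *)
Lemma tail_moment_limit n (tau : R) (lam : PM) :
  (forall e : R, (0 < e)%R -> exists2 kap, near e lam kap & tail_moment r n kap <= tau%:E) ->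
  tail_moment r n.+1 lam <= tau%:E.
Proof.
move=> H.
have HT (T : nat) : \int[lam]_x (trunc n.+1 T x `^ r)%:E <= tau%:E.
  apply/lee_addgt0Pr => e e0; pose c : R := (Num.min 1 (e / (T%:R `^ r + 1)))%R.
  have Tp : (0 < T%:R `^ r + 1 :> R)%R by rewrite ltr_wpDl// powR_ge0.
  have c0 : (0 < c)%R by rewrite lt_min ltr01 divr_gt0.
  have c1 : (c <= 1)%R by rewrite ge_min lexx.
  have [kap lk tk] := H c c0; apply: (le_trans (trunc_near T c0 c1 lk tk)).
  rewrite -EFinD lee_fin lerD2l.
  apply: (@le_trans _ _ ((T%:R `^ r + 1) * c)%R); first by rewrite ler_wpM2r ?lerDl// ltW.
  by rewrite mulrC -ler_pdivlMr// ge_min lexx orbT.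
pose f (T : nat) (x : Rd R d) : \bar R := (trunc n.+1 T x `^ r)%:E.
have f0 T x : 0 <= f T x by rewrite lee_fin powR_ge0.
have cvg : \int[lam]_x f T x @[T --> \oo] --> \int[lam]_x limn (f ^~ x).
  apply: cvg_monotone_convergence => //.
  - by move=> T; exact: measurable_trunc.
  - move=> x _ T T' TT'; rewrite lee_fin ler_powR_ge0 ?trunc_ge0//.
    by rewrite le_min ge_min lexx/= ge_min ler_nat TT' orbT.
have -> : tail_moment r n.+1 lam = \int[lam]_x limn (f ^~ x).
  apply: eq_integral => x _; apply/esym/cvg_lim => //.
  apply: cvg_near_cst; near=> T; rewrite /f; congr (_ `^ _)%:E.
  apply: min_l; near: T; exact: nbhs_infty_ger.
by apply: (cvge_le _ cvg); exact: nearW.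
Unshelve. all: by end_near. Qed.

Lemma uexcess_rel_compact (A : set PM) : uexcess r A -> rel_compact (Mr r) (dW r) A.
Proof.
move=> HA.
have AM : A `<=` Mr r.
  move=> mu Amu; have [n Hn] := HA 1%R ltr01.
  by apply: (@tail_moment_Mr R d r r1 n); apply: (le_lt_trans (Hn mu Amu)); rewrite ltry.
apply: ultra_rel_compact => // FF uFF FFK.
have PF : ProperFilter FF := @ultra_proper _ _ uFF.
set K := mclosure _ _ A in FFK.
have AK : A `<=` K.
  move=> mu Amu; split; first exact: AM.
  move=> c c0; exists mu; split; first exact: Amu.
  by split; [exact: AM|exact: dW_refl].
(* The bound passes from A to its closure because the r-th root of the tail moment is 1-Lipschitz: v
   is the root of e, and half of it is spent on the distance. *)
have HK : uexcess r K.
  move=> e e0; pose v : R := (e `^ r^-1)%R.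
  have v0 : (0 < v)%R by rewrite powR_gt0.
  have v2 : (0 < v / 2)%R by rewrite divr_gt0.
  have v4 : (0 < v / 4)%R by rewrite divr_gt0.
  have v2r : (0 < (v / 2) `^ r)%R by rewrite powR_gt0.
  have [n Hn] := HA _ v2r; exists n => kap [_ Kk].
  have [mu [Amu [_ /(dW_sym r0 v4) kmu]]] := Kk _ v4.
  (* [dW_sym] turns the strict bound into a weak one; starting from v / 4 restores strictness below
     v / 2. *)
  have {}kmu : dW r mu kap < (v / 2)%:E by rewrite (le_lt_trans kmu)// lte_fin; lra.
  have tmu : poweR (tail_moment r n mu) r^-1 <= (v / 2)%:E.
    rewrite -(powRK (s := r) (x := v / 2)) ?gt_eqF ?(ltW v2)// -poweR_EFin.
    apply: gt0_ler_poweR; [by rewrite invr_ge0 ltW| | |exact: Hn].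
      by rewrite in_itv/= leey andbT tail_moment_ge0.
    by rewrite in_itv/= leey andbT lee_fin ltW.
  have fmu : poweR (tail_moment r n mu) r^-1 \is a fin_num.
    by rewrite ge0_fin_numE ?poweR_ge0// (le_lt_trans tmu) ?ltry.
  have tk := tail_moment_dW r1 v2 fmu kmu.
  have {}tk : poweR (tail_moment r n kap) r^-1 <= v%:E.
    apply: (le_trans (ltW tk)); rewrite [in leRHS](splitr v) EFinD.
    by rewrite leeD2r.
  rewrite -(poweRVK (s := r) (y := tail_moment r n kap)) ?gt_eqF ?tail_moment_ge0//.
  rewrite -(powRVK (s := r) (x := e)) ?gt_eqF ?(ltW e0)// -poweR_EFin.
  apply: gt0_ler_poweR; [exact: ltW| | |exact: tk].
    by rewrite in_itv/= leey andbT poweR_ge0.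
  by rewrite in_itv/= leey andbT lee_fin ltW.
have FFtight (e : R) : (0 < e)%R -> exists n : nat,
    FF [set kap : PM | (kap [set x | (n%:R < eucl (x : 'rV[R]_d))%R] <= e%:E)].
  move=> /(uexcess_tight r1 HK)[n Hn]; exists n.
  exact: filterS FFK.
have [lam Hlam] := ultra_near FFtight.
have Htail n (tau : R) : (forall kap, K kap -> tail_moment r n kap <= tau%:E) ->
    tail_moment r n.+1 lam <= tau%:E.
  move=> Hn; apply: tail_moment_limit => e e0.
  by have [kap [/= lk Kk]] := filter_ex (filterI (Hlam _ e0) FFK); exists kap => //; exact: Hn.
have lamM : Mr r lam.
  have [n Hn] := HK 1%R ltr01.
  by apply: (@tail_moment_Mr R d r r1 n.+1); rewrite (le_lt_trans (Htail _ _ Hn)) ?ltry.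
have close (c : R) : (0 < c)%R -> exists2 e : R, (0 < e)%R &
    forall kap, K kap -> near e lam kap -> dW r lam kap < c%:E.
  move=> c0; have [tau tau0 Htau] := @near_dW R d r r1 c c0.
  have [n Hn] := HK _ tau0; have [e e0 He] := Htau n.+1.
  exists e => // kap Kk lk; apply: He => //; first exact: Htail.
  by apply: le_trans (Hn _ Kk); exact: tail_moment_mono.
exists lam.
(* To place the limit in the closure, the Wasserstein bounds are turned into [near], composed by
   [near_trans] with e / 3, and turned back using the common tail bound. *)
- split=> // c c0; have [e e0 He] := close c c0.
  have e3 : (0 < e / 3)%R by rewrite divr_gt0.
  have [kap [/= lk [_ Kk]]] := filter_ex (filterI (Hlam _ e3) FFK).
  have [c' c'0 Hc'] := @dW_near R d r _ r0 e3.
  have [mu [Amu [_ /Hc' kmu]]] := Kk _ c'0.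
  exists mu; split; first exact: Amu.
  split; first exact: AM.
  apply: He; first exact: AK.
  by have := near_trans e3 lk kmu; rewrite (_ : 3 * (e / 3) = e)%R//; lra.
- move=> c c0; have [e e0 He] := close c c0.
  apply: filterS (filterI (Hlam _ e0) FFK) => kap [lk Kk].
  by split; [exact: (proj1 Kk)|exact: He].
Qed.

End wasserstein_limit.

Lemma unif_rel_compactE (R : realType) (d : nat) (I : Type) (X : I -> RVec R d) (r : R) : 1 <= r ->
  unif_r_integrable X r <-> rel_compact (Mr r) (dW r) (laws X).
Proof.
move=> r1; have r0 := lt_le_trans ltr01 r1; split.
  by move=> /(unifE _ r0)/(uexcess_rel_compact r1).
by move=> /(dW_rel_compact_uexcess r1)/(unifE _ r0).
Qed.

Lemma tight_rel_compactE (R : realType) (d : nat) (I : Type) (X : I -> RVec R d) :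
  tight X <-> rel_compact setT (@dP R d) (laws X).
Proof.
split; first by move=> /tightE/utight_rel_compact.
by move=> /dP_rel_compact_tight/tightE.
Qed.

Theorem mainTheorem7 (R : realType) (d : nat) (p q : R) :
  0 < p -> p < 1 -> 1 < q -> (0 < d)%N ->
  (forall (I : Type) (X : I -> RVec R d),
     (* (1) <-> {|X_i|^q} st-bounded by an integrable r.v. *)
     (prop1 q X <->
        exists Y, integrableY Y /\ st_bounded X (fun i => nrmp (X i) q) Y) /\
     (* (1) <-> {|X_i|} icx-bounded by a q-integrable r.v. *)
     (prop1 q X <->
        exists Y, r_integrableY q Y /\ icx_bounded X (fun i => nrm (X i)) Y) /\
     (* (2) <-> uniformly q-integrable *)
     (prop2 q X <-> unif_r_integrable X q) /\
     (* (2) <-> laws relatively compact in (M_q, d_{W,q}) *)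
     (prop2 q X <-> rel_compact (Mr q) (dW q) (laws X)) /\
     (* (3) <-> laws bounded in (M_q, d_{W,q}) *)
     (prop3 q X <-> mbounded (Mr q) (dW q) (laws X)) /\
     (* (5) <-> uniformly integrable *)
     (prop5 X <-> unif_r_integrable X 1) /\
     (* (5) <-> laws relatively compact in (M_1, d_{W,1}) *)
     (prop5 X <-> rel_compact (Mr 1) (dW 1) (laws X)) /\
     (* (6) <-> laws bounded in (M_1, d_{W,1}) *)
     (prop6 X <-> mbounded (Mr 1) (dW 1) (laws X)) /\
     (* (7) <-> {|X_i|^p} st-bounded by an integrable r.v. *)
     (prop7 p X <->
        exists Y, integrableY Y /\ st_bounded X (fun i => nrmp (X i) p) Y) /\
     (* (8) <-> uniformly p-integrable *)
     (prop8 p X <-> unif_r_integrable X p) /\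
     (* (10) <-> tight *)
     (prop10 X <-> tight X) /\
     (* (10) <-> laws relatively compact in (M, d_P) *)
     (prop10 X <-> rel_compact setT (@dP R d) (laws X)) /\
     (* (1) => (2) => ... => (10) *)
     (forall k : nat, (1 <= k <= 9)%N -> prop p q X k -> prop p q X k.+1)) /\
  (* none of the nine implications can be reversed *)
  (forall k : nat, (1 <= k <= 9)%N ->
     exists (I : Type) (X : I -> RVec R d),
       prop p q X k.+1 /\ ~ prop p q X k).
Proof.
move=> p0 p1 q1 d0; have q0 : 0 < q := lt_trans ltr01 q1.
split; last by move=> k; exact: prop_irreversible.
move=> I X; have U2 : prop2 q X <-> unif_r_integrable X q by exact: unif_icxE.
split; first exact: prop1E.
split; first exact: prop1_icx.
split; first exact: U2.
split; first exact: iff_trans U2 (unif_rel_compactE X (ltW q1)).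
split; first exact: bounded_LrE.
split; first exact: prop5E.
split; first exact: iff_trans (prop5E X) (unif_rel_compactE X (lexx 1)).
split; first exact: bounded_LrE.
split; first exact: prop7E.
split; first exact: unif_icxE.
split; first exact: prop10E.
split; first exact: iff_trans (prop10E X) (tight_rel_compactE X).
by move=> k; exact: prop_chain.
Qed.
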